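(* Let $L\in\mathbb{R}^{N\times N}$ be positive definite, $\mathbf{b}\in\mathbb{R}^N$, let $\Xi=\{\xi_1,\dots,\xi_k\}\subset-\Sigma$ be a set of pairwise distinct poles, $V$ a matrix whose columns form a basis of $\mathcal{Q}_{k+1}^\Xi(L,\mathbf{b})$, $L_{k+1}=V^\dagger LV$, and $\mathbf{u}_{k+1}=Vf(L_{k+1})V^\dagger\mathbf{b}$. If $f\in\mathcal{LS}$ admits an extension (a complex, i.e. analytic, continuation) to $\mathbb{C}\setminus\mathbb{R}^-$, again denoted by $f$, such that $$c_f:=\int_{i\mathbb{R}}\left|\frac{f(\zeta)}{\zeta+\lambda_{\min}}\right|\,d\zeta<\infty,$$ then $$\|f(L)\mathbf{b}-\mathbf{u}_{k+1}\|\le\frac{C\,c_f}{\pi}\,\|\mathbf{b}\|\,\|r_\Xi\|_\Sigma.$$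
   Context: $\mathbb{R}^+=(0,\infty)$ and $\mathbb{R}^-=(-\infty,0)$ denote the strictly positive and strictly negative reals, so $\mathbb{C}\setminus\mathbb{R}^-$ contains $0$ and the whole imaginary axis $i\mathbb{R}$. The integral defining $c_f$ is taken with respect to arc length on $i\mathbb{R}$. $L\in\mathbb{R}^{N\times N}$ is a diagonalizable positive definite matrix with smallest and largest eigenvalues $\lambda_{\min},\lambda_{\max}$; $\Sigma=[\lambda_{\min},\lambda_{\max}]$. $\|\cdot\|$ is the Euclidean norm (and induced matrix norm), $\|\cdot\|_\Sigma$ the maximum norm on $\Sigma$. For poles $\Xi=\{\xi_1,\dots,\xi_k\}$: $q_k(\lambda)=\prod_{j=1}^k(\lambda-\xi_j)$, $\mathcal{Q}_{k+1}^\Xi(L,\mathbf{b})=q_k(L)^{-1}\operatorname{span}\{\mathbf{b},L\mathbf{b},\dots,L^k\mathbf{b}\}$, and $r_\Xi(\lambda)=\prod_{j=1}^k\frac{\lambda+\xi_j}{\lambda-\xi_j}$. $V\in\mathbb{C}^{N\times(k+1)}$, and $V^\dagger$ is the Moore-Penrose inverse of $V$. $C\le 11.08$ is the absolute constant of Crouzeix's estimate $\|f(L)\|\le 2C\|f\|_\Sigma$ and of the quasi-optimality estimate $\|f(L)\mathbf{b}-Vf(L_{k+1})V^\dagger\mathbf{b}\|\le 2C\|\mathbf{b}\|\min_{p\in\mathcal{P}_k}\|f-p/q_k\|_\Sigma$ ($\mathcal{P}_k$: polynomials of degree at most $k$); if $L$ is self-adjoint, $C=1$. $f:\mathbb{R}^+\to\mathbb{R}$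 belongs to $\mathcal{LS}$ (Laplace-Stieltjes functions) if $f(\lambda)=\int_0^\infty e^{-\zeta\lambda}\mu_L(\zeta)\,d\zeta$ for some positive real-valued function $\mu_L$ such that the integral is absolutely convergent; this class is identified, via Bernstein's theorem, with the class of completely monotonic functions on $\mathbb{R}^+$.
   Formalization: For non-symmetric L no absolute constant C satisfies the two cited estimates on Σ and the bound can fail; there C ≤ 11.08 is assumed to satisfy Crouzeix's estimate for this L and the quasi-optimality estimate for the given L, b, f, Ξ, V. For symmetric L, C = 1 and nothing is added. *)

(* Defs.v *)
From HB Require Import structures.
From mathcomp Require Import all_boot all_order all_algebra.
From mathcomp Require Import spectral mxred.
From mathcomp Require Import complex.
From mathcomp Require Import all_classical all_reals all_analysis.

Set Implicit Arguments.
Unset Strict Implicit.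
Unset Printing Implicit Defensive.

Import Order.TTheory GRing.Theory Num.Theory.
Import numFieldNormedType.Exports.

Local Open Scope classical_set_scope.
Local Open Scope ring_scope.
Local Open Scope complex_scope.
Local Open Scope sesquilinear_scope.

Section Norms.
Context {R : realType}.

(* The norm `|z| of R[i] is R[i]-valued; its modulus with values in R is normc. *)
Definition modulus (z : R[i]) : R := Normc.normc z.

(* The library norm on matrices is the entrywise maximum, not the Euclidean one. *)
Definition enorm (n : nat) (x : 'cV[R[i]]_n) : R :=
  Num.sqrt (\sum_i modulus (x i 0) ^+ 2).

Definition opnorm (n : nat) (A : 'M[R[i]]_n) : R :=
  sup [set enorm (A *m x) | x in [set x : 'cV[R[i]]_n | enorm x <= 1]].

Definition maxnorm (S : set R) (g : R[i] -> R[i]) : R :=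
  sup [set modulus (g x%:C) | x in S].

Definition toC (m n : nat) (A : 'M[R]_(m, n)) : 'M[R[i]]_(m, n) :=
  map_mx (fun x : R => x%:C) A.

End Norms.

Section Spectrum.
Context {R : realType}.

Definition positive_definite (n : nat) (L : 'M[R]_n) : Prop :=
  forall x : 'cV[R]_n, x != 0 -> 0 < (x^T *m L *m x) 0 0.

Definition lambda_min (n : nat) (L : 'M[R]_n) : R :=
  inf [set a | eigenvalue L a].

Definition lambda_max (n : nat) (L : 'M[R]_n) : R :=
  sup [set a | eigenvalue L a].

Definition Sigma (n : nat) (L : 'M[R]_n) : set R :=
  `[lambda_min L, lambda_max L].

End Spectrum.

Section MatrixFunctions.
Context {R : realType}.

(* Primary matrix function: f(A) = p(A) for any polynomial p that agrees with f,
   derivatives included, on the roots of the minimal polynomial of A up to their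
   multiplicities (all such p give the same p(A)).  When A is diagonalizable
   this is P diag(f(a_i)) P^-1.  The derivatives are needed because the
   compression of a diagonalizable matrix need not be diagonalizable. *)
Definition hermite_interpolates (n : nat) (f : R[i] -> R[i])
    (A : 'M[R[i]]_n.+1) (p : {poly R[i]}) : Prop :=
  forall (z : R[i]) (j : nat), (j < mup z (mxminpoly A))%N ->
    (p^`(j)%R).[z] = (f : R[i]^o -> R[i]^o)^`(j)%classic z.

Definition matfun (n : nat) (f : R[i] -> R[i]) (A : 'M[R[i]]_n.+1)
    : 'M[R[i]]_n.+1 :=
  horner_mx A (xget 0 [set p | hermite_interpolates f A p]).

Definition is_moore_penrose (m n : nat) (V : 'M[R[i]]_(m, n))
    (W : 'M[R[i]]_(n, m)) : Prop :=
  [/\ V *m W *m V = V, W *m V *m W = W,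
      (V *m W)^t* = V *m W & (W *m V)^t* = W *m V].

Definition moore_penrose (m n : nat) (V : 'M[R[i]]_(m, n)) : 'M[R[i]]_(n, m) :=
  xget 0 [set W | is_moore_penrose V W].

End MatrixFunctions.

Section RationalKrylov.
Context {R : realType}.

Definition pole_poly (k : nat) (xi : 'I_k -> R) : {poly R[i]} :=
  \prod_(j < k) ('X - ((xi j)%:C)%:P).

Definition pole_ratio (k : nat) (xi : 'I_k -> R) (z : R[i]) : R[i] :=
  \prod_(j < k) ((z + (xi j)%:C) / (z - (xi j)%:C)).

Definition rational_krylov (n k : nat) (L : 'M[R]_n.+1) (b : 'cV[R]_n.+1)
    (xi : 'I_k -> R) : set 'cV[R[i]]_n.+1 :=
  [set invmx (horner_mx (toC L) (pole_poly xi)) *m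
         (\sum_(j < k.+1) c j *: (toC L ^+ j *m toC b)) | c in [set: 'I_k.+1 -> R[i]]].

Definition columns_basis (n m : nat) (V : 'M[R[i]]_(n, m))
    (S : set 'cV[R[i]]_n) : Prop :=
  \rank V = m /\ S = range (fun c : 'cV[R[i]]_m => V *m c).

Definition krylov_approx (n k : nat) (f : R[i] -> R[i]) (L : 'M[R]_n.+1)
    (b : 'cV[R]_n.+1) (V : 'M[R[i]]_(n.+1, k.+1)) : 'cV[R[i]]_n.+1 :=
  V *m matfun f (moore_penrose V *m toC L *m V) *m moore_penrose V *m toC b.

(* Both estimates are predicates of the given data: no C satisfies either of them
   uniformly over all non-symmetric L.  The test functions g are continuous on
   Sigma L so that the supremum in maxnorm is a genuine maximum. *)
Definition crouzeix_estimate (n : nat) (L : 'M[R]_n.+1) (C : R) : Prop :=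
  forall g : R[i] -> R[i],
    {within Sigma L, continuous (fun x : R => (g x%:C : R[i]^o))} ->
    opnorm (matfun g (toC L)) <= 2 * C * maxnorm (Sigma L) g.

Definition quasi_optimality (n k : nat) (f : R[i] -> R[i]) (L : 'M[R]_n.+1)
    (b : 'cV[R]_n.+1) (xi : 'I_k -> R) (V : 'M[R[i]]_(n.+1, k.+1)) (C : R)
    : Prop :=
  enorm (matfun f (toC L) *m toC b - krylov_approx f L b V)
  <= 2 * C * enorm (toC b) *
     inf [set maxnorm (Sigma L) (fun z => f z - p.[z] / (pole_poly xi).[z])
         | p in [set p : {poly R[i]} | (size p <= k.+1)%N]].

End RationalKrylov.

Section LaplaceStieltjes.
Context {R : realType}.

(* mu_L(zeta) d zeta is read as a nonnegative Borel measure on [0, +oo[ (a density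
   is a special case): by Bernstein's theorem this is exactly the class of
   completely monotonic functions on ]0, +oo[. *)
Definition laplace_stieltjes (f : R -> R) : Prop :=
  exists mu : {measure set (measurableTypeR R) -> \bar R},
    forall x : R, 0 < x ->
      mu.-integrable `[0, +oo[ (fun z => (expR (- (z * x)))%:E) /\
      f x = Rintegral mu `[0, +oo[ (fun z => expR (- (z * x))).

(* C \ R^-, which contains 0 and is not a neighbourhood of it: an analytic
   extension is holomorphic on the interior and continuous up to 0. *)
Definition slit_plane : set R[i]^o :=
  [set z : R[i]^o | ~ (complex.Im z = 0 /\ complex.Re z < 0)].

Definition analytic_on_slit_plane (F : R[i]^o -> R[i]^o) : Prop :=
  {within slit_plane, continuous F} /\
  (forall z, (slit_plane)° z -> derivable F z 1).

(* Arc length on the imaginary axis is parametrized by zeta = iy. *)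
Definition axis_integral (F : R[i] -> R[i]) (a : R) : \bar R :=
  (\int[lebesgue_measure]_(y in [set: R])
     (modulus (F (0 +i* y) / (0 +i* y + a%:C)))%:E)%E.

End LaplaceStieltjes.

(* Main.v *)
(* The idea goes back to Hermite and Walsh. If p / q_k interpolates f at the
   mirrored poles -xi_j, the interpolation error at x is r_Xi(x) times a Cauchy
   integral of f over the imaginary axis with kernel 1 / (r_Xi(z) (z - x)). As
   |r_Xi| = 1 on that axis, the error is at most |r_Xi(x)| c_f / (2 pi), and
   quasi-optimality concludes. The interpolant is linear in f and explicit for
   the Cauchy kernels, so only the formula f(a) = (1 / 2 pi) int f(iy) / (a - iy) dy
   for a > 0 has to come from complex analysis. The growth of f in the right
   half-plane, which closing the contour requires, is controlled because f
   coincides there with the Laplace transform of its measure. *)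
Require Import Defs.
From HB Require Import structures.
From mathcomp Require Import all_boot all_order all_algebra.
From mathcomp Require Import spectral mxred.
From mathcomp Require Import complex.
From mathcomp Require Import all_classical all_reals all_analysis.
From mathcomp Require Import measurable_realfun zify ring lra.
Import Order.TTheory GRing.Theory Num.Theory.
Import numFieldNormedType.Exports.
Local Open Scope classical_set_scope.
Local Open Scope ring_scope.
Local Open Scope complex_scope.

(** * Cauchy's theorem on rectangles *)

(** The origin lies on the boundary of the slit plane, so [F] is only continuous there, and Cauchy's
    theorem must hold for functions merely continuous up to a vertical side. A bounded [F] does not
    make far sides negligible for the kernel 1 / (z - a): length T meets decay 1 / T. The kernel 1 /
    (z^2 - a^2) decays fast enough, and on the axis it is, up to sign, the Poisson kernel; applied
    to F(z) (z + a) it restores the Cauchy kernel, at the price of a factor b / (z + b) that keeps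
    this function bounded and disappears as b grows. Since [f], the nodes and the interpolation
    weights are real, real parts of contour integrals suffice. The kernels of the interpolation
    error are summed before moduli are taken, since separate estimates would lose the factor
    r_Xi(x). For symmetric [L] quasi-optimality with [C = 1] is derived, not assumed: the Krylov
    space reproduces p / q_k exactly and the eigenvalues of the compression stay in [Sigma L], so
    the error is a difference of two vectors, each bounded by the uniform error of p / q_k times the
    norm of b. *)

Section SegmentIntegral.
Context {R : realType}.
Implicit Types (f g : R -> R) (a b c x y : R).
Local Notation mu := (@lebesgue_measure R).
Local Notation "\int_ [ a , b ] f" := (Rintegral mu `[a, b]%classic f)
  (at level 36, a, b at level 50, f at level 36).

Lemma within_continuousP (A : set R) f :
  (forall x, A x -> forall e, 0 < e -> exists2 d, 0 < d &
     forall y, A y -> `|y - x| < d -> `|f y - f x| <= e) <->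
  {within A, continuous f}.
Proof.
rewrite subspace_continuousP; split=> [cf x Ax|cf x Ax e e0].
  apply/cvgrPdist_le => /= e e0; have [d d0 fd] := cf x Ax e e0.
  rewrite /nbhs /= /within /=; apply/nbhs_ballP; exists d => //= y.
  by rewrite /ball /= => xy Ay; rewrite distrC; apply: fd => //; rewrite distrC.
move/cvgrPdist_le/(_ _ e0): (cf x Ax); rewrite /nbhs /= /within /=.
move=> /nbhs_ballP[d /= d0 fd]; exists d => // y Ay xy.
rewrite distrC; apply: fd => //=; by rewrite /ball /= distrC.
Qed.

Lemma integrable_segment f a b :
  {within `[a, b], continuous f} -> mu.-integrable `[a, b] (EFin \o f).
Proof. move=> cf; apply: continuous_compact_integrable => //; exact: segment_compact. Qed.

Lemma segment_integral_split f a c b : a <= c -> c <= b ->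
  {within `[a, b], continuous f} ->
  \int_[a, b] f = \int_[a, c] f + \int_[c, b] f.
Proof.
move=> ac cb cf; have fi := integrable_segment _ _ _ cf.
have := @Rintegral_itvB _ f (BLeft a) (BRight b) c fi.
rewrite !bnd_simp => /(_ ac cb) /eqP; rewrite subr_eq => /eqP ->.
rewrite Rintegral_itv_obnd_cbnd 1?addrC//.
apply: integrableS fi => //; apply: subset_itvr; by rewrite bnd_simp.
Qed.

Lemma segment_integral_cst a b k : a <= b -> \int_[a, b] (fun=> k) = k * (b - a).
Proof.
move=> ab; rewrite Rintegral_cst//= lebesgue_measure_itv/= lte_fin.
by case: ltgtP ab => /= [ab _|//|-> _]; rewrite ?subrr.
Qed.

Lemma within_continuous_segment_cst a b k : {within `[a, b], continuous (fun=> k : R)}.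
Proof. by apply: continuous_subspaceT => x; exact: cvg_cst. Qed.

Lemma segment_integral_approx f a b k e : a <= b ->
  {within `[a, b], continuous f} ->
  (forall x, a <= x <= b -> `|f x - k| <= e) ->
  `|\int_[a, b] f - k * (b - a)| <= e * (b - a).
Proof.
move=> ab cf fk; have fi := integrable_segment _ _ _ cf.
have ci r := integrable_segment _ a b (within_continuous_segment_cst a b r).
have h1 : \int_[a, b] f <= \int_[a, b] (fun=> k + e).
  apply: le_Rintegral => //= x; rewrite in_itv /= => /fk; rewrite ler_norml; lra.
have h2 : \int_[a, b] (fun=> k - e) <= \int_[a, b] f.
  apply: le_Rintegral => //= x; rewrite in_itv /= => /fk; rewrite ler_norml; lra.
move: h1 h2; rewrite !segment_integral_cst// ler_norml mulrDl mulrBl => h1 h2.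
by apply/andP; split; lra.
Qed.

Lemma segment_integralB f g a b :
  {within `[a, b], continuous f} -> {within `[a, b], continuous g} ->
  \int_[a, b] (fun x => f x - g x) = \int_[a, b] f - \int_[a, b] g.
Proof. by move=> cf cg; apply: RintegralB => //; exact: integrable_segment. Qed.

Lemma within_continuous_segmentS f a b c d : a <= c -> d <= b ->
  {within `[a, b], continuous f} -> {within `[c, d], continuous f}.
Proof.
move=> ac db; apply: continuous_subspaceW => x /=; rewrite !in_itv /=.
by case/andP=> cx xd; rewrite (le_trans ac cx) (le_trans xd db).
Qed.

End SegmentIntegral.

Notation "\int_ [ a , b ] f" := (Rintegral (@lebesgue_measure _) `[a, b]%classic f)
  (at level 36, a, b at level 50, f at level 36).

Section Green.
Context {R : realType}.
Implicit Types (u v : R -> R -> R) (a b c d x y e : R).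

(* The real part of the counterclockwise contour integral of [u + i v] along the
   boundary of the rectangle [a, b] x [c, d]. *)
Definition circulation u v a b c d : R :=
  (\int_[a, b] (u^~ c) - \int_[a, b] (u^~ d)) - (\int_[c, d] (v b) - \int_[c, d] (v a)).

(** [circulation] integrates [u] only along horizontal segments and [v] only along vertical ones;
    this much continuity lets these integrals be split and compared. *)
Definition separately_continuous u v a b c d : Prop :=
  (forall y, c <= y <= d -> {within `[a, b], continuous (u^~ y)}) /\
  (forall x, a <= x <= b -> {within `[c, d], continuous (v x)}).

(** The complex derivative is p + i q, and the linear terms are the two parts of (p + i q) (s + i
    t). An expansion in both variables at once replaces partial derivatives because Goursat's
    argument needs it on a whole neighbourhood. *)
Definition cauchy_riemann_at u v x y : Prop :=
  exists p q : R, forall e, 0 < e -> exists2 r : R, 0 < r & forall s t : R, `|s| < r -> `|t| < r ->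
    `|u (x + s) (y + t) - u x y - (p * s - q * t)| <= e * (`|s| + `|t|) /\
    `|v (x + s) (y + t) - v x y - (q * s + p * t)| <= e * (`|s| + `|t|).

Lemma separately_continuousS u v a b c d a' b' c' d' :
  a <= a' -> b' <= b -> c <= c' -> d' <= d ->
  separately_continuous u v a b c d -> separately_continuous u v a' b' c' d'.
Proof.
move=> aa bb cc dd [cu cv]; split=> z /andP[z1 z2].
  apply: within_continuous_segmentS aa bb (cu z _).
  by rewrite (le_trans cc z1) (le_trans z2 dd).
apply: within_continuous_segmentS cc dd (cv z _).
by rewrite (le_trans aa z1) (le_trans z2 bb).
Qed.

Lemma circulation_splitx u v a m b c d : a <= m -> m <= b -> c <= d ->
  separately_continuous u v a b c d ->
  circulation u v a b c d = circulation u v a m c d + circulation u v m b c d.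
Proof.
move=> am mb cd [cu cv]; rewrite /circulation.
rewrite (segment_integral_split _ _ _ _ am mb (cu c _)) ?lexx//.
rewrite (segment_integral_split _ _ _ _ am mb (cu d _)) ?lexx ?cd//; ring.
Qed.

Lemma circulation_splity u v a b c m d : c <= m -> m <= d -> a <= b ->
  separately_continuous u v a b c d ->
  circulation u v a b c d = circulation u v a b c m + circulation u v a b m d.
Proof.
move=> cm md ab [cu cv]; rewrite /circulation.
rewrite (segment_integral_split _ _ _ _ cm md (cv a _)) ?lexx//.
rewrite (segment_integral_split _ _ _ _ cm md (cv b _)) ?lexx ?ab//; ring.
Qed.

Lemma cauchy_riemann_continuous u v a b c d :
  (forall x y, a <= x <= b -> c <= y <= d -> cauchy_riemann_at u v x y) ->
  separately_continuous u v a b c d.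
Proof.
(* [K] is the slope |p| of the linear part, and the added 1 is the tolerance taken for the
   remainder. The alternative [K < 0] is excluded when [K] is a norm. *)
have small (e K : R) : 0 < e -> exists2 r : R, 0 < r & forall s : R, `|s| < r -> (K + 1) * `|s| <= e \/ K < 0.
  move=> e0; have [K0|K0] := leP 0 K; last by exists 1 => // s _; right.
  exists (e / (K + 1)); first by apply: divr_gt0; lra.
  move=> s; rewrite ltr_pdivlMr; last lra.
  by left; nra.
move=> cr; split=> z zI; apply/within_continuousP => w; rewrite /= in_itv /= => wI e e0.
  have [p [q h]] := cr _ _ wI zI; have [r r0 {}h] := h 1 ltr01.
  have [r' r'0 h'] := small e `|p| e0.
  exists (Num.min r r'); first by rewrite lt_min r0 r'0.
  move=> x _; rewrite lt_min => /andP[xr xr'].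
  have [||h1 _] := h (x - w) 0; rewrite ?normr0//.
  have [h2|] := h' _ xr'; last by rewrite ltNge normr_ge0.
  move: h1; rewrite addr0 (addrC w) subrK normr0 addr0 mulr0 subr0 mul1r => h1.
  have := ler_normD (u x z - u w z - p * (x - w)) (p * (x - w)); rewrite subrK normrM.
  lra.
have [p [q h]] := cr _ _ zI wI; have [r r0 {}h] := h 1 ltr01.
have [r' r'0 h'] := small e `|p| e0.
exists (Num.min r r'); first by rewrite lt_min r0 r'0.
move=> x _; rewrite lt_min => /andP[xr xr'].
have [||_ h1] := h 0 (x - w); rewrite ?normr0//.
have [h2|] := h' _ xr'; last by rewrite ltNge normr_ge0.
move: h1; rewrite addr0 (addrC w) subrK normr0 add0r mulr0 add0r mul1r => h1.
have := ler_normD (v z x - v z w - p * (x - w)) (p * (x - w)); rewrite subrK normrM.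
lra.
Qed.

(** The affine part has circulation 0: [u] differs by q (d - c) between the horizontal sides, [v] by
    q (b - a) between the vertical ones, and both integrate to q (b - a) (d - c). Only the remainder
    is left, at most e times the half-perimeter at each point. *)
Lemma circulation_local u v x y : cauchy_riemann_at u v x y ->
  forall e, 0 < e -> exists2 r : R, 0 < r & forall a b c d,
    a <= x <= b -> c <= y <= d -> b - a < r -> d - c < r ->
    separately_continuous u v a b c d ->
    `|circulation u v a b c d| <= 2 * e * ((b - a) + (d - c)) ^+ 2.
Proof.
move=> [p [q h]] e e0; have [r r0 {}h] := h e e0.
exists r => // a b c d /andP[ax xb] /andP[cy yd] bar dcr [cu cv].
have ab : a <= b by exact: le_trans xb.
have cd : c <= d by exact: le_trans yd.
set w := (b - a) + (d - c).
have est s t : a <= s <= b -> c <= t <= d ->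
    `|u s t - u x y - (p * (s - x) - q * (t - y))| <= e * w /\
    `|v s t - v x y - (q * (s - x) + p * (t - y))| <= e * w.
  move=> /andP[s1 s2] /andP[t1 t2].
  have sx : `|s - x| <= b - a.
    by move: ax xb s1 s2; clear; rewrite ler_norml => *; apply/andP; split; lra.
  have ty : `|t - y| <= d - c.
    by move: cy yd t1 t2; clear; rewrite ler_norml => *; apply/andP; split; lra.
  have [||h1 h2] := h (s - x) (t - y); [exact: le_lt_trans bar|exact: le_lt_trans dcr|].
  have H : e * (`|s - x| + `|t - y|) <= e * w by rewrite ler_pM2l// lerD.
  move: h1 h2; rewrite (addrC x) subrK (addrC y) subrK => h1 h2.
  by split; exact: le_trans H.
have Cu : `|\int_[a, b] (fun s => u s c - u s d) - q * (d - c) * (b - a)|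
          <= 2 * e * w * (b - a).
  apply: segment_integral_approx => //.
    by move=> s; apply: continuousB; [apply: cu|apply: cu]; rewrite lexx cd.
  move=> s sI; have [|h1 _] := est s c sI; first by rewrite lexx.
  have [|h2 _] := est s d sI; first by rewrite lexx cd.
  by move: h1 h2; clear; rewrite !ler_norml => /andP[? ?] /andP[? ?]; apply/andP; split; lra.
have Cv : `|\int_[c, d] (fun t => v b t - v a t) - q * (b - a) * (d - c)|
          <= 2 * e * w * (d - c).
  apply: segment_integral_approx => //.
    by move=> s; apply: continuousB; [apply: cv|apply: cv]; rewrite lexx ab.
  move=> t tI; have [|//|_ h1] := est b t; first by rewrite lexx ab.
  have [|//|_ h2] := est a t; first by rewrite lexx.
  by move: h1 h2; clear; rewrite !ler_norml => /andP[? ?] /andP[? ?]; apply/andP; split; lra.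
move: Cu Cv; rewrite !segment_integralB; last first.
- by apply: cu; rewrite lexx cd.
- by apply: cu; rewrite lexx.
- by apply: cv; rewrite lexx.
- by apply: cv; rewrite lexx ab.
rewrite -/(circulation u v a b c d) !ler_norml => /andP[h1 h2] /andP[h3 h4].
rewrite /circulation expr2 !mulrA; apply/andP; split; rewrite /w in h1 h2 h3 h4 *; nra.
Qed.
End Green.

Section Goursat.
Context {R : realType}.
Implicit Types (u v : R -> R -> R) (a b c d x y e : R).

(** The four quarters add up to the whole, so one of them carries at least a quarter of it. *)
Lemma circulation_bisect u v a b c d : a <= b -> c <= d ->
  separately_continuous u v a b c d ->
  exists a' b' c' d', [/\ a <= a' /\ b' <= b, c <= c' /\ d' <= d,
    b' - a' = (b - a) / 2, d' - c' = (d - c) / 2 &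
    `|circulation u v a b c d| <= 4 * `|circulation u v a' b' c' d'| ].
Proof.
move=> ab cd uv; set m := (a + b) / 2; set n := (c + d) / 2.
have [am mb cn nd] : [/\ a <= m, m <= b, c <= n & n <= d] by rewrite /m /n; split; lra.
have uvl : separately_continuous u v a m c d by exact: separately_continuousS uv.
have uvr : separately_continuous u v m b c d by exact: separately_continuousS uv.
rewrite (circulation_splitx _ _ _ m) // (circulation_splity _ _ a m c n)//.
rewrite (circulation_splity _ _ m b c n)//.
set J1 := circulation u v a m c n; set J2 := circulation u v a m n d.
set J3 := circulation u v m b c n; set J4 := circulation u v m b n d.
have tri : `|J1 + J2 + (J3 + J4)| <= `|J1| + `|J2| + (`|J3| + `|J4|).
  exact: le_trans (ler_normD _ _) (lerD (ler_normD _ _) (ler_normD _ _)).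
set J := `|J1 + J2 + (J3 + J4)| in tri *.
have [mL mR] : m - a = (b - a) / 2 /\ b - m = (b - a) / 2 by rewrite /m; split; field.
have [nL nR] : n - c = (d - c) / 2 /\ d - n = (d - c) / 2 by rewrite /n; split; field.
have [h1|h1] := leP J (4 * `|J1|); first by exists a, m, c, n.
have [h2|h2] := leP J (4 * `|J2|); first by exists a, m, n, d.
have [h3|h3] := leP J (4 * `|J3|); first by exists m, b, c, n.
exists m, b, n, d; split=> //; rewrite -/J -/J4.
by move: tri h1 h2 h3; rewrite /J; clear; lra.
Qed.

Lemma nested_intervals (a b : R ^nat) : (forall n, a n <= a n.+1) ->
  (forall n, b n.+1 <= b n) -> (forall n, a n <= b n) ->
  exists x, forall n, a n <= x <= b n.
Proof.
move=> ai bd ab.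
have amono n m : (n <= m)%N -> a n <= a m.
  by move=> nm; exact: (homo_leq (@lexx _ _) le_trans ai).
have bmono n m : (n <= m)%N -> b m <= b n.
  by move=> nm; apply: (homo_leq (r := fun x y => y <= x) (@lexx _ _)) => // y x z; move=> xy yz; exact: le_trans yz xy.
have anbm n m : a n <= b m.
  have [nm|/ltnW nm] := leqP n m; first exact: le_trans (amono _ _ nm) (ab m).
  exact: le_trans (ab n) (bmono _ _ nm).
exists (sup (range a)) => n; apply/andP; split.
  apply: ub_le_sup; last by exists n.
  by exists (b 0%N) => _ [m _ <-].
by apply: ge_sup; [exists (a 0%N), 0%N|move=> _ [m _ <-]].
Qed.

Lemma half_power_lt (w e : R) : 0 < e -> exists n : nat, w / 2 ^+ n < e.
Proof.
move=> e0; have [n wn] : exists n : nat, w / e < n%:R.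
  have [w0|w0] := ltP (w / e) 0; first by exists 0%N.
  by exists (Num.truncn (w / e)).+1; exact: truncnS_gt.
exists n; rewrite ltr_pdivrMr ?exprn_gt0// mulrC -ltr_pdivrMr//.
apply: lt_le_trans wn _.
by rewrite -natrX ler_nat ltnW// ltn_expl.
Qed.

(** Each bisection loses at most a factor 4 of the circulation and halves the sides. At the common
    point of the nested rectangles the local bound is quadratic in the size, so the factors 4^n
    cancel and an arbitrarily small tolerance remains. *)
Theorem goursat u v a b c d : a <= b -> c <= d ->
  (forall x y, a <= x <= b -> c <= y <= d -> cauchy_riemann_at u v x y) ->
  circulation u v a b c d = 0.
Proof.
move=> ab cd cr.
pose ok (Q : (R * R) * (R * R)) :=
  [/\ a <= Q.1.1, Q.1.2 <= b, c <= Q.2.1 & Q.2.2 <= d] /\ (Q.1.1 <= Q.1.2 /\ Q.2.1 <= Q.2.2).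
pose J (Q : (R * R) * (R * R)) := circulation u v Q.1.1 Q.1.2 Q.2.1 Q.2.2.
have sc Q : ok Q -> separately_continuous u v Q.1.1 Q.1.2 Q.2.1 Q.2.2.
  case=> -[h1 h2 h3 h4] _; apply: separately_continuousS h1 h2 h3 h4 _.
  exact: cauchy_riemann_continuous.
(* The bisection map has to be total to be iterated, hence the implication from [ok Q]; other
   quadruples are left unchanged. *)
have /choice[f fP] : forall Q, exists Q', ok Q -> [/\ ok Q',
    Q.1.1 <= Q'.1.1 /\ Q'.1.2 <= Q.1.2, Q.2.1 <= Q'.2.1 /\ Q'.2.2 <= Q.2.2,
    Q'.1.2 - Q'.1.1 = (Q.1.2 - Q.1.1) / 2 /\ Q'.2.2 - Q'.2.1 = (Q.2.2 - Q.2.1) / 2 &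
    `|J Q| <= 4 * `|J Q'|].
  move=> Q; have [okQ|nQ] := pselect (ok Q); last by exists Q.
  have [[h1 h2 h3 h4] [h5 h6]] := okQ.
  have [a' [b' [c' [d' [[aa bb] [cc dd] wE hE JE]]]]] := circulation_bisect _ _ _ _ _ _ h5 h6 (sc _ okQ).
  exists ((a', b'), (c', d')) => _; split=> //; split.
    by split; [exact: le_trans h1 aa|exact: le_trans bb h2|exact: le_trans h3 cc|exact: le_trans dd h4].
  by split; rewrite /= -subr_ge0 ?wE ?hE divr_ge0 ?subr_ge0.
pose Q n := iter n f ((a, b), (c, d)).
have Qok n : ok (Q n).
  elim: n => [|n ih]; first by rewrite /ok /=; do !split.
  by have [] := fP _ ih.
have size n : ((Q n).1.2 - (Q n).1.1) + ((Q n).2.2 - (Q n).2.1)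
   = ((b - a) + (d - c)) / 2 ^+ n.
  elim: n => [|n ih]; first by rewrite expr0 divr1.
  have [_ _ _ [-> ->] _] := fP _ (Qok n).
  by rewrite -/(Q n) -mulrDl ih exprS invfM mulrA [in RHS]mulrAC.
have big n : `|circulation u v a b c d| <= 4 ^+ n * `|J (Q n)|.
  elim: n => [|n ih]; first by rewrite mul1r.
  have [_ _ _ _ h] := fP _ (Qok n).
  apply: le_trans ih _; rewrite exprSr -mulrA ler_pM2l ?exprn_gt0//.
have [x xP] : exists x, forall n, (Q n).1.1 <= x <= (Q n).1.2.
  apply: nested_intervals => n; last by have [_ []] := Qok n.
    by have [_ [? ?] _ _ _] := fP _ (Qok n).
  by have [_ [? ?] _ _ _] := fP _ (Qok n).
have [y yP] : exists y, forall n, (Q n).2.1 <= y <= (Q n).2.2.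
  apply: nested_intervals => n; last by have [_ []] := Qok n.
    by have [_ _ [? ?] _ _] := fP _ (Qok n).
  by have [_ _ [? ?] _ _] := fP _ (Qok n).
have /circulation_local loc := cr x y (xP 0%N) (yP 0%N).
set w := (b - a) + (d - c) in size.
apply/eqP; rewrite -normr_le0; apply/ler_addgt0Pr => e e0; rewrite add0r.
have w0 : 0 <= w by rewrite /w; lra.
(* The added 1 keeps the tolerance e / (2 w^2 + 1) meaningful for a rectangle reduced to a point. *)
have den0 : 0 < 2 * w ^+ 2 + 1 by rewrite ltr_wpDl// mulr_ge0// sqr_ge0.
have e0' : 0 < e / (2 * w ^+ 2 + 1) by exact: divr_gt0.
have [r r0 hr] := loc _ e0'.
have [n nP] := half_power_lt w r r0.
have [[h1 h2 h3 h4] [h5 h6]] := Qok n.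
have {}hr := hr _ _ _ _ (xP n) (yP n) _ _ (sc _ (Qok n)).
have := size n; set W := w / 2 ^+ n in nP * => sz.
have {}hr : `|J (Q n)| <= 2 * (e / (2 * w ^+ 2 + 1)) * W ^+ 2.
  have W1 : (Q n).1.2 - (Q n).1.1 <= W by rewrite -sz lerDl subr_ge0.
  have W2 : (Q n).2.2 - (Q n).2.1 <= W by rewrite -sz lerDr subr_ge0.
  by rewrite -sz; apply: hr; [exact: le_lt_trans W1 nP|exact: le_lt_trans W2 nP].
apply: le_trans (big n) _.
have p4 : (4 : R) ^+ n = (2 ^+ n) ^+ 2 by rewrite (_ : 4 = 2 ^+ 2) -?exprM 1?mulnC// -natrX.
have p2 : (2 : R) ^+ n != 0 by rewrite expf_eq0 /= pnatr_eq0 andbF.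
have : 4 ^+ n * `|J (Q n)| <= 4 ^+ n * (2 * (e / (2 * w ^+ 2 + 1)) * W ^+ 2).
  by rewrite ler_pM2l ?exprn_gt0.
move=> /le_trans; apply.
have -> : 4 ^+ n * (2 * (e / (2 * w ^+ 2 + 1)) * W ^+ 2) = e * ((2 * w ^+ 2) / (2 * w ^+ 2 + 1)).
  by rewrite p4 /W; field; rewrite p2 gt_eqF.
by rewrite ler_piMr ?(ltW e0)// ler_pdivrMr// mul1r lerDl.
Qed.

End Goursat.

Section GoursatBoundary.
Context {R : realType}.
Implicit Types (u v : R -> R -> R) (a b c d x y e : R).

(** Moving a vertical side towards the boundary needs continuity that is uniform along the side;
    separate continuity does not give it. *)
Definition jointly_continuous u a b c d : Prop :=
  forall x y, a <= x <= b -> c <= y <= d -> forall e, 0 < e -> exists2 r : R, 0 < r &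
    forall s t, a <= s <= b -> c <= t <= d -> `|s - x| < r -> `|t - y| < r ->
      `|u s t - u x y| <= e.

Lemma jointly_continuousS u a b c d a' b' c' d' :
  a <= a' -> b' <= b -> c <= c' -> d' <= d ->
  jointly_continuous u a b c d -> jointly_continuous u a' b' c' d'.
Proof.
move=> aa bb cc dd cu.
have I s : a' <= s <= b' -> a <= s <= b by case/andP=> ? ?; apply/andP; split; lra.
have I' s : c' <= s <= d' -> c <= s <= d by case/andP=> ? ?; apply/andP; split; lra.
move=> x y /I xI /I' yI e e0; have [r r0 h] := cu x y xI yI e e0.
by exists r => // s t /I sI /I' tI; exact: h.
Qed.

Lemma jointly_continuous_separately u v a b c d :
  jointly_continuous u a b c d -> jointly_continuous v a b c d ->
  separately_continuous u v a b c d.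
Proof.
move=> cu cv; split=> z zI; apply/within_continuousP => w; rewrite /= in_itv /= => wI e e0.
  have [r r0 h] := cu _ _ wI zI _ e0; exists r => // s; rewrite in_itv /= => sI sw.
  by apply: h => //; rewrite subrr normr0.
have [r r0 h] := cv _ _ zI wI _ e0; exists r => // s; rewrite in_itv /= => sI sw.
by apply: h => //; rewrite subrr normr0.
Qed.

(** Compactness of [c, d], in its near-covering form, makes the radius independent of y. *)
Lemma jointly_continuous_uniform u a b c d x : a <= x <= b ->
  jointly_continuous u a b c d ->
  forall e, 0 < e -> exists2 r : R, 0 < r & forall s y, a <= s <= b -> `|s - x| < r ->
    c <= y <= d -> `|u s y - u x y| <= e.
Proof.
move=> xI cu e e0.
have cK : compact (`[c, d]%classic : set R) by exact: segment_compact.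
move/compact_near_coveringP: cK => /(_ R (nbhs x)
  (fun s y => a <= s <= b -> c <= y <= d -> `|u s y - u x y| <= e) _) [].
  move=> y; rewrite /= in_itv /= => yI; have e20 : 0 < e / 2 by lra.
  have [r r0 h] := cu x y xI yI _ e20.
  exists (ball y r, ball x r); first by split; exact: nbhsx_ballx.
  move=> [t s] /=; rewrite /ball /= => -[yt xs] sI tI.
  have h1 : `|u s t - u x y| <= e / 2 by apply: h => //; rewrite distrC.
  have h2 : `|u x t - u x y| <= e / 2.
    by apply: h => //; rewrite ?subrr ?normr0// distrC.
  by move: h1 h2; rewrite !ler_norml => /andP[? ?] /andP[? ?]; apply/andP; split; lra.
move=> r /= r0 h; exists r => // s y sI sx yI.
by apply: (h s) => //=; rewrite ?in_itv //= distrC.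
Qed.

(** In a thin strip the two vertical integrals nearly cancel by uniform continuity, and the two
    horizontal ones are taken over a short segment on which [u] is bounded. *)
Lemma circulation_thin u v a b c d x : c <= d -> a <= x <= b ->
  jointly_continuous u a b c d -> jointly_continuous v a b c d ->
  forall e, 0 < e -> exists2 r : R, 0 < r & forall a' b', a <= a' -> a' <= b' -> b' <= b ->
    `|a' - x| < r -> `|b' - x| < r -> `|circulation u v a' b' c d| <= e.
Proof.
move=> cd xI cu cv e e0.
have [cc dd] : c <= c <= d /\ c <= d <= d by rewrite !lexx cd.
have [r1 r10 h1] := cu x c xI cc 1 ltr01.
have [r2 r20 h2] := cu x d xI dd 1 ltr01.
(* Near (x, c) and (x, d) the function [u] moves by at most 1, which accounts for the 2: [K] times
   the width bounds both horizontal integrals together, and a width of at most e / (2 K) costs e /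
   2. *)
set K := `|u x c| + `|u x d| + 2.
have K0 : 0 < K by rewrite /K; have := normr_ge0 (u x c); have := normr_ge0 (u x d); lra.
(* Both vertical sides stay this close to the values of [v] at abscissa [x], so their integrals
   differ by at most e / 2; the 1 covers c = d. *)
have ev : 0 < e / (4 * (d - c) + 1) by apply: divr_gt0 => //; lra.
have [r3 r30 h3] := jointly_continuous_uniform _ _ _ _ _ _ xI cv _ ev.
have eK : 0 < e / (4 * K) by apply: divr_gt0 => //; lra.
exists (Num.min (Num.min r1 r2) (Num.min r3 (e / (4 * K)))).
  by rewrite !lt_min r10 r20 r30 eK.
move=> a' b' aa ab bb; rewrite !lt_min => /andP[/andP[a1 a2] /andP[a3 a4]].
move=> /andP[/andP[b1 b2] /andP[b3 b4]].
have [cu' cv'] := jointly_continuous_separately _ _ _ _ _ _ cu cv.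
have small : b' - a' <= e / (2 * K).
  have -> : e / (2 * K) = e / (4 * K) + e / (4 * K) by clear -K0; field; lra.
 by move: a4 b4; clear; rewrite !ltr_norml => /andP[? ?] /andP[? ?]; lra.
have near z r : `|a' - x| < r -> `|b' - x| < r -> a' <= z <= b' -> `|z - x| < r.
  by clear; rewrite !ltr_norml => /andP[? ?] /andP[? ?] /andP[? ?]; apply/andP; split; lra.
have incl z : a' <= z <= b' -> a <= z <= b.
  by case/andP => ? ?; rewrite (le_trans aa) //= (le_trans _ bb).
have Iu y : y = c \/ y = d -> `|\int_[a', b'] (u^~ y)  - u x y * (b' - a')| <= 1 * (b' - a').
  move=> ycd; apply: segment_integral_approx => //.
    apply: within_continuous_segmentS aa bb (cu' _ _).
    by case: ycd => ->.
  move=> z zI; case: ycd => ->.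
    by apply: h1 => //; [exact: incl|exact: near|rewrite subrr normr0].
  by apply: h2 => //; [exact: incl|exact: near|rewrite subrr normr0].
have aI : a <= a' <= b by apply: incl; rewrite lexx.
have bI : a <= b' <= b by apply: incl; rewrite lexx ab.
have Iv : `|\int_[c, d] (fun y => v b' y - v a' y) - 0 * (d - c)|
    <= 2 * (e / (4 * (d - c) + 1)) * (d - c).
  apply: segment_integral_approx => //.
    by move=> s; apply: continuousB; exact: cv'.
  move=> y yI; have hb := h3 _ _ bI b3 yI; have ha := h3 _ _ aI a3 yI.
  by move: ha hb; clear; rewrite !ler_norml => /andP[? ?] /andP[? ?]; apply/andP; split; lra.
have Iv' : 2 * (e / (4 * (d - c) + 1)) * (d - c) <= e / 2.
  have -> : 2 * (e / (4 * (d - c) + 1)) * (d - c) = e / 2 * (4 * (d - c) / (4 * (d - c) + 1)).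
    by clear -cd; field; lra.
  by clear -cd e0; rewrite ler_piMr ?divr_ge0 ?(ltW e0)// ler_pdivrMr; lra.
have Iu' : K * (b' - a') <= e / 2.
  apply: le_trans (_ : K * (e / (2 * K)) <= _); first by rewrite ler_pM2l.
  by rewrite le_eqVlt; apply/orP; left; apply/eqP; clear -K0; field; lra.
move: Iv; rewrite segment_integralB; [|exact: cv'|exact: cv'].
have := Iu c (or_introl erefl); have := Iu d (or_intror erefl).
rewrite /circulation mul0r subr0 !mul1r.
set A := \int_[a', b'] _; set B := \int_[a', b'] _; set D := \int_[c, d] _ - _.
move=> hA hB hD.
have hc : u x c * (b' - a') <= `|u x c| * (b' - a') /\ - u x c * (b' - a') <= `|u x c| * (b' - a').
  split; apply: ler_wpM2r; rewrite ?subr_ge0// ?ler_norm//.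
  by rewrite -normrN ler_norm.
have hd : u x d * (b' - a') <= `|u x d| * (b' - a') /\ - u x d * (b' - a') <= `|u x d| * (b' - a').
  split; apply: ler_wpM2r; rewrite ?subr_ge0// ?ler_norm//.
  by rewrite -normrN ler_norm.
case: hc hd => hc1 hc2 [hd1 hd2].
move: hA hB hD Iv' Iu'; rewrite /K; set E := _ * (d - c).
move: hc1 hc2 hd1 hd2.
set Pc := u x c * _; set Pd := u x d * _; set l := b' - a'; rewrite !mulNr -/Pc -/Pd.
rewrite !mulrDl; set Nc := _ * l; set Nd := _ * l; clear.
rewrite !ler_norml => ? ? ? ? /andP[? ?] /andP[? ?] /andP[? ?] ? ?; apply/andP; split; lra.
Qed.

(** Strips along the vertical sides are cut off: [goursat] covers the middle rectangle and
    [circulation_thin] the strips. *)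
Theorem goursat_boundary u v a b c d : a < b -> c <= d ->
  jointly_continuous u a b c d -> jointly_continuous v a b c d ->
  (forall x y, a < x < b -> c <= y <= d -> cauchy_riemann_at u v x y) ->
  circulation u v a b c d = 0.
Proof.
move=> ab cd cu cv cr; apply/eqP; rewrite -normr_le0; apply/ler_addgt0Pr => e e0.
rewrite add0r; have e20 : 0 < e / 2 by lra.
have aI : a <= a <= b by rewrite lexx ltW.
have bI : a <= b <= b by rewrite lexx ltW.
have [r r0 ha] := circulation_thin _ _ _ _ _ _ _ cd aI cu cv _ e20.
have [r' r'0 hb] := circulation_thin _ _ _ _ _ _ _ cd bI cu cv _ e20.
(* A third of the width keeps the two strips disjoint. *)
set s := Num.min (Num.min (r / 2) (r' / 2)) ((b - a) / 3).
have s0 : 0 < s by rewrite !lt_min; apply/andP; split; [apply/andP; split|]; lra.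
have [sr sr' sab] : [/\ s <= r / 2, s <= r' / 2 & s <= (b - a) / 3].
  by split; rewrite !ge_min lexx ?orbT.
have [s_lt_r s_lt_r'] : s < r /\ s < r' by split; [move: sr r0|move: sr' r'0]; clear; lra.
have [asb abs sb] : [/\ a + s <= b, a <= b - s & a + s <= b - s].
  by move: sab ab s0; clear; split; lra.
have uv := jointly_continuous_separately _ _ _ _ _ _ cu cv.
have as_ : a <= a + s by rewrite lerDl ltW.
have bs_ : b - s <= b by rewrite gerBl ltW.
rewrite (circulation_splitx _ _ _ (a + s)) //.
rewrite (circulation_splitx _ _ (a + s) (b - s)) //; last first.
  exact: separately_continuousS uv.
rewrite [X in _ + (X + _)]goursat //; last first.
  move=> x y /andP[h1 h2] yI; apply: cr => //; apply/andP; split.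
    by apply: lt_le_trans h1; rewrite ltrDl.
  by apply: le_lt_trans h2 _; rewrite gtrBl.
have h1 : `|circulation u v a (a + s) c d| <= e / 2.
  apply: ha => //; first by rewrite subrr normr0.
  by rewrite addrAC subrr add0r gtr0_norm.
have h2 : `|circulation u v (b - s) b c d| <= e / 2.
  apply: hb => //; first by rewrite addrAC subrr add0r normrN gtr0_norm.
  by rewrite subrr normr0.
rewrite add0r; apply: le_trans (ler_normD _ _) _.
by move: h1 h2; clear; lra.
Qed.

(* Painleve: a vertical line of exceptional points is harmless. *)
Theorem goursat_removable u v a b c d x0 : a < x0 < b -> c <= d ->
  jointly_continuous u a b c d -> jointly_continuous v a b c d ->
  (forall x y, a < x < b -> x != x0 -> c <= y <= d -> cauchy_riemann_at u v x y) ->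
  circulation u v a b c d = 0.
Proof.
move=> /andP[ax xb] cd cu cv cr.
have uv := jointly_continuous_separately _ _ _ _ _ _ cu cv.
rewrite (circulation_splitx _ _ _ x0) ?(ltW ax) ?(ltW xb)//.
rewrite !goursat_boundary ?addr0//.
- by apply: jointly_continuousS cu; rewrite ?lexx ?(ltW ax) ?(ltW xb).
- by apply: jointly_continuousS cv; rewrite ?lexx ?(ltW ax) ?(ltW xb).
- by move=> x y /andP[? ?] ?; apply: cr => //; [apply/andP; split; lra|rewrite gt_eqF].
- by apply: jointly_continuousS cu; rewrite ?lexx ?(ltW ax) ?(ltW xb).
- by apply: jointly_continuousS cv; rewrite ?lexx ?(ltW ax) ?(ltW xb).
- by move=> x y /andP[? ?] ?; apply: cr => //; [apply/andP; split; lra|rewrite lt_eqF].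
Qed.
End GoursatBoundary.

Section DifferenceQuotient.
Context {K : numFieldType}.
Implicit Types (f : K -> K) (z : K).

(** The value at [z0] is the one that gives continuity. Differentiability is established only away
    from [z0]; [goursat_removable] then treats the vertical line through [z0] as exceptional. *)
Definition dquot f z0 z : K := if z == z0 then 'D_1 f z0 else (f z - f z0) / (z - z0).

Lemma near_neq z z0 : z != z0 -> \forall w \near z, w != z0.
Proof.
move=> zz0; have d0 : 0 < `|z - z0| by rewrite normr_gt0 subr_eq0.
apply/nbhs_ballP; exists `|z - z0| => // w; rewrite /ball /=.
by apply: contraTneq => ->; rewrite ltxx.
Qed.

Lemma derivable_dquot f z0 z : z != z0 -> derivable f z 1 -> derivable (dquot f z0) z 1.
Proof.
move=> zz0 df.
have : derivable (fun w => (f w - f z0) * (w - z0)^-1 : K) z 1.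
  apply: derivableM; first by apply: derivableB => //; exact: derivable_cst.
  apply: derivableV; first by rewrite subr_eq0.
  by apply: derivableB; [exact: derivable_id|exact: derivable_cst].
apply: near_eq_derivable; near=> w.
by rewrite /dquot ifN//; near: w; exact: near_neq.
Unshelve. all: by end_near. Qed.

Lemma within_continuous_dquot f z0 (A : set K) : derivable f z0 1 ->
  {within A, continuous f} -> {within A, continuous (dquot f z0)}.
Proof.
move=> df /subspace_continuousP cf; apply/subspace_continuousP => z Az.
move: (cf z Az); rewrite /from_subspace => cfz.
have [->|zz0] := eqVneq z z0.
  apply/cvgrPdist_lt => e e0; move/cvgrPdist_lt: df => /(_ _ e0) /nbhs_ballP[d /= d0 hd].
  apply/nbhs_ballP; exists d => // w; rewrite /ball /= => z0w Aw.
  rewrite /from_subspace /dquot eqxx; case: eqP => [_|/eqP wz]; first by rewrite subrr normr0.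
  have := hd (w - z0); rewrite /ball /= sub0r normrN distrC subr_eq0 => /(_ z0w wz).
  by rewrite /= !scaler1 ?mulr1 subrK mulrC.
have : (fun w => (f w - f z0) / (w - z0)) @ within A (nbhs z) --> (f z - f z0) / (z - z0).
  apply: cvgM; first by apply: cvgB; [exact: cfz|exact: cvg_cst].
  apply: cvgV; first by rewrite subr_eq0.
  by apply: cvgB; [exact: cvg_within|exact: cvg_cst].
rewrite [X in _ --> X]/dquot ifN//; apply: cvg_trans; apply: near_eq_cvg.
rewrite near_withinE; near=> w => _.
by rewrite /dquot ifN//; near: w; exact: near_neq.
Unshelve. all: by end_near. Qed.
End DifferenceQuotient.

Section Modulus.
Context {R : realType}.
Implicit Types (z w : R[i]) (x y : R).

Lemma normr_modulus z : `|z| = (modulus z)%:C. Proof. by []. Qed.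
Lemma modulusM z w : modulus (z * w) = modulus z * modulus w.
Proof. exact: Normc.normcM. Qed.
Lemma modulusV z : modulus z^-1 = (modulus z)^-1.
Proof. exact: Normc.normcV. Qed.
Lemma modulusN z : modulus (- z) = modulus z.
Proof. exact: normcN. Qed.
Lemma modulusB z w : modulus (z - w) = modulus (w - z).
Proof. by rewrite -modulusN opprB. Qed.
Lemma ler_modulusD z w : modulus (z + w) <= modulus z + modulus w.
Proof. exact: le_normcD. Qed.
Lemma modulus_ge0 z : 0 <= modulus z.
Proof. by rewrite -lecR -normr_modulus normr_ge0. Qed.
Lemma modulus_eq0 z : (modulus z == 0) = (z == 0).
Proof. by rewrite -(inj_eq (@complexI R)) -normr_modulus normr_eq0. Qed.
Lemma modulus_gt0 z : (0 < modulus z) = (z != 0).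
Proof. by rewrite lt_def modulus_ge0 andbT modulus_eq0. Qed.
Lemma modulus_real x : modulus x%:C = `|x|.
Proof. by rewrite /modulus /= expr0n /= addr0 sqrtr_sqr. Qed.
Lemma modulus0 : modulus 0 = 0 :> R.
Proof. by rewrite -[0]/(0%:C) modulus_real normr0. Qed.
Lemma modulusX z n : modulus (z ^+ n) = modulus z ^+ n.
Proof.
elim: n => [|n ih]; last by rewrite !exprS modulusM ih.
by rewrite !expr0 -[1]/(1%:C) modulus_real normr1.
Qed.
Lemma modulusE z : modulus z = Num.sqrt (complex.Re z ^+ 2 + complex.Im z ^+ 2).
Proof. by case: z. Qed.
Lemma sqr_modulus z : modulus z ^+ 2 = complex.Re z ^+ 2 + complex.Im z ^+ 2.
Proof. by rewrite modulusE sqr_sqrtr// addr_ge0// sqr_ge0. Qed.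
Lemma ler_Re_modulus z : `|complex.Re z| <= modulus z.
Proof. by rewrite -sqrtr_sqr modulusE; apply: ler_wsqrtr; rewrite lerDl sqr_ge0. Qed.
Lemma ler_Im_modulus z : `|complex.Im z| <= modulus z.
Proof. by rewrite -sqrtr_sqr modulusE; apply: ler_wsqrtr; rewrite lerDr sqr_ge0. Qed.
Lemma ler_modulus_ReIm z : modulus z <= `|complex.Re z| + `|complex.Im z|.
Proof.
rewrite -[leRHS]ger0_norm ?addr_ge0// -sqrtr_sqr modulusE; apply: ler_wsqrtr.
rewrite sqrrD !real_normK ?num_real// addrAC lerDl mulrn_wge0// mulr_ge0//.
Qed.
Lemma ler_sub_modulus z w : modulus z - modulus w <= modulus (z - w).
Proof. by rewrite lerBlDr; apply: le_trans (ler_modulusD _ _); rewrite subrK. Qed.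

(** Radii and tolerances in [R[i]] are elements of [R[i]]; positivity makes them real, so that
    limits can be handled with bounds in [R]. *)
Lemma gt0_complex z : 0 < z -> exists2 x, 0 < x & z = x%:C.
Proof. by case: z => a b; rewrite ltcE /= => /andP[/eqP b0 a0]; exists a => //; rewrite -?b0 ?b0. Qed.

Lemma within_continuous_modulusP (A : set R[i]) (h : R[i] -> R[i]) :
  {within A : set R[i]^o, continuous (h : R[i]^o -> R[i]^o)} <->
  forall z, A z -> forall e : R, 0 < e -> exists2 r : R, 0 < r & forall w, A w ->
    modulus (w - z) < r -> modulus (h w - h z) <= e.
Proof.
split=> [/subspace_continuousP ch z Az e e0|ch].
  have e0' : 0 < e%:C by rewrite ltcR.
  move/cvgrPdist_le/(_ _ e0')/nbhs_ballP: (ch z Az) => [d /= /gt0_complex[r r0 ->] hd].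
  exists r => // w Aw wz; have := hd w; rewrite /ball /= normr_modulus ltcR (modulusB z).
  by move=> /(_ wz Aw); rewrite /from_subspace normr_modulus lecR (modulusB (h w)).
apply/subspace_continuousP => z Az; apply/cvgrPdist_le => _ /gt0_complex[e e0 ->].
have [r r0 hr] := ch z Az e e0; apply/nbhs_ballP; exists r%:C; first by rewrite /= ltcR.
move=> w; rewrite /ball /= normr_modulus ltcR (modulusB z) => wz Aw.
by rewrite /from_subspace normr_modulus lecR (modulusB (h z)); exact: hr.
Qed.

(** Without a quotient the increment 0 needs no exception, and real and imaginary parts can be read
    off directly. *)
Lemma derivable_modulusP (h : R[i] -> R[i]) z :
  derivable (h : R[i]^o -> R[i]^o) z 1 <->
  exists l, forall e : R, 0 < e -> exists2 r : R, 0 < r & forall w, modulus w < r ->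
    modulus (h (z + w) - h z - l * w) <= e * modulus w.
Proof.
split=> [dh|[l hl]].
  exists ('D_1 (h : R[i]^o -> R[i]^o) z) => e e0; have e0' : 0 < e%:C by rewrite ltcR.
  move/cvgrPdist_le: dh => /(_ _ e0')/nbhs_ballP[d /= /gt0_complex[r r0 ->] hd].
  exists r => // w wr; have [->|w0] := eqVneq w 0.
    by rewrite addr0 subrr mulr0 subr0 modulus0 mulr0.
  have := hd w; rewrite /ball /= sub0r normrN normr_modulus ltcR => /(_ wr w0).
  rewrite normr_modulus lecR -(ler_pM2r (_ : 0 < modulus w)) ?modulus_gt0//.
  rewrite -modulusM; apply: le_trans; rewrite -[leRHS]modulusN.
  rewrite (_ : w *: (1 : R[i]^o) = w); last by rewrite /GRing.scale /= mulr1.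
  by rewrite /GRing.scale /= mulrBl mulrAC mulVf// mul1r opprB [w + z]addrC; exact: lexx.
rewrite /derivable; apply/cvg_ex; exists l; apply/cvgrPdist_le => _ /gt0_complex[e e0 ->].
have [r r0 hr] := hl e e0; apply/nbhs_ballP; exists r%:C; first by rewrite /= ltcR.
move=> w; rewrite /ball /= sub0r normrN normr_modulus ltcR => wr w0.
rewrite normr_modulus lecR -(ler_pM2r (_ : 0 < modulus w)) ?modulus_gt0//.
rewrite -modulusM; apply: le_trans (hr w wr); rewrite -[leLHS]modulusN.
rewrite (_ : w *: (1 : R[i]^o) = w); last by rewrite /GRing.scale /= mulr1.
by rewrite /GRing.scale /= [w + z]addrC mulrBl mulrAC mulVf// mul1r opprB.
Qed.

Lemma Re_add z w : complex.Re (z + w) = complex.Re z + complex.Re w.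
Proof. by case: z w => ? ? []. Qed.
Lemma Im_add z w : complex.Im (z + w) = complex.Im z + complex.Im w.
Proof. by case: z w => ? ? []. Qed.
Lemma Re_opp z : complex.Re (- z) = - complex.Re z.
Proof. by case: z. Qed.
Lemma Im_opp z : complex.Im (- z) = - complex.Im z.
Proof. by case: z. Qed.
Lemma Re_mul z w : complex.Re (z * w) = complex.Re z * complex.Re w - complex.Im z * complex.Im w.
Proof. by case: z w => ? ? []. Qed.
Lemma Im_mul z w : complex.Im (z * w) = complex.Re z * complex.Im w + complex.Im z * complex.Re w.
Proof. by case: z w => ? ? [? ?]. Qed.

Definition complexRI := (Re_add, Im_add, Re_opp, Im_opp, Re_mul, Im_mul).

Definition rectangle (a b c d : R) : set R[i] :=
  [set z | a <= complex.Re z <= b /\ c <= complex.Im z <= d].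

Lemma rectangle_jointly_continuous (h : R[i] -> R[i]) a b c d :
  {within rectangle a b c d : set R[i]^o, continuous (h : R[i]^o -> R[i]^o)} ->
  jointly_continuous (fun x y => complex.Re (h (x +i* y))) a b c d /\
  jointly_continuous (fun x y => complex.Im (h (x +i* y))) a b c d.
Proof.
move=> /within_continuous_modulusP ch.
have main x y : a <= x <= b -> c <= y <= d -> forall e : R, 0 < e -> exists2 r : R, 0 < r &
    forall s t, a <= s <= b -> c <= t <= d -> `|s - x| < r -> `|t - y| < r ->
      modulus (h (s +i* t) - h (x +i* y)) <= e.
  move=> xI yI e e0; have [r r0 hr] := ch (x +i* y) (conj xI yI) e e0.
  exists (r / 2); first lra; move=> s t sI tI sx ty; apply: hr => //.
  by apply: le_lt_trans (ler_modulus_ReIm _) _; rewrite /=; lra.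
split=> x y xI yI e e0; have [r r0 hr] := main x y xI yI e e0; exists r => // s t sI tI sx ty;
  apply: le_trans (hr s t sI tI sx ty).
  by rewrite -Re_opp -Re_add ler_Re_modulus.
by rewrite -Im_opp -Im_add ler_Im_modulus.
Qed.

Lemma derivable_cauchy_riemann (h : R[i] -> R[i]) x y :
  derivable (h : R[i]^o -> R[i]^o) (x +i* y) 1 ->
  cauchy_riemann_at (fun x y => complex.Re (h (x +i* y))) (fun x y => complex.Im (h (x +i* y))) x y.
Proof.
move=> /derivable_modulusP[l hl]; exists (complex.Re l), (complex.Im l) => e e0.
have [r r0 hr] := hl e e0; exists (r / 2); first lra; move=> s t sr tr.
have := ler_modulus_ReIm (s +i* t); rewrite /= => st.
have {}hr := hr (s +i* t) (le_lt_trans st _).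
have {}hr : modulus (h ((x +i* y) + (s +i* t)) - h (x +i* y) - l * (s +i* t)) <= e * (`|s| + `|t|).
  apply: le_trans (hr _) _; first lra.
  by rewrite ler_pM2l.
rewrite (_ : (x +i* y) + (s +i* t) = (x + s) +i* (y + t)) // in hr; split; apply: le_trans hr.
  by apply: le_trans (ler_Re_modulus _); rewrite !complexRI.
by apply: le_trans (ler_Im_modulus _); rewrite !complexRI /= [complex.Re l * t + _]addrC.
Qed.

Theorem cauchy_rectangle (h : R[i] -> R[i]) a b c d x0 : a < x0 < b -> c <= d ->
  {within rectangle a b c d : set R[i]^o, continuous (h : R[i]^o -> R[i]^o)} ->
  (forall z, a < complex.Re z < b -> complex.Re z != x0 -> c <= complex.Im z <= d ->
     derivable (h : R[i]^o -> R[i]^o) z 1) ->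
  circulation (fun x y => complex.Re (h (x +i* y))) (fun x y => complex.Im (h (x +i* y))) a b c d = 0.
Proof.
move=> axb cd /rectangle_jointly_continuous[cu cv] dh.
apply: (goursat_removable _ _ _ _ _ _ _ axb) => // x y xI xx0 yI.
by apply: derivable_cauchy_riemann; exact: dh.
Qed.

End Modulus.

(** * Analytic functions on the right half-plane *)

Section SegmentBounds.
Context {R : realType}.
Implicit Types (f : R -> R) (a b k : R).

Lemma segment_integral_le f a b k : a <= b -> {within `[a, b], continuous f} ->
  (forall x, a <= x <= b -> f x <= k) -> \int_[a, b] f <= k * (b - a).
Proof.
move=> ab cf fk; rewrite -segment_integral_cst//; apply: le_Rintegral => //.
- exact: integrable_segment.
- by apply: integrable_segment; exact: within_continuous_segment_cst.
Qed.

Lemma segment_integral_ge f a b k : a <= b -> {within `[a, b], continuous f} ->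
  (forall x, a <= x <= b -> k <= f x) -> k * (b - a) <= \int_[a, b] f.
Proof.
move=> ab cf fk; rewrite -segment_integral_cst//; apply: le_Rintegral => //.
- by apply: integrable_segment; exact: within_continuous_segment_cst.
- exact: integrable_segment.
Qed.

Lemma segment_bounded f a b : a <= b -> {within `[a, b], continuous f} ->
  exists M, forall x, a <= x <= b -> `|f x| <= M.
Proof.
move=> ab cf; have [c _ hc] := EVT_max ab cf; have [d _ hd] := EVT_min ab cf.
exists (`|f c| + `|f d|) => x xI.
have h1 := hc x; have h2 := hd x; rewrite !in_itv /= in h1 h2.
have {}h1 := h1 xI; have {}h2 := h2 xI.
have := ler_norm (f c); have := ler_norm (- f d); rewrite normrN => h3 h4.
have := normr_ge0 (f c); have := normr_ge0 (f d).
by rewrite ler_norml => h5 h6; apply/andP; split; lra.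
Qed.

Lemma power_lt (t e : R) : 0 <= t -> t < 1 -> 0 < e -> exists n, t ^+ n <= e.
Proof.
move=> t0 t1 e0; have t1' : `|t| < 1 by rewrite ger0_norm.
have /cvgrPdist_le/(_ _ e0)[n _ hn] := cvg_expr t1'.
exists n; have := hn n (leqnn n); rewrite sub0r normrN ger0_norm//.
exact: exprn_ge0.
Qed.

End SegmentBounds.

Section HalfPlane.
Context {R : realType}.
Implicit Types (h : R[i] -> R[i]) (z : R[i]).

Definition holomorphic_rhp h : Prop :=
  forall z, 0 < complex.Re z -> derivable (h : R[i]^o -> R[i]^o) z 1.

Lemma derivable_within_continuous_set h (A : set R[i]) :
  (forall z, A z -> derivable (h : R[i]^o -> R[i]^o) z 1) ->
  {within A : set R[i]^o, continuous (h : R[i]^o -> R[i]^o)}.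
Proof.
move=> dh; apply/subspace_continuousP => z Az.
apply: cvg_within_filter; apply: (@differentiable_continuous _ R[i]^o R[i]^o).
by apply/derivable1_diffP; exact: dh.
Qed.

Lemma side_bounded h a b c d : a <= b -> c <= d ->
  {within rectangle a b c d : set R[i]^o, continuous (h : R[i]^o -> R[i]^o)} ->
  exists M, (forall x y, a <= x <= b -> y = c \/ y = d -> modulus (h (x +i* y)) <= M) /\
            (forall x y, x = a \/ x = b -> c <= y <= d -> modulus (h (x +i* y)) <= M).
Proof.
move=> ab cd /rectangle_jointly_continuous[cu cv].
have [cux cuy] := jointly_continuous_separately _ _ _ _ _ _ cu cu.
have [cvx cvy] := jointly_continuous_separately _ _ _ _ _ _ cv cv.
have Ia : a <= a <= b by rewrite lexx ab.
have Ib : a <= b <= b by rewrite lexx ab.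
have Ic : c <= c <= d by rewrite lexx cd.
have Id : c <= d <= d by rewrite lexx cd.
have [M1 h1] := segment_bounded _ _ _ ab (cux _ Ic).
have [M2 h2] := segment_bounded _ _ _ ab (cux _ Id).
have [M3 h3] := segment_bounded _ _ _ cd (cuy _ Ia).
have [M4 h4] := segment_bounded _ _ _ cd (cuy _ Ib).
have [N1 k1] := segment_bounded _ _ _ ab (cvx _ Ic).
have [N2 k2] := segment_bounded _ _ _ ab (cvx _ Id).
have [N3 k3] := segment_bounded _ _ _ cd (cvy _ Ia).
have [N4 k4] := segment_bounded _ _ _ cd (cvy _ Ib).
have l1 := le_trans (normr_ge0 _) (h1 _ Ia); have l2 := le_trans (normr_ge0 _) (h2 _ Ia).
have l3 := le_trans (normr_ge0 _) (h3 _ Ic); have l4 := le_trans (normr_ge0 _) (h4 _ Ic).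
have n1 := le_trans (normr_ge0 _) (k1 _ Ia); have n2 := le_trans (normr_ge0 _) (k2 _ Ia).
have n3 := le_trans (normr_ge0 _) (k3 _ Ic); have n4 := le_trans (normr_ge0 _) (k4 _ Ic).
exists ((M1 + N1) + (M2 + N2) + (M3 + N3) + (M4 + N4)).
split=> x y.
  move=> xI [->|->]; apply: le_trans (ler_modulus_ReIm _) _.
    by have := h1 _ xI; have := k1 _ xI; move: l2 l3 l4 n2 n3 n4; clear; lra.
  by have := h2 _ xI; have := k2 _ xI; move: l1 l3 l4 n1 n3 n4; clear; lra.
case=> -> yI; apply: le_trans (ler_modulus_ReIm _) _.
  by have := h3 _ yI; have := k3 _ yI; move: l1 l2 l4 n1 n2 n4; clear; lra.
by have := h4 _ yI; have := k4 _ yI; move: l1 l2 l3 n1 n2 n3; clear; lra.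
Qed.

Definition upper_part h z : R[i] := if 0 <= complex.Im z then h z else 0.

(** Since [h] vanishes along the positive axis, its derivative there is 0, and gluing 0 below the
    axis preserves this. The glued function is holomorphic and vanishes on an open set, which is
    what a contour argument can exploit. *)
Lemma derivable_upper_part h : holomorphic_rhp h -> (forall x : R, 0 < x -> h x%:C = 0) ->
  holomorphic_rhp (upper_part h).
Proof.
move=> hh h0 z z0; have /derivable_modulusP[l hl] := hh z z0.
have Im_small (w : R[i]) : `|complex.Im w| <= modulus w := ler_Im_modulus w.
apply/derivable_modulusP; have [Iz|Iz|Iz] := ltgtP (complex.Im z) 0.
- exists 0 => e e0; exists (- complex.Im z); first lra; move=> w hw.
  rewrite /upper_part !ifF ?subrr ?mul0r ?subr0 ?modulus0 ?mulr_ge0 ?modulus_ge0 ?(ltW e0)//.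
    by apply: lt_geF.
  apply: lt_geF; rewrite Im_add; have := Im_small w; rewrite ler_norml; lra.
- exists l => e e0; have [r r0 hr] := hl e e0.
  exists (Num.min r (complex.Im z)); first by rewrite lt_min r0.
  move=> w; rewrite lt_min => /andP[wr wz]; rewrite /upper_part !ifT; first exact: hr.
    exact: ltW.
  by rewrite Im_add; have := Im_small w; rewrite ler_norml; lra.
have Ez : z = (complex.Re z)%:C by case: (z) Iz => ? ? /= ->.
have hz : h z = 0 by rewrite Ez h0.
have l0 : l = 0.
  apply/eqP; rewrite -modulus_eq0 eq_le modulus_ge0 andbT.
  apply/ler_addgt0Pr => e e0; rewrite add0r; have [r r0 hr] := hl e e0.
  have := hr (r / 2)%:C; rewrite modulus_real ger0_norm; last lra.
  rewrite hz {1}Ez -rmorphD h0 /=; last lra.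
  rewrite subr0 sub0r modulusN modulusM modulus_real ger0_norm; last lra.
  by rewrite ler_pM2r; [apply; lra|lra].
exists 0 => e e0; have [r r0 hr] := hl e e0; exists r => // w wr.
have {hr} := hr w wr; rewrite hz l0 mul0r !subr0 /upper_part Iz lexx hz subr0 => hr.
by case: ifP => // _; rewrite modulus0 mulr_ge0 ?modulus_ge0 ?ltW.
Qed.
End HalfPlane.

Section Derivable.
Context {K : numFieldType}.
Implicit Types (f g : K -> K) (z : K).

Lemma derivable_shift p z : derivable (fun w : K => w - p) z 1.
Proof. by apply: derivableB; [exact: derivable_id|exact: derivable_cst]. Qed.

Lemma derivable_div f g z : g z != 0 -> derivable f z 1 -> derivable g z 1 ->
  derivable (fun w => f w / g w) z 1.
Proof. move=> gz df dg; exact: derivableM df (derivableV gz dg). Qed.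

Lemma derivable_mulX f g n z : derivable f z 1 -> derivable g z 1 ->
  derivable (fun w => f w * g w ^+ n) z 1.
Proof. by move=> df dg; have := derivableM df (@derivableX _ _ g n z 1 dg); rewrite exprfctE. Qed.

Lemma derivable_mull (k : K) f z : derivable f z 1 -> derivable (fun w => k * f w) z 1.
Proof. by move=> df; exact: (derivableM (derivable_cst k z 1) df). Qed.

Lemma within_continuous_mull (k : K) f (A : set K) :
  {within A, continuous f} -> {within A, continuous (fun w => k * f w)}.
Proof. by move=> cf z; apply: continuousM; [exact: cvg_cst|exact: cf]. Qed.

Lemma derivable_mobius (c p : K) z : z - p != 0 -> derivable (fun w => c / (w - p)) z 1.
Proof.
move=> zp; apply: derivable_mull.
exact: (@derivableV _ _ (fun w : K => w - p) z 1 zp (derivable_shift p z)).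
Qed.
End Derivable.

Section Identity.
Context {R : realType}.
Implicit Types (h : R[i] -> R[i]) (z w : R[i]).

Lemma Re_imaginary_div (k : R) w :
  complex.Re ((0 +i* k) / w) = k * complex.Im w / modulus w ^+ 2.
Proof. by rewrite sqr_modulus; case: w => x y /=; rewrite !mul0r; ring. Qed.

Lemma Im_imaginary_div (k : R) w :
  complex.Im ((0 +i* k) / w) = k * complex.Re w / modulus w ^+ 2.
Proof. by rewrite sqr_modulus; case: w => x y /=; rewrite !mul0r; ring. Qed.

Lemma mul_conj_modulus z : (0 +i* (- 1)) * conjc z * z = 0 +i* (- modulus z ^+ 2).
Proof. by rewrite sqr_modulus; case: z => x y; apply/eqP; rewrite eq_complex /=; apply/andP; split; apply/eqP; ring. Qed.

(* The pole [p] lies below the real axis, where [upper_part h] vanishes, and every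
   boundary point of the rectangle above the axis is farther from [p] than [z0]:
   Cauchy's formula for [upper_part h z * ((z0 - p) / (z - p)) ^+ N] with large [N]
   leaves nothing at [z0]. *)
Lemma holomorphic_rhp_upper_eq0 h z0 : holomorphic_rhp h ->
  (forall x : R, 0 < x -> h x%:C = 0) ->
  0 < complex.Re z0 -> 0 < complex.Im z0 -> h z0 = 0.
Proof.
move=> hh h0; set x0 := complex.Re z0; set y0 := complex.Im z0 => x0_gt0 y0_gt0.
set K := upper_part h; have hK : holomorphic_rhp K by exact: derivable_upper_part.
have -> : h z0 = K z0 by rewrite /K /upper_part ltW.
(* With p = c - i x0 this gives |z0 - p|^2 = c^2 - c x0 = rho^2 - x0^2 / 4, so [z0] lies inside the
   disc of radius rho about p. *)
pose c := (x0 ^+ 2 + (y0 + x0) ^+ 2) / x0.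
have cE : x0 * c = x0 ^+ 2 + (y0 + x0) ^+ 2 by rewrite /c mulrC divfK ?gt_eqF.
have cx : x0 < c by rewrite -(ltr_pM2l x0_gt0) cE -expr2 ltrDl exprn_gt0// addr_gt0.
pose rho := c - x0 / 2; have rho0 : 0 < rho by rewrite /rho; lra.
pose p := c +i* (- x0).
have pz0 : modulus (z0 - p) < rho.
  rewrite -(ltr_pXn2r (_ : 0 < 2)%N) ?nnegrE ?modulus_ge0 ?(ltW rho0)//.
  rewrite sqr_modulus !complexRI /= -/x0 -/y0 /rho opprK.
  have : 0 < x0 ^+ 2 by rewrite exprn_gt0.
  by move: cE; clear; nra.
pose a := x0 / 2; pose b := 2 * c - x0 / 2; pose d := - (x0 / 2).
have y0rho : y0 < rho.
  apply: le_lt_trans pz0; apply: le_trans (ler_Im_modulus _).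
  by rewrite !complexRI /= -/y0 opprK ger0_norm; lra.
have [ax xb] : a < x0 /\ x0 < b by rewrite /a /b; split; lra.
have ab : a <= b by lra.
have drho : d <= rho by rewrite /d; lra.
have rect_sub z : rectangle a b d rho z -> 0 < complex.Re z /\ z - p != 0.
  case=> /andP[az _] /andP[dz _]; split; first by move: az; rewrite /a; lra.
  apply/eqP => /(congr1 (@complex.Im R)); rewrite !complexRI /= opprK; move: dz; rewrite /d; lra.
pose q z := (z0 - p) / (z - p).
have dq z : z - p != 0 -> derivable (q : R[i]^o -> R[i]^o) z 1.
  exact: derivable_mobius.
pose Q N z := K z * q z ^+ N.
have dQ N z : 0 < complex.Re z -> z - p != 0 -> derivable (Q N : R[i]^o -> R[i]^o) z 1.
  by move=> z_gt0 zp; exact: (@derivable_mulX _ K q N z (hK z z_gt0) (dq z zp)).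
have rz0 : rectangle a b d rho z0.
  by split; rewrite -/x0 -/y0 !ltW// /d; lra.
have [_ zp0] := rect_sub _ rz0.
have Qz0 N : Q N z0 = K z0 by rewrite /Q /q divff// expr1n mulr1.
(* kappa times [K z0] is - i k with k = |K z0|^2. The pole term of [g N] becomes i k / (z - z0),
   whose contribution to the circulation has the same sign on all four sides, so that the value 2 pi
   never has to be computed. *)
pose kappa := (0 +i* (- 1)) * conjc (K z0).
pose g N z := kappa * dquot (Q N : R[i]^o -> R[i]^o) z0 z.
have cg N : {within rectangle a b d rho : set R[i]^o, continuous (g N : R[i]^o -> R[i]^o)}.
  have cdq : {within rectangle a b d rho : set R[i]^o,
      continuous (dquot (Q N : R[i]^o -> R[i]^o) z0 : R[i]^o -> R[i]^o)}.
    apply: within_continuous_dquot; first exact: dQ.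
    by apply: derivable_within_continuous_set => z /rect_sub[]; exact: dQ.
  exact: within_continuous_mull.
have J0 N : circulation (fun x y => complex.Re (g N (x +i* y)))
    (fun x y => complex.Im (g N (x +i* y))) a b d rho = 0.
  apply: (@cauchy_rectangle _ _ _ _ _ _ x0) => //; first by rewrite ax xb.
  move=> z /andP[az zb] zx0 dz.
  have [|z_gt0 zp] := rect_sub z; first by split=> //; rewrite !ltW.
  apply: derivable_mull; apply: derivable_dquot; last exact: dQ.
  by apply: contraNneq zx0 => ->.
pose k := modulus (K z0) ^+ 2.
have gE N z : z != z0 -> g N z = kappa * (Q N z / (z - z0)) + (0 +i* k) / (z - z0).
  move=> zz0; rewrite /g /dquot ifN// Qz0 mulrBl mulrBr; congr (_ + _).
  by rewrite mulrA /kappa mul_conj_modulus -mulNr; congr (_ / _); rewrite /k -[LHS]/(_ +i* _) /= oppr0 opprK.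
have [M [Mh Mv]] : exists M : R, (forall x y, a <= x <= b -> y = d \/ y = rho -> modulus (K (x +i* y)) <= M) /\
            (forall x y, x = a \/ x = b -> d <= y <= rho -> modulus (K (x +i* y)) <= M).
  apply: side_bounded => //; apply: derivable_within_continuous_set => z /rect_sub[z_gt0 _].
  exact: hK.
pose tau := modulus (z0 - p) / rho.
have tau0 : 0 <= tau by rewrite divr_ge0 ?modulus_ge0 ?ltW.
have tau1 : tau < 1 by rewrite ltr_pdivrMr// mul1r.
(* A lower bound for the distance from [z0] to the top and to the vertical sides. *)
pose delta := Num.min (x0 / 2) (rho - y0).
have delta0 : 0 < delta by rewrite lt_min; apply/andP; split; lra.
have [dx dr] : delta <= x0 / 2 /\ delta <= rho - y0 by rewrite /delta !ge_min !lexx orbT.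
have M0 : 0 <= M by apply: le_trans (Mh a d _ (or_introl erefl)); rewrite ?modulus_ge0 ?lexx.
pose E := modulus kappa * (M / delta).
have E0 : 0 <= E by rewrite mulr_ge0 ?modulus_ge0// divr_ge0// ltW.
have small N z : modulus (K z) <= M -> delta <= modulus (z - z0) ->
    (0 <= complex.Im z -> rho <= modulus (z - p)) ->
    modulus (kappa * (Q N z / (z - z0))) <= E * tau ^+ N.
  move=> KM dz far; rewrite (modulusM kappa) (modulusM (Q N z)) (modulusM (K z)) modulusX modulusV /E -!mulrA.
  apply: ler_wpM2l; first exact: modulus_ge0.
  have [Iz|Iz] := leP 0 (complex.Im z); last first.
    rewrite {1}/K /upper_part ifN -?ltNge// modulus0 mul0r.
    by rewrite !mulr_ge0 ?exprn_ge0// invr_ge0 ltW.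
  have qt : modulus (q z) <= tau.
    rewrite /q modulusM modulusV /tau; apply: ler_wpM2l; first exact: modulus_ge0.
    by rewrite lef_pV2 ?posrE ?far// (lt_le_trans rho0 (far Iz)).
  rewrite [delta^-1 * _]mulrC; apply: ler_pM => //.
  - exact: modulus_ge0.
  - by rewrite mulr_ge0 ?exprn_ge0 ?invr_ge0 ?modulus_ge0.
  - apply: ler_pM; rewrite ?exprn_ge0 ?invr_ge0 ?modulus_ge0//.
      by apply: lerXn2r; rewrite ?nnegrE ?modulus_ge0.
    by rewrite lef_pV2 ?posrE// (lt_le_trans delta0 dz).
have lower (r e t l : R) : `|r| <= t -> t <= e -> 0 <= l -> - e <= r + l.
  by clear; rewrite ler_norml => /andP[? ?] ? ?; lra.
have upper (r e t l : R) : `|r| <= t -> t <= e -> l <= 0 -> r + l <= e.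
  by clear; rewrite ler_norml => /andP[? ?] ? ?; lra.
pose W := (b - a) + 2 * (rho - d).
(* On the bottom the pole term has real part at most - k m: the numerator is the distance of [z0]
   from that side, the denominator bounds |z - z0|^2 there. *)
pose m := (y0 - d) / ((2 * c) ^+ 2 + (rho - d) ^+ 2).
have den0 : 0 < (2 * c) ^+ 2 + (rho - d) ^+ 2.
  by rewrite ltr_pwDl ?sqr_ge0// exprn_gt0//; lra.
have m0 : 0 < m by rewrite divr_gt0// /d; lra.
have k0 : 0 <= k by rewrite exprn_ge0 ?modulus_ge0.
(* On the bottom [K] vanishes and only the pole term remains. On the other sides the pole term has
   the favourable sign and is dropped, while the rest is at most E tau^N. *)
have key N : k * m * (b - a) <= E * tau ^+ N * W.
  have [sc1 sc2] := rectangle_jointly_continuous _ _ _ _ _ (cg N).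
  have [cu cv] := jointly_continuous_separately _ _ _ _ _ _ sc1 sc2.
  have Ia : a <= a <= b by rewrite lexx ab.
  have Ib : a <= b <= b by rewrite lexx ab.
  have Id : d <= d <= rho by rewrite lexx drho.
  have Ir : d <= rho <= rho by rewrite lexx drho.
  have ne z : delta <= modulus (z - z0) -> z != z0.
    by move=> dz; rewrite -subr_eq0 -modulus_gt0 (lt_le_trans delta0).
  have Eg N' : 0 <= E * tau ^+ N' by rewrite mulr_ge0// exprn_ge0.
  have bot : \int_[a, b] (fun x => complex.Re (g N (x +i* d))) <= - (k * m) * (b - a).
    apply: segment_integral_le => //; first exact: cu.
    move=> x /andP[xa xb']; set z := x +i* d.
    have zz0 : z != z0.
      rewrite eq_complex /= -/x0 -/y0 negb_and; apply/orP; right; rewrite lt_eqF// /d.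
      by move: x0_gt0 y0_gt0; clear; lra.
    have Kz : K z = 0 by rewrite /K /upper_part /= ifN // -ltNge /d oppr_lt0 divr_gt0.
    rewrite gE// /Q Kz !mul0r mulr0 add0r Re_imaginary_div !complexRI /= -/y0.
    rewrite -mulrA -mulrN; apply: ler_wpM2l => //.
    have D0 : 0 < modulus (z - z0) ^+ 2 by rewrite exprn_gt0// modulus_gt0 subr_eq0.
    rewrite -opprB mulNr lerN2 /m; apply: ler_wpM2l; first by move: x0_gt0 y0_gt0; rewrite /d; clear; lra.
    rewrite lef_pV2 ?posrE// sqr_modulus !complexRI /= -/x0 -/y0.
    apply: lerD; rewrite -[leLHS]real_normK ?num_real//; apply: lerXn2r; rewrite ?nnegrE ?normr_ge0// ?subr_ge0//.
    - by move: x0_gt0 cx; clear; lra.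
      by rewrite ler_norml; move: xa xb' x0_gt0 cx; rewrite /a /b; clear; lra.
    by rewrite ler_norml; move: x0_gt0 y0_gt0 y0rho; rewrite /d; clear; lra.
  have top : - (E * tau ^+ N) * (b - a) <= \int_[a, b] (fun x => complex.Re (g N (x +i* rho))).
    apply: segment_integral_ge => //; first exact: cu.
    move=> x xI; set z := x +i* rho.
    have dz : delta <= modulus (z - z0).
      apply: le_trans (ler_Im_modulus _); rewrite !complexRI /= -/y0; apply: le_trans dr _; exact: ler_norm.
    have sm : modulus (kappa * (Q N z / (z - z0))) <= E * tau ^+ N.
      apply: small => //; first by apply: Mh => //; right.
      move=> _; apply: le_trans (ler_Im_modulus _); rewrite !complexRI /= opprK.
      by apply: le_trans (ler_norm _); rewrite lerDl ltW.
    rewrite gE ?ne// Re_add Re_imaginary_div; apply: lower (ler_Re_modulus _) sm _.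
    by rewrite divr_ge0 ?sqr_ge0// mulr_ge0// !complexRI /= -/y0 subr_ge0 ltW.
  have right : - (E * tau ^+ N) * (rho - d) <= \int_[d, rho] (fun y => complex.Im (g N (b +i* y))).
    apply: segment_integral_ge => //; first exact: cv.
    move=> y yI; set z := b +i* y.
    have dz : delta <= modulus (z - z0).
      apply: le_trans (ler_Re_modulus _); rewrite !complexRI /= -/x0; apply: le_trans dx _.
      by apply: le_trans (ler_norm _); move: cx; rewrite /b; clear; lra.
    have sm : modulus (kappa * (Q N z / (z - z0))) <= E * tau ^+ N.
      apply: small => //; first by apply: Mv => //; right.
      move=> _; apply: le_trans (ler_Re_modulus _); rewrite !complexRI /=.
      by apply: le_trans (ler_norm _); rewrite /b /rho; clear; lra.
    rewrite gE ?ne// Im_add Im_imaginary_div; apply: lower (ler_Im_modulus _) sm _.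
    by rewrite divr_ge0 ?sqr_ge0// mulr_ge0// !complexRI /= -/x0 subr_ge0 ltW.
  have left : \int_[d, rho] (fun y => complex.Im (g N (a +i* y))) <= E * tau ^+ N * (rho - d).
    apply: segment_integral_le => //; first exact: cv.
    move=> y yI; set z := a +i* y.
    have dz : delta <= modulus (z - z0).
      apply: le_trans (ler_Re_modulus _); rewrite !complexRI /= -/x0; apply: le_trans dx _.
      by rewrite -normrN; apply: le_trans (ler_norm _); rewrite /a; clear; lra.
    have sm : modulus (kappa * (Q N z / (z - z0))) <= E * tau ^+ N.
      apply: small => //; first by apply: Mv => //; left.
      move=> _; apply: le_trans (ler_Re_modulus _); rewrite !complexRI /=.
      by rewrite -normrN; apply: le_trans (ler_norm _); rewrite /a /rho; clear; lra.
    rewrite gE ?ne// Im_add Im_imaginary_div; apply: upper (ler_Im_modulus _) sm _.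
    rewrite -oppr_ge0 -mulNr -mulrN divr_ge0 ?sqr_ge0// mulr_ge0// !complexRI /= -/x0.
    by rewrite opprB subr_ge0 ltW.
  have arith (L H e I1 I2 I3 I4 : R) : I1 <= - (k * m) * L -> - e * L <= I2 ->
      - e * H <= I3 -> I4 <= e * H -> (I1 - I2) - (I3 - I4) = 0 -> k * m * L <= e * (L + 2 * H).
    by clear; lra.
  exact: arith bot top right left (J0 N).
apply/eqP; rewrite -modulus_eq0 -[_ == 0](@expf_eq0 _ _ 2) -/k; apply: contraT => kn0.
have {}k0 : 0 < k by rewrite lt_def kn0.
have X0 : 0 < k * m * (b - a).
  by apply: mulr_gt0; [exact: mulr_gt0|rewrite subr_gt0; exact: lt_trans xb].
have W0 : 0 <= W by rewrite /W addr_ge0 ?mulr_ge0 ?subr_ge0.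
have EW0 : 0 <= E * W by rewrite mulr_ge0.
have [|N hN] := @power_lt _ tau (k * m * (b - a) / (E * W + 1)) tau0 tau1.
  by rewrite divr_gt0// ltr_wpDl.
have : k * m * (b - a) < k * m * (b - a).
  apply: le_lt_trans (key N) _; rewrite mulrAC.
  apply: le_lt_trans (ler_wpM2l EW0 hN) _.
  rewrite mulrA ltr_pdivrMr ?ltr_wpDl//.
  by rewrite mulrC; move: X0 EW0; clear; nra.
by rewrite ltxx.
Qed.

Theorem holomorphic_rhp_eq0 h : holomorphic_rhp h ->
  (forall x : R, 0 < x -> h x%:C = 0) -> forall z, 0 < complex.Re z -> h z = 0.
Proof.
move=> hh h0 z z0; have [Iz|Iz|Iz] := ltgtP (complex.Im z) 0; last first.
- have -> : z = (complex.Re z)%:C by case: (z) Iz => ? ? /= ->.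
  exact: h0.
- exact: holomorphic_rhp_upper_eq0.
(* Reflection in the real axis preserves the half-plane and the vanishing on the axis, and carries
   the lower quadrant to the upper one. *)
pose h' w := conjc (h (conjc w)).
have mJ w : modulus (conjc w) = modulus w by rewrite !modulusE; case: w => x y /=; rewrite sqrrN.
have ReJ w : complex.Re (conjc w) = complex.Re w by case: w.
have h'0 : h' (conjc z) = 0.
  apply: holomorphic_rhp_upper_eq0.
  - move=> w w0; have [|l hl] := (derivable_modulusP h (conjc w)).1; first by apply: hh; rewrite ReJ.
    apply/derivable_modulusP; exists (conjc l) => e e0.
    have [r r0 hr] := hl _ e0; exists r => // t tr.
    have -> : h' (w + t) - h' w - conjc l * t = conjc (h (conjc w + conjc t) - h (conjc w) - l * conjc t).
      by rewrite /h' !rmorphB rmorphM /= conjcK rmorphD.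
    by rewrite mJ -(mJ t); apply: hr; rewrite mJ.
  - by move=> x x0; rewrite /h' conjc_real h0// conjc0.
  - by rewrite ReJ.
  - by case: (z) Iz => x y /=; rewrite oppr_gt0.
have hz : conjc (h z) = 0 by rewrite -h'0 /h' conjcK.
by rewrite -[h z]conjcK hz conjc0.
Qed.
End Identity.

Section KernelDerivable.
Context {K : numFieldType}.
Implicit Types (f : K -> K) (z : K).

Lemma derivable_subl_div f (c p : K) z : z - p != 0 -> derivable f z 1 ->
  derivable (fun w => (f w - c) / (w - p)) z 1.
Proof.
move=> zp df; have d1 : derivable (fun w => f w - c) z 1.
  by apply: derivableB => //; exact: derivable_cst.
exact: (@derivable_div _ _ (fun w => w - p) z zp d1 (derivable_shift p z)).
Qed.

Lemma within_continuous_subl_div f (c p : K) (A : set K) : (forall z, A z -> z - p != 0) ->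
  {within A, continuous f} -> {within A, continuous (fun w => (f w - c) / (w - p))}.
Proof.
move=> Ap cf; apply/subspace_continuousP => z Az.
have cfz := (@subspace_continuousP _ _ _ _).1 cf z Az; rewrite /from_subspace in cfz *.
apply: cvgM; first by apply: cvgB; [exact: cfz|exact: cvg_cst].
apply: cvgV; first exact: Ap.
by apply: cvgB; [exact: cvg_within|exact: cvg_cst].
Qed.
End KernelDerivable.

Section Poisson.
Context {R : realType}.
Implicit Types (h : R[i] -> R[i]) (z : R[i]) (a M T : R).

Definition closed_rhp : set R[i] := [set z | 0 <= complex.Re z].

(** Cauchy's theorem on [0, T] x [-T, T] for i (h(z) - h(a)) / ((z + a) (z - a)): subtracting h(a)
    makes the singularity at a removable, and on the axis the denominator is - (y^2 + a^2). The
    other three sides have total length 4 T, and the integrand is at most 8 M / T^2 there. *)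
Theorem poisson_kernel_approx h a M T : 0 < a -> 2 * a <= T ->
  {within closed_rhp : set R[i]^o, continuous (h : R[i]^o -> R[i]^o)} ->
  holomorphic_rhp h ->
  (forall z, 0 <= complex.Re z -> modulus (h z) <= M) ->
  `|\int_[- T, T] (fun y => (complex.Re (h (0 +i* y)) - complex.Re (h a%:C)) / (y ^+ 2 + a ^+ 2))|
    <= 32 * M / T.
Proof.
move=> a0 aT ch hh hM; have T0 : 0 < T by lra.
have M0 : 0 <= M by apply: le_trans (hM 0 _); rewrite ?modulus_ge0//.
pose A : R[i] := a%:C.
pose P z := (h z - h A) / (z - - A).
have shift_neq z : 0 <= complex.Re z -> z - - A != 0.
  by move=> z0; rewrite eq_complex !complexRI /= opprK negb_and gt_eqF// ltr_wpDl.
have dP z : 0 < complex.Re z -> derivable (P : R[i]^o -> R[i]^o) z 1.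
  move=> z0; apply: (@derivable_subl_div _ h (h A) (- A) z); last exact: hh.
  by apply: shift_neq; exact: ltW.
(* [circulation] takes imaginary parts along vertical sides; the factor i puts the real part of the
   quotient there. *)
pose g z := (0 +i* 1) * dquot (P : R[i]^o -> R[i]^o) A z.
have gE z : z != A -> g z = (0 +i* 1) * ((h z - h A) / ((z + A) * (z - A))).
  have PA : P A = 0 by rewrite /P subrr mul0r.
  by move=> zA; rewrite /g /dquot ifN// PA subr0 /P opprK -[in LHS]mulrA -invfM.
have rect z : rectangle 0 T (- T) T z -> closed_rhp z by case=> /andP[].
have cg : {within rectangle 0 T (- T) T : set R[i]^o, continuous (g : R[i]^o -> R[i]^o)}.
  apply: within_continuous_mull; apply: within_continuous_dquot; first exact: dP.
  apply: (@within_continuous_subl_div _ h (h A) (- A)).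
    by move=> z /rect; exact: shift_neq.
  exact: continuous_subspaceW ch.
have J0 : circulation (fun x y => complex.Re (g (x +i* y)))
    (fun x y => complex.Im (g (x +i* y))) 0 T (- T) T = 0.
  apply: (@cauchy_rectangle _ _ _ _ _ _ a) => //.
  - by rewrite a0; move: a0 aT; clear; lra.
  - by move: T0; clear; lra.
  - move=> z /andP[z0 zT] za _; apply: derivable_mull; apply: derivable_dquot; last exact: dP.
    by apply: contraNneq za => ->.
(* The numerator is at most 2 M, and 2 a <= T leaves |z + a| and |z - a| at least T / 2. *)
have far z : 0 <= complex.Re z -> T <= modulus z -> modulus (g z) <= 8 * M / T ^+ 2.
  move=> z0 Tz; have zA : z != A.
    apply: contraTneq Tz => ->; rewrite modulus_real gtr0_norm// -ltNge.
    by move: a0 aT; clear; lra.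
  have m1 : modulus (0 +i* (1 : R)) = 1.
    by rewrite modulusE /= expr0n expr1n add0r sqrtr1.
  rewrite gE// modulusM m1 mul1r modulusM modulusV (modulusM (z + A)).
  have Ta : T / 2 <= T - a by move: aT; clear; lra.
  have mA : modulus A = a by rewrite modulus_real gtr0_norm.
  have f1 : T / 2 <= modulus (z + A).
    apply: le_trans (_ : modulus z - modulus (- A) <= _).
      by rewrite modulusN mA; move: Ta Tz; clear; lra.
    by apply: le_trans (ler_sub_modulus _ _) _; rewrite opprK.
  have f2 : T / 2 <= modulus (z - A).
    apply: le_trans (_ : modulus z - modulus A <= _); last exact: ler_sub_modulus.
    by rewrite mA; move: Ta Tz; clear; lra.
  have -> : 8 * M / T ^+ 2 = (M + M) * (T / 2 * (T / 2))^-1.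
    by field; rewrite gt_eqF.
  have T20 : 0 < T / 2 by move: T0; clear; lra.
  apply: ler_pM; rewrite ?modulus_ge0// ?invr_ge0 ?mulr_ge0 ?modulus_ge0//.
    apply: le_trans (ler_modulusD _ _) _; rewrite modulusN; apply: lerD; apply: hM => //.
    by rewrite /= ltW.
  rewrite lef_pV2 ?posrE; [|by rewrite mulr_gt0 ?(lt_le_trans T20)|by rewrite mulr_gt0].
  by apply: ler_pM => //; exact: ltW.
have [sc1 sc2] := rectangle_jointly_continuous _ _ _ _ _ cg.
have [cu cv] := jointly_continuous_separately _ _ _ _ _ _ sc1 sc2.
set e := 8 * M / T ^+ 2 in far.
have TT : - T <= T by move: T0; clear; lra.
have bot : `|\int_[0, T] (fun x => complex.Re (g (x +i* (- T)))) - 0 * (T - 0)| <= e * (T - 0).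
  apply: segment_integral_approx; first exact: ltW.
    by apply: cu; rewrite lexx.
  move=> x /andP[x0 xT]; rewrite subr0; apply: le_trans (ler_Re_modulus _) (far _ _ _) => //.
  by apply: le_trans (ler_Im_modulus _); rewrite /= normrN ler_norm.
have top : `|\int_[0, T] (fun x => complex.Re (g (x +i* T))) - 0 * (T - 0)| <= e * (T - 0).
  apply: segment_integral_approx; first exact: ltW.
    by apply: cu; rewrite lexx TT.
  move=> x /andP[x0 xT]; rewrite subr0; apply: le_trans (ler_Re_modulus _) (far _ _ _) => //.
  by apply: le_trans (ler_Im_modulus _); rewrite /= ler_norm.
have right : `|\int_[- T, T] (fun y => complex.Im (g (T +i* y))) - 0 * (T - - T)| <= e * (T - - T).
  apply: segment_integral_approx => //.
    by apply: cv; rewrite lexx ltW.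
  move=> y yI; rewrite subr0; apply: le_trans (ler_Im_modulus _) (far _ _ _) => //; first exact: ltW.
  by apply: le_trans (ler_Re_modulus _); rewrite /= ler_norm.
have left : \int_[- T, T] (fun y => (complex.Re (h (0 +i* y)) - complex.Re (h A)) / (y ^+ 2 + a ^+ 2)) =
    - \int_[- T, T] (fun y => complex.Im (g (0 +i* y))).
  rewrite -[RHS]mulN1r -RintegralZl//; last first.
    by apply: integrable_segment; apply: cv; rewrite lexx ltW.
  apply: eq_Rintegral => y _; rewrite gE; last first.
    by rewrite eq_complex /= negb_and lt_eqF.
  have -> : (0 +i* y + A) * (0 +i* y - A) = (- (y ^+ 2 + a ^+ 2))%:C.
    by apply/eqP; rewrite eq_complex /=; apply/andP; split; apply/eqP; ring.
  rewrite -fmorphV !complexRI /= invrN; set r := (_ + _)^-1; ring.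
have arith (I1 I2 I3 I4 : R) : `|I1 - 0 * (T - 0)| <= e * (T - 0) -> `|I2 - 0 * (T - 0)| <= e * (T - 0) ->
    `|I3 - 0 * (T - - T)| <= e * (T - - T) -> (I1 - I2) - (I3 - I4) = 0 -> `|- I4| <= 4 * (e * T).
  clear; rewrite !mul0r !subr0 opprK mulrDr normrN !ler_norml.
  move=> /andP[? ?] /andP[? ?] /andP[? ?] ?; apply/andP; split; lra.
have -> : 32 * M / T = 4 * (e * T) by rewrite /e; field; rewrite gt_eqF.
by rewrite left; exact: (arith _ _ _ _ bot top right J0).
Qed.
End Poisson.

(** * Laplace transforms *)

Section ExponentialBounds.
Context {R : realType}.
Implicit Types (p q x : R).

Lemma mean_value_at0 (f df : R -> R) x : (forall y : R, is_derive y (1 : R) f (df y)) ->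
  exists2 c, `|c| <= `|x| & f x - f 0 = df c * x.
Proof.
move=> fd; have cf : continuous f.
  by move=> y; apply: differentiable_continuous; apply/derivable1_diffP; exact: ex_derive.
have [x0|/ltW x0] := leP 0 x.
  have [|c] := @MVT_segment R f df 0 x x0 (fun y _ => fd y).
    exact: continuous_subspaceT.
  rewrite in_itv /= => /andP[c0 cx] ->; exists c; last by rewrite subr0.
  by rewrite !ger0_norm.
have [|c] := @MVT_segment R f df x 0 x0 (fun y _ => fd y).
  exact: continuous_subspaceT.
rewrite in_itv /= => /andP[cx c0] h; exists c; first by rewrite !ler0_norm// lerN2.
by rewrite -opprB h sub0r mulrN opprK.
Qed.

Lemma abs_sin_le x : `|sin x| <= `|x|.
Proof.
have [c _] := @mean_value_at0 sin cos x (fun y => is_derive_sin y).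
by rewrite sin0 subr0 => ->; rewrite normrM ler_piMl// cos_max.
Qed.

Lemma abs_cosB1_le x : `|cos x - 1| <= x ^+ 2.
Proof.
have [c cx] := @mean_value_at0 cos (fun y => - sin y) x (fun y => is_derive_cos y).
rewrite cos0 => ->; rewrite normrM normrN -[leRHS]ger0_norm ?sqr_ge0// expr2 normrM.
by rewrite ler_wpM2r//; apply: le_trans cx; exact: abs_sin_le.
Qed.

Lemma abs_sinB_le x : `|sin x - x| <= x ^+ 2.
Proof.
have [c cx h] := @mean_value_at0 sin cos x (fun y => is_derive_sin y).
move: h; rewrite sin0 subr0 => ->; rewrite -[X in _ - X]mul1r -mulrBl normrM.
rewrite -[leRHS]ger0_norm ?sqr_ge0// expr2 normrM ler_wpM2r//.
have [d _] := @mean_value_at0 cos (fun y => - sin y) c (fun y => is_derive_cos y).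
rewrite cos0 => ->; rewrite normrM normrN; apply: le_trans cx.
by rewrite ler_piMl// ler_norml sin_geN1 sin_le1.
Qed.

Lemma abs_expRB1_le p : `|expR p - 1| <= `|p| * expR `|p|.
Proof.
have h1 := expR_ge1Dx p; have h2 := expR_ge1Dx (- p); have h3 := expR_gt0 p.
rewrite expRN in h2.
have h4 : (1 - p) * expR p <= 1 by rewrite -ler_pdivlMr// div1r.
have [p0|p0] := leP 0 p.
  rewrite (ger0_norm p0) ger0_norm; first by move: h4; clear; nra.
  by move: h1 p0; clear; lra.
rewrite (ltr0_norm p0) ltr0_norm; last by rewrite subr_lt0 expR_lt1.
have h5 : 1 <= expR (- p) by rewrite -expR0 ler_expR oppr_ge0 ltW.
by move: h1 h5 p0; clear; nra.
Qed.

Lemma abs_expRB1Bp_le p : `|expR p - 1 - p| <= p ^+ 2 * expR `|p|.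
Proof.
have h1 := expR_ge1Dx p; have h2 := expR_ge1Dx (- p); have h3 := expR_gt0 p.
rewrite expRN in h2.
have h4 : (1 - p) * expR p <= 1 by rewrite -ler_pdivlMr// div1r.
rewrite ger0_norm; last by move: h1; clear; lra.
apply: le_trans (_ : p * (expR p - 1) <= _); first by move: h4; clear; lra.
apply: le_trans (ler_norm _) _; rewrite normrM -[p ^+ 2]real_normK ?num_real// expr2 -mulrA.
by apply: ler_wpM2l => //; exact: abs_expRB1_le.
Qed.

(** The real part of the remainder exp(p + i q) - 1 - (p + i q); [expR_sinB_le] treats the imaginary
    part. *)
Lemma expR_cosB_le p q : `|expR p * cos q - 1 - p| <= (`|p| + `|q|) ^+ 2 * expR `|p|.
Proof.
have -> : expR p * cos q - 1 - p = (expR p - 1 - p) + expR p * (cos q - 1) by ring.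
apply: le_trans (ler_normD _ _) _; rewrite normrM (gtr0_norm (expR_gt0 p)).
have h1 := abs_expRB1Bp_le p; have h2 := abs_cosB1_le q.
have h3 : expR p <= expR `|p| by rewrite ler_expR ler_norm.
have h4 : expR p * `|cos q - 1| <= expR `|p| * q ^+ 2.
  by apply: ler_pM => //; exact: expR_ge0.
rewrite sqrrD !real_normK ?num_real//.
have := mulr_ge0 (mulr_ge0 (normr_ge0 p) (normr_ge0 q)) (expR_ge0 `|p|).
by move: h1 h4; clear; nra.
Qed.

Lemma expR_sinB_le p q : `|expR p * sin q - q| <= (`|p| + `|q|) ^+ 2 * expR `|p|.
Proof.
have -> : expR p * sin q - q = (expR p - 1) * sin q + (sin q - q) by ring.
apply: le_trans (ler_normD _ _) _; rewrite normrM.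
have h1 := abs_expRB1_le p; have h2 := abs_sin_le q; have h3 := abs_sinB_le q.
have h4 : `|expR p - 1| * `|sin q| <= (`|p| * expR `|p|) * `|q| by exact: ler_pM.
have h5 : 1 <= expR `|p| by rewrite -expR0 ler_expR.
have h6 : q ^+ 2 <= q ^+ 2 * expR `|p| by rewrite ler_peMr// sqr_ge0.
rewrite sqrrD !real_normK ?num_real//.
have := mulr_ge0 (mulr_ge0 (normr_ge0 p) (normr_ge0 q)) (expR_ge0 `|p|).
have := mulr_ge0 (sqr_ge0 p) (expR_ge0 `|p|).
by move: h3 h4 h6; clear; nra.
Qed.

End ExponentialBounds.

Section Laplace.
Context {R : realType} (mu : {measure set (measurableTypeR R) -> \bar R}) (f : R -> R).
Local Notation I := (`[0%R, +oo[%classic : set R).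
Hypothesis fmu : forall x : R, 0 < x ->
  mu.-integrable I (fun t => (expR (- (t * x)))%:E) /\
  f x = Rintegral mu I (fun t => expR (- (t * x))).
Implicit Types (phi : R -> R) (x y t : R).
Local Notation "\int phi" := (Rintegral mu I phi) (at level 36, phi at level 36).

Let mI : measurable (I : set (measurableTypeR R)). Proof. exact: measurable_itv. Qed.

(** [mu] may have infinite mass, so constants cannot serve as dominating functions; decaying
    exponentials can, and their integrals are values of [f]. *)
Lemma laplace_dominated phi x (k : R) : continuous phi -> 0 < x ->
  (forall t, 0 <= t -> `|phi t| <= k * expR (- (t * x))) ->
  mu.-integrable I (EFin \o phi) /\ `|\int phi| <= k * f x.
Proof.
move=> cphi x0 hphi; have [ix ->] := fmu x x0.
have ik : mu.-integrable I (EFin \o (fun t => k * expR (- (t * x)))).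
  exact: (integrableZl mI k ix).
have ip : mu.-integrable I (EFin \o phi).
  apply: (le_integrable mI _ _ ik).
    apply/measurable_EFinP; apply: measurable_funTS.
    exact: continuous_measurable_fun.
  move=> t /=; rewrite in_itv /= andbT => t0; rewrite lee_fin.
  exact: le_trans (hphi t t0) (ler_norm _).
split=> //; rewrite -RintegralZl//.
apply: le_trans (le_normr_Rintegral _ ip) _ => //; apply: le_Rintegral => //.
  exact: integrable_norm ip.
by move=> t /=; rewrite in_itv /= andbT; exact: hphi.
Qed.

Lemma laplace_ge0 x : 0 < x -> 0 <= f x.
Proof. by move=> /fmu[_ ->]; apply: Rintegral_ge0 => t _; exact: expR_ge0. Qed.

Lemma laplace_nonincreasing x y : 0 < x -> x <= y -> f y <= f x.
Proof.
move=> x0 xy; have [ix ->] := fmu x x0; have [iy ->] := fmu y (lt_le_trans x0 xy).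
apply: le_Rintegral => // t /=; rewrite in_itv /= andbT => t0.
by rewrite ler_expR lerN2 ler_wpM2l.
Qed.

Lemma continuous_expRN x : continuous (fun t => expR (- (t * x))).
Proof.
move=> t; apply: (@continuous_comp _ _ _ (fun t => - (t * x)) expR); last exact: continuous_expR.
by apply: continuousN; apply: continuousM; [exact: cvg_id|exact: cvg_cst].
Qed.

Lemma continuous_cosM y : continuous (fun t => cos (t * y)).
Proof.
move=> t; apply: (@continuous_comp _ _ _ (fun t => t * y) cos); last exact: continuous_cos.
by apply: continuousM; [exact: cvg_id|exact: cvg_cst].
Qed.

Lemma continuous_sinM y : continuous (fun t => sin (t * y)).
Proof.
move=> t; apply: (@continuous_comp _ _ _ (fun t => t * y) sin); last exact: continuous_sin.
by apply: continuousM; [exact: cvg_id|exact: cvg_cst].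
Qed.

Lemma Rintegral_linear (a b u v : R -> R) (s r : R) :
  mu.-integrable I (EFin \o a) -> mu.-integrable I (EFin \o b) ->
  mu.-integrable I (EFin \o u) -> mu.-integrable I (EFin \o v) ->
  \int (fun t => a t - b t - (s * u t - r * v t)) =
  \int a - \int b - (s * \int u - r * \int v).
Proof.
move=> ia ib iu iv.
have iZ (k : R) w : mu.-integrable I (EFin \o w) -> mu.-integrable I (EFin \o (fun t => k * w t)).
  by move=> iw; exact: (integrableZl mI k iw).
have iB w w' : mu.-integrable I (EFin \o w) -> mu.-integrable I (EFin \o w') ->
    mu.-integrable I (EFin \o (fun t => w t - w' t)).
  by move=> iw iw'; exact: (integrableB mI iw iw').
rewrite (RintegralB _ (iB _ _ ia ib) (iB _ _ (iZ s _ iu) (iZ r _ iv)))//.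
by rewrite !RintegralB ?RintegralZl//; exact: iZ.
Qed.

Definition laplace_transform (z : R[i]) : R[i] :=
  (\int (fun t => expR (- (t * complex.Re z)) * cos (t * complex.Im z))) +i*
  (\int (fun t => - (expR (- (t * complex.Re z)) * sin (t * complex.Im z)))).

Let kernel_c z t : R := expR (- (t * complex.Re z)) * cos (t * complex.Im z).
Let kernel_s z t : R := - (expR (- (t * complex.Re z)) * sin (t * complex.Im z)).

Let continuous_c z : continuous (kernel_c z).
Proof.
move=> t; rewrite /kernel_c; apply: cvgM; first exact: continuous_expRN.
exact: continuous_cosM.
Qed.

Let continuous_s z : continuous (kernel_s z).
Proof.
move=> t; rewrite /kernel_s; apply: cvgN; apply: cvgM; first exact: continuous_expRN.
exact: continuous_sinM.
Qed.

Let kernel_c_le z t : `|kernel_c z t| <= 1 * expR (- (t * complex.Re z)).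
Proof.
by rewrite /kernel_c normrM ger0_norm ?expR_ge0// mul1r ler_piMr ?expR_ge0// cos_max.
Qed.

Let kernel_s_le z t : `|kernel_s z t| <= 1 * expR (- (t * complex.Re z)).
Proof.
rewrite /kernel_s normrN normrM ger0_norm ?expR_ge0// mul1r ler_piMr ?expR_ge0//.
by rewrite ler_norml sin_geN1 sin_le1.
Qed.

Lemma laplace_transform_real x : laplace_transform x%:C = (Rintegral mu I (fun t => expR (- (t * x))))%:C.
Proof.
congr (_ +i* _).
  by apply: eq_Rintegral => t _; rewrite /= mulr0 cos0 mulr1.
transitivity (Rintegral mu I (fun=> 0)); last by rewrite Rintegral_cst ?mul0r.
by apply: eq_Rintegral => t _; rewrite /= mulr0 sin0 mulr0 oppr0.
Qed.

Lemma laplace_transform_le z : 0 < complex.Re z ->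
  modulus (laplace_transform z) <= 2 * f (complex.Re z).
Proof.
move=> z0; apply: le_trans (ler_modulus_ReIm _) _ => /=.
have [_ h1] := @laplace_dominated _ _ 1 (continuous_c z) z0 (fun t _ => kernel_c_le z t).
have [_ h2] := @laplace_dominated _ _ 1 (continuous_s z) z0 (fun t _ => kernel_s_le z t).
by move: h1 h2; rewrite /kernel_c /kernel_s; lra.
Qed.

(** Part of the exponential decay is traded for the factor t^2: s <= exp s at s = t x / 8, squared,
    which gives 64. *)
Let sqr_expR_le x t : 0 < x -> 0 <= t -> t ^+ 2 * expR (- (t * (x / 2))) <= 64 / x ^+ 2 * expR (- (t * (x / 4))).
Proof.
move=> x0 t0; have h : t * x / 8 <= expR (t * x / 8).
  by apply: le_trans (expR_ge1Dx _); rewrite lerDr.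
have -> : - (t * (x / 2)) = - (t * (x / 4)) - (t * x / 8 + t * x / 8) by field.
rewrite expRD mulrCA [leRHS]mulrC.
apply: ler_wpM2l; first exact: expR_ge0.
rewrite expRN ler_pdivrMr ?expR_gt0// expRD.
have -> : t ^+ 2 = 64 / x ^+ 2 * ((t * x / 8) * (t * x / 8)) by field; rewrite gt_eqF.
rewrite ler_pM2l; last by rewrite divr_gt0// exprn_gt0.
have tx : 0 <= t * x / 8 by rewrite !mulr_ge0// ltW.
exact: ler_pM.
Qed.

(* [l] is the transform of [- t]; the second-order Taylor bound for the complex
   exponential makes the remainder quadratic in the increment. *)
Lemma holomorphic_laplace_transform : holomorphic_rhp laplace_transform.
Proof.
move=> z; set x0 := complex.Re z; set y0 := complex.Im z => x0_gt0.
pose u t := - (t * (expR (- (t * x0)) * cos (t * y0))).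
pose v t := t * (expR (- (t * x0)) * sin (t * y0)).
have cu : continuous u.
  move=> t; apply: cvgN; apply: cvgM; first exact: cvg_id.
  exact: (continuous_c z).
have cv : continuous v.
  move=> t; apply: cvgM; first exact: cvg_id.
  by apply: cvgM; [exact: continuous_expRN|exact: continuous_sinM].
have x2 : 0 < x0 / 2 by rewrite divr_gt0.
have x4 : 0 < x0 / 4 by rewrite divr_gt0.
have lin_le (t c : R) : 0 <= t -> `|c| <= 1 -> `|t * (expR (- (t * x0)) * c)| <= 2 / x0 * expR (- (t * (x0 / 2))).
  move=> t0 c1; rewrite !normrM (ger0_norm t0) (ger0_norm (expR_ge0 _)).
  have h : t * (x0 / 2) <= expR (t * (x0 / 2)).
    by apply: le_trans (expR_ge1Dx _); rewrite lerDr.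
  have -> : - (t * x0) = - (t * (x0 / 2)) - t * (x0 / 2) by field.
  rewrite expRD [leRHS]mulrC -mulrA mulrCA; apply: ler_wpM2l; first exact: expR_ge0.
  apply: le_trans (_ : t * expR (- (t * (x0 / 2))) <= _).
    by apply: ler_wpM2l => //; rewrite ler_piMr ?expR_ge0.
  rewrite expRN ler_pdivrMr ?expR_gt0//.
  rewrite [leLHS](_ : _ = 2 / x0 * (t * (x0 / 2))); last by field; rewrite gt_eqF.
  by rewrite ler_pM2l ?divr_gt0.
have [iu _] : mu.-integrable I (EFin \o u) /\ `|\int u| <= 2 / x0 * f (x0 / 2).
  by apply: laplace_dominated => // t t0; rewrite /u normrN; apply: lin_le => //; exact: cos_max.
have [iv _] : mu.-integrable I (EFin \o v) /\ `|\int v| <= 2 / x0 * f (x0 / 2).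
  apply: laplace_dominated => // t t0; apply: lin_le => //.
  by rewrite ler_norml sin_geN1 sin_le1.
have ic w : 0 < complex.Re w -> mu.-integrable I (EFin \o kernel_c w).
  by move=> w0; have [] := @laplace_dominated _ _ 1 (continuous_c w) w0 (fun t _ => kernel_c_le w t).
have is_ w : 0 < complex.Re w -> mu.-integrable I (EFin \o kernel_s w).
  by move=> w0; have [] := @laplace_dominated _ _ 1 (continuous_s w) w0 (fun t _ => kernel_s_le w t).
apply/derivable_modulusP; exists ((\int u) +i* (\int v)) => e e0.
(* The real and imaginary remainders add up to 256 / x0^2 f(x0 / 4) D, and D <= (2 |w|)^2. *)
pose K := 1024 / x0 ^+ 2 * f (x0 / 4).
have xx0 : 0 <= x0 ^+ 2 by exact: sqr_ge0.
have K0 : 0 <= K by apply: mulr_ge0; [apply: divr_ge0; [exact: ler0n|]|exact: laplace_ge0].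
exists (Num.min (x0 / 2) (e / (K + 1))).
  by rewrite lt_min x2 divr_gt0// ltr_wpDl.
move=> w; set s := complex.Re w; set r := complex.Im w; rewrite lt_min => /andP[w1 w2].
have sw : `|s| <= modulus w := ler_Re_modulus w.
have rw : `|r| <= modulus w := ler_Im_modulus w.
have zw0 : 0 < complex.Re (z + w).
  rewrite Re_add -/x0 -/s; move: sw w1 x0_gt0; rewrite ler_norml => /andP[? ?] ? ?; lra.
pose D := (`|s| + `|r|) ^+ 2.
(* The increment of exp(- t z) minus its linear part is exp(- t z) times the remainder of exp(- t
   w); [c1] and [c2] stand for the sine and cosine of t y0 up to sign. Half of the decay exp(- t x0)
   pays for exp |t s|, another quarter for t^2, and a quarter is kept. *)
have rem_le (t c1 c2 : R) : 0 <= t -> `|c1| <= 1 -> `|c2| <= 1 ->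
    `|expR (- (t * x0)) * (c1 * (expR (- (t * s)) * cos (t * r) - 1 - - (t * s)) +
       c2 * (expR (- (t * s)) * sin (t * r) - t * r))| <= 128 / x0 ^+ 2 * D * expR (- (t * (x0 / 4))).
  move=> t0 hc1 hc2; rewrite normrM ger0_norm ?expR_ge0//.
  have h1 := expR_cosB_le (- (t * s)) (t * r); have h2 := expR_sinB_le (- (t * s)) (t * r).
  have ts : `|- (t * s)| <= t * (x0 / 2).
    by rewrite normrN normrM ger0_norm//; apply: ler_wpM2l => //; exact: le_trans sw (ltW w1).
  have E : (`|- (t * s)| + `|t * r|) ^+ 2 = t ^+ 2 * D.
    by rewrite normrN !normrM (ger0_norm t0) -mulrDr exprMn.
  rewrite !E in h1 h2.
  have tD : 0 <= t ^+ 2 * D by rewrite mulr_ge0 ?sqr_ge0.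
  have h3 : t ^+ 2 * D * expR `|- (t * s)| <= t ^+ 2 * D * expR (t * (x0 / 2)).
    by apply: ler_wpM2l => //; rewrite ler_expR.
  have h4 (a c B : R) : `|a| <= B -> `|c| <= 1 -> `|c * a| <= B.
    by move=> aB c_le; rewrite normrM; apply: le_trans aB; rewrite ler_piMl.
  have h5 := h4 _ _ _ (le_trans h1 h3) hc1; have h6 := h4 _ _ _ (le_trans h2 h3) hc2.
  have h7 := le_trans (ler_normD _ _) (lerD h5 h6).
  apply: le_trans (ler_wpM2l (expR_ge0 _) h7) _.
  have -> : 128 / x0 ^+ 2 * D * expR (- (t * (x0 / 4))) = 2 * D * (64 / x0 ^+ 2 * expR (- (t * (x0 / 4)))).
    by field; rewrite gt_eqF.
  apply: le_trans (ler_wpM2l _ (sqr_expR_le _ _ x0_gt0 t0)); last by rewrite mulr_ge0// sqr_ge0.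
  have -> : expR (- (t * (x0 / 2))) = expR (- (t * x0)) * expR (t * (x0 / 2)).
    by rewrite -expRD; congr expR; field.
  by rewrite le_eqVlt; apply/orP; left; apply/eqP; ring.
have cosE t : cos (t * complex.Im (z + w)) = cos (t * y0) * cos (t * r) - sin (t * y0) * sin (t * r).
  by rewrite Im_add mulrDr cosD.
have sinE t : sin (t * complex.Im (z + w)) = sin (t * y0) * cos (t * r) + cos (t * y0) * sin (t * r).
  by rewrite Im_add mulrDr sinD.
have expE t : expR (- (t * complex.Re (z + w))) = expR (- (t * x0)) * expR (- (t * s)).
  by rewrite Re_add mulrDr opprD expRD.
have sin1 (t : R) : `|sin t| <= 1 by rewrite ler_norml sin_geN1 sin_le1.
have HRe : `|complex.Re (laplace_transform (z + w) - laplace_transform z - ((\int u) +i* (\int v)) * w)|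
    <= 128 / x0 ^+ 2 * D * f (x0 / 4).
  rewrite !complexRI /= -/s -/r.
  rewrite -[Rintegral mu I (fun t => _ * cos (t * complex.Im (z + w)))]/(\int (kernel_c (z + w))).
  rewrite -[Rintegral mu I (fun t => _ * cos (t * complex.Im z))]/(\int (kernel_c z)).
  rewrite [(\int u) * s]mulrC [(\int v) * r]mulrC -Rintegral_linear ?ic ?is_//.
  have [|t t0|//] := @laplace_dominated (fun t => kernel_c (z + w) t - kernel_c z t - (s * u t - r * v t))
    (x0 / 4) (128 / x0 ^+ 2 * D) _ x4.
    move=> t; apply: cvgB; first by apply: cvgB; exact: continuous_c.
    by apply: cvgB; apply: cvgM; [exact: cvg_cst|exact: cu|exact: cvg_cst|exact: cv].
  apply: le_trans (rem_le t (cos (t * y0)) (- sin (t * y0)) t0 (cos_max _) _); last by rewrite normrN.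
  by rewrite le_eqVlt; apply/orP; left; apply/eqP; congr (`|_|);
    rewrite /kernel_c cosE expE /u /v -/x0 -/y0; ring.
have HIm : `|complex.Im (laplace_transform (z + w) - laplace_transform z - ((\int u) +i* (\int v)) * w)|
    <= 128 / x0 ^+ 2 * D * f (x0 / 4).
  rewrite !complexRI /= -/s -/r.
  rewrite -[Rintegral mu I (fun t => - (_ * sin (t * complex.Im (z + w))))]/(\int (kernel_s (z + w))).
  rewrite -[Rintegral mu I (fun t => - (_ * sin (t * complex.Im z)))]/(\int (kernel_s z)).
  rewrite (_ : (\int u) * r + (\int v) * s = r * (\int u) - (- s) * (\int v)); last by ring.
  rewrite -Rintegral_linear ?ic ?is_//.
  have [|t t0|//] := @laplace_dominated (fun t => kernel_s (z + w) t - kernel_s z t - (r * u t - (- s) * v t))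
    (x0 / 4) (128 / x0 ^+ 2 * D) _ x4.
    move=> t; apply: cvgB; first by apply: cvgB; exact: continuous_s.
    by apply: cvgB; apply: cvgM; [exact: cvg_cst|exact: cu|exact: cvg_cst|exact: cv].
  apply: le_trans (rem_le t (- sin (t * y0)) (- cos (t * y0)) t0 _ _); rewrite ?normrN ?cos_max//.
  by rewrite le_eqVlt; apply/orP; left; apply/eqP; congr (`|_|);
    rewrite /kernel_s sinE expE /u /v -/x0 -/y0; ring.
have DK : 128 / x0 ^+ 2 * D * f (x0 / 4) + 128 / x0 ^+ 2 * D * f (x0 / 4) <= K * modulus w * modulus w.
  have -> : K * modulus w * modulus w = 256 / x0 ^+ 2 * f (x0 / 4) * (modulus w + modulus w) ^+ 2.
    by rewrite /K; field; rewrite gt_eqF.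
  have -> : 128 / x0 ^+ 2 * D * f (x0 / 4) + 128 / x0 ^+ 2 * D * f (x0 / 4) = 256 / x0 ^+ 2 * f (x0 / 4) * D.
    by field; rewrite gt_eqF.
  apply: ler_wpM2l.
    by apply: mulr_ge0; [apply: divr_ge0; [exact: ler0n|]|exact: laplace_ge0].
  by apply: lerXn2r; rewrite ?nnegrE ?addr_ge0 ?modulus_ge0// lerD.
apply: le_trans (ler_modulus_ReIm _) _.
apply: le_trans (lerD HRe HIm) _; apply: le_trans DK _.
rewrite ler_wpM2r ?modulus_ge0//.
apply: le_trans (ler_wpM2l K0 (ltW w2)) _.
by rewrite mulrCA ler_piMr ?(ltW e0)// ler_pdivrMr ?ltr_wpDl// mul1r lerDl.
Qed.
End Laplace.

Section LaplaceStieltjes.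
Context {R : realType}.
Variables (f : R -> R) (F : R[i] -> R[i]).
Hypothesis f_LS : laplace_stieltjes f.
Hypothesis F_extends : forall x : R, 0 < x -> F x%:C = (f x)%:C.
Hypothesis F_analytic : analytic_on_slit_plane F.

Lemma closed_rhp_slit_plane : closed_rhp `<=` (slit_plane : set R[i]).
Proof. by move=> z /= z0 [_]; rewrite ltNge z0. Qed.

Lemma analytic_continuous_closed_rhp :
  {within closed_rhp : set R[i]^o, continuous (F : R[i]^o -> R[i]^o)}.
Proof. by have [cF _] := F_analytic; apply: continuous_subspaceW cF; exact: closed_rhp_slit_plane. Qed.

Lemma analytic_holomorphic_rhp : holomorphic_rhp F.
Proof.
have [_ dF] := F_analytic; move=> z z0; apply: dF.
apply/nbhs_ballP; exists (complex.Re z)%:C; first by rewrite /= ltcR.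
move=> w; rewrite /ball /= normr_modulus ltcR => zw; apply: closed_rhp_slit_plane => /=.
have := le_lt_trans (ler_Re_modulus _) zw; rewrite !complexRI ltr_norml => /andP[_ ?].
by apply: ltW; lra.
Qed.

(** The identity theorem and [laplace_transform_le] give |F(z)| <= 2 f(Re z) on the open half-plane.
    Continuity of [F] at 0 bounds [f] near 0, monotonicity bounds it everywhere, and continuity of
    [F] carries the bound to the axis. *)
Lemma laplace_stieltjes_bounded :
  exists M, forall z, 0 <= complex.Re z -> modulus (F z) <= M.
Proof.
have [mu hmu] := f_LS.
have FE z : 0 < complex.Re z -> F z = laplace_transform mu z.
  move=> z0; apply/eqP; rewrite -subr_eq0; apply/eqP.
  apply: (@holomorphic_rhp_eq0 _ (fun z => F z - laplace_transform mu z)) => //.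
    move=> w w0; have dF := analytic_holomorphic_rhp w w0.
    have dG := holomorphic_laplace_transform _ _ hmu w w0.
    exact: (@derivableB _ R[i]^o R[i]^o _ _ _ _ dF dG).
  move=> x x0; rewrite F_extends// laplace_transform_real.
  by have [_ ->] := hmu x x0; rewrite subrr.
have /within_continuous_modulusP cF := analytic_continuous_closed_rhp.
have f0 x : 0 < x -> 0 <= f x by by exact: (laplace_ge0 _ _ hmu).
have [r r0 hr] := cF 0 (lexx 0) 1 ltr01.
pose B := modulus (F 0) + 1.
have fB0 x : 0 < x -> x < r -> f x <= B.
  move=> x0 xr; have := hr x%:C; rewrite subr0 modulus_real gtr0_norm// => /(_ (ltW x0) xr).
  rewrite F_extends// => h; rewrite -[f x](ger0_norm (f0 x x0)) -modulus_real /B addrC.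
  by rewrite -lerBlDr; apply: le_trans (ler_sub_modulus _ _) h.
have fB x : 0 < x -> f x <= B.
  move=> x0; have [xr|xr] := ltP x r; first exact: fB0.
  apply: le_trans (_ : f (r / 2) <= _); last by apply: fB0; lra.
  by apply: (laplace_nonincreasing _ _ hmu); lra.
have FB z : 0 < complex.Re z -> modulus (F z) <= 2 * B.
  move=> z0; rewrite FE//; apply: le_trans (laplace_transform_le _ _ hmu z z0) _.
  by rewrite ler_pM2l// fB.
(* The extra 1 is the tolerance spent in moving from a point of the axis into the open
   half-plane. *)
exists (2 * B + 1) => z; rewrite le_eqVlt => /orP[/eqP z0|z0]; last first.
  by apply: le_trans (FB z z0) _; rewrite lerDl.
have [|s s0 hs] := cF z _ 1 ltr01; first by rewrite /closed_rhp /= -z0.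
have Rw : complex.Re (z + (s / 2)%:C) = s / 2 by rewrite Re_add -z0 /= add0r.
have s2 : 0 < s / 2 by rewrite divr_gt0.
have := hs (z + (s / 2)%:C); rewrite /closed_rhp /= Rw addrAC subrr add0r modulus_real gtr0_norm//.
move=> /(_ (ltW s2)) h; rewrite addrC -lerBlDr.
apply: le_trans (_ : modulus (F z) - modulus (F (z + (s / 2)%:C)) <= _).
  by rewrite lerB// FB// Rw.
apply: le_trans (ler_sub_modulus _ _) _; rewrite modulusB; apply: h; lra.
Qed.
End LaplaceStieltjes.

(** * Cauchy's formula on the imaginary axis *)

Section KernelGeneric.
Context {K : numFieldType}.
Implicit Types (h : K -> K) (z p c : K).

Lemma derivable_mul_mobius h p c q z : z - q != 0 -> derivable h z 1 ->
  derivable (fun w => h w * (w - p) * (c / (w - q))) z 1.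
Proof.
move=> zq dh.
exact: (derivableM (derivableM dh (derivable_shift p z)) (@derivable_mobius _ c q z zq)).
Qed.

Lemma within_continuous_mul_mobius h p c q (A : set K) : (forall z, A z -> z - q != 0) ->
  {within A, continuous h} ->
  {within A, continuous (fun w => h w * (w - p) * (c / (w - q)))}.
Proof.
move=> Aq ch; apply/subspace_continuousP => z Az.
have chz := (@subspace_continuousP _ _ _ _).1 ch z Az; rewrite /from_subspace in chz *.
apply: cvgM.
  by apply: cvgM; [exact: chz|apply: cvgB; [exact: cvg_within|exact: cvg_cst]].
apply: cvgM; first exact: cvg_cst.
apply: cvgV; first exact: Aq.
by apply: cvgB; [exact: cvg_within|exact: cvg_cst].
Qed.
End KernelGeneric.

Section Arctangent.
Context {R : realType}.
Implicit Types (a T y : R).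

Lemma ler_dist_half (x y z e : R) :
  `|x - y| <= e / 2 -> `|z - y| <= e / 2 -> `|x - z| <= e.
Proof.
by rewrite !ler_norml => /andP[? ?] /andP[? ?]; apply/andP; split; lra.
Qed.

Lemma continuous_invD a : 0 < a -> continuous (fun y => (y ^+ 2 + a ^+ 2)^-1).
Proof.
move=> a0 y; apply: cvgV; first by rewrite gt_eqF// ltr_wpDl ?sqr_ge0// exprn_gt0.
by apply: cvgD; [exact: exprn_continuous|exact: cvg_cst].
Qed.

Lemma integral_invD a T : 0 < a -> 0 < T ->
  \int_[- T, T] (fun y => (y ^+ 2 + a ^+ 2)^-1) = 2 / a * atan (T / a).
Proof.
move=> a0 T0; pose G y := a^-1 * atan (a^-1 * y).
have dG y : is_derive y (1 : R) G (y ^+ 2 + a ^+ 2)^-1.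
  have d1 : is_derive y (1 : R) (fun y : R => a^-1 * y) a^-1.
    by apply: is_derive_eq; rewrite scaler1 ?mulr1.
  have d2 := @is_derive1_comp _ (@atan R) (fun y : R => a^-1 * y) y _ _ (is_derive1_atan _) d1.
  have d3 := @is_deriveZ _ _ _ _ a^-1 y 1 _ d2.
  apply: is_derive_eq d3 _; rewrite /GRing.scale /=; field.
  by rewrite !gt_eqF// ltr_wpDl ?sqr_ge0// exprn_gt0.
have cG y : {for y, continuous G}.
  by apply: differentiable_continuous; apply/derivable1_diffP; exact: ex_derive.
rewrite /Rintegral (@continuous_FTC2 _ _ G).
- rewrite -EFinB /= /G mulrN atanN mulrC [a^-1 * T]mulrC; field; rewrite gt_eqF//.
- by rewrite -subr_gt0 opprK addr_gt0.
- by apply: continuous_subspaceT; exact: continuous_invD.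
- split; first by move=> y _; exact: ex_derive.
  + exact: cvg_at_right_filter (cG _).
  + exact: cvg_at_left_filter (cG _).
- by move=> y _; rewrite derive1E; exact: derive_val.
Qed.

Lemma cvg_integral_invD a : 0 < a ->
  \int_[- T, T] (fun y => (y ^+ 2 + a ^+ 2)^-1) @[T --> +oo] --> pi / a.
Proof.
move=> a0; have -> : pi / a = 2 / a * (pi / 2) :> R by field; rewrite gt_eqF.
have : 2 / a * atan (T / a) @[T --> +oo] --> 2 / a * (pi / 2).
  apply: cvgM; first exact: cvg_cst.
  apply: (cvg_comp _ _ _ (@cvgy_atan R)).
  by apply: gt0_cvgMly; [rewrite invr_gt0|exact: cvg_id].
apply: cvg_trans; apply: near_eq_cvg.
near=> T; rewrite integral_invD//.
Unshelve. all: by end_near. Qed.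
End Arctangent.

Section CauchyLimit.
Context {R : realType}.
Variables (f : R -> R) (F : R[i] -> R[i]) (M : R).
Hypothesis F_extends : forall x : R, 0 < x -> F x%:C = (f x)%:C.
Hypothesis F_holo : holomorphic_rhp F.
Hypothesis F_cont : {within closed_rhp : set R[i]^o, continuous (F : R[i]^o -> R[i]^o)}.
Hypothesis F_bounded : forall z, 0 <= complex.Re z -> modulus (F z) <= M.

(* The factor [b / (z + b)] makes [F z * (z + a) * (b / (z + b))] bounded and tends to
   [1] as [b] grows; dividing by [y^2 + a^2] on the imaginary axis turns [z + a]
   into the Cauchy kernel [1 / (a - i y)]. *)
Definition damped (a b : R) z : R[i] := F z * (z - - a%:C) * (b%:C / (z - - b%:C)).

Lemma shift_neq0 (b : R) z : 0 < b -> 0 <= complex.Re z -> z - - b%:C != 0.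
Proof.
move=> b0 z0; rewrite eq_complex !complexRI /= opprK negb_and.
by apply/orP; left; rewrite gt_eqF// ltr_wpDl.
Qed.

Lemma damped_holomorphic a b : 0 < b -> holomorphic_rhp (damped a b).
Proof.
move=> b0 z z0; apply: (@derivable_mul_mobius _ F (- a%:C) b%:C (- b%:C)); last exact: F_holo.
by apply: shift_neq0 => //; exact: ltW.
Qed.

Lemma damped_continuous a b : 0 < b ->
  {within closed_rhp : set R[i]^o, continuous (damped a b : R[i]^o -> R[i]^o)}.
Proof.
move=> b0; apply: (@within_continuous_mul_mobius _ F (- a%:C) b%:C (- b%:C)) => // z z0.
exact: shift_neq0.
Qed.

(** For Re z >= 0 both |z| and b are at most |z + b|, hence (|z| + a) b / |z + b| <= a + b. *)
Lemma damped_bounded a b z : 0 < a -> 0 < b -> 0 <= complex.Re z ->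
  modulus (damped a b z) <= M * (a + b).
Proof.
move=> a0 b0 z0; rewrite /damped !opprK !modulusM modulusV -mulrA.
have zb0 : 0 < modulus (z + b%:C) by rewrite modulus_gt0 -[b%:C]opprK shift_neq0.
have bz : b <= modulus (z + b%:C).
  by apply: le_trans (ler_Re_modulus _); rewrite !complexRI /=; apply: le_trans (ler_norm _); rewrite lerDr.
have zz : modulus z <= modulus (z + b%:C).
  rewrite !modulusE; apply: ler_wsqrtr; rewrite !complexRI /= addr0 lerD2r.
  by apply: lerXn2r; rewrite ?nnegrE ?addr_ge0 ?(ltW b0)// lerDl ltW.
have M0 : 0 <= M by exact: le_trans (modulus_ge0 _) (F_bounded _ z0).
apply: ler_pM; rewrite ?modulus_ge0 ?F_bounded ?mulr_ge0 ?invr_ge0 ?modulus_ge0//.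
rewrite modulus_real gtr0_norm// mulrA ler_pdivrMr//.
apply: le_trans (_ : (modulus z + a) * b <= _).
  apply: ler_wpM2r; first exact: ltW.
  by apply: le_trans (ler_modulusD _ _) _; rewrite modulus_real gtr0_norm.
rewrite mulrDl mulrDl addrC; apply: lerD; first by apply: ler_wpM2l => //; exact: ltW.
by rewrite mulrC; apply: ler_wpM2l => //; exact: ltW.
Qed.

Definition damped_kernel (a b y : R) : R := complex.Re (damped a b (0 +i* y)) / (y ^+ 2 + a ^+ 2).

Lemma continuous_damped_kernel a b T : 0 < a -> 0 < b -> {within `[- T, T], continuous (damped_kernel a b)}.
Proof.
move=> a0 b0; have cd : {within rectangle 0 1 (- T) T : set R[i]^o, continuous (damped a b : R[i]^o -> R[i]^o)}.
  by apply: continuous_subspaceW (damped_continuous a b b0) => z [/andP[]].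
have [cu _] := rectangle_jointly_continuous _ _ _ _ _ cd.
have [_ cu'] := jointly_continuous_separately _ _ _ _ _ _ cu cu.
have cR := cu' 0 (_ : 0 <= 0 <= 1); rewrite lexx ler01 in cR.
move=> y; apply: cvgM; first exact: (cR isT).
exact: (continuous_subspaceT (continuous_invD a a0)).
Qed.

(** At z = a the factor z + a is 2 a, and 1 / (y^2 + a^2) has integral pi / a; the product is 2 pi
    f(a), up to the value b / (a + b) of the damping. *)
Lemma cvg_damped_integral a b : 0 < a -> 0 < b ->
  \int_[- T, T] (damped_kernel a b) @[T --> +oo] --> 2 * pi * (f a * (b / (a + b))).
Proof.
move=> a0 b0; set k := complex.Re (damped a b a%:C).
have kE : k = 2 * a * (f a * (b / (a + b))).
  rewrite /k /damped F_extends// !opprK -!rmorphD -fmorphV -!rmorphM /=; field.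
  by rewrite gt_eqF// addr_gt0.
have -> : 2 * pi * (f a * (b / (a + b))) = k * (pi / a).
  by rewrite kE; field; rewrite !gt_eqF// addr_gt0.
have cW : k * \int_[- T, T] (fun y => (y ^+ 2 + a ^+ 2)^-1) @[T --> +oo] --> k * (pi / a).
  by apply: cvgM; [exact: cvg_cst|exact: cvg_integral_invD].
apply/cvgrPdist_le => e e0; have e20 : 0 < e / 2 by rewrite divr_gt0.
move/cvgrPdist_le/(_ _ e20) : cW => cW; near=> T.
have T0 : 0 < T by near: T; exact: nbhs_pinfty_gt.
have Ta : 2 * a <= T by near: T; apply: nbhs_pinfty_ge; exact: num_real.
(* This makes the error 32 M (a + b) / T of the Poisson approximation at most e / 2. *)
have TM : 64 * (M * (a + b)) / e <= T by near: T; apply: nbhs_pinfty_ge; exact: num_real.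
have h1 : `|k * (pi / a) - k * \int_[- T, T] (fun y => (y ^+ 2 + a ^+ 2)^-1)| <= e / 2 by near: T.
have h2 := poisson_kernel_approx _ _ _ _ a0 Ta (damped_continuous a b b0) (damped_holomorphic a b b0)
  (fun z => damped_bounded a b z a0 b0).
have cinv : {within `[- T, T], continuous (fun y => (y ^+ 2 + a ^+ 2)^-1)}.
  by apply: continuous_subspaceT; exact: continuous_invD.
have E : \int_[- T, T] (fun y => (complex.Re (damped a b (0 +i* y)) - complex.Re (damped a b a%:C)) / (y ^+ 2 + a ^+ 2))
   = \int_[- T, T] (damped_kernel a b) - k * \int_[- T, T] (fun y => (y ^+ 2 + a ^+ 2)^-1).
  rewrite -RintegralZl//; last exact: integrable_segment.
  rewrite -segment_integralB; [|exact: continuous_damped_kernel|].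
    by apply: eq_Rintegral => y _; rewrite mulrBl.
  by move=> y; apply: cvgM; [exact: cvg_cst|exact: cinv].
rewrite E in h2.
have h3 : 32 * (M * (a + b)) / T <= e / 2.
  rewrite ler_pdivrMr//; move: TM; rewrite ler_pdivrMr//; lra.
exact: ler_dist_half h1 (le_trans h2 h3).
Unshelve. all: by end_near. Qed.

End CauchyLimit.

Section WeightedEstimate.
Context {R : realType}.
Variables (f : R -> R) (F : R[i] -> R[i]) (M : R).
Hypothesis F_extends : forall x : R, 0 < x -> F x%:C = (f x)%:C.
Hypothesis F_holo : holomorphic_rhp F.
Hypothesis F_cont : {within closed_rhp : set R[i]^o, continuous (F : R[i]^o -> R[i]^o)}.
Hypothesis F_bounded : forall z, 0 <= complex.Re z -> modulus (F z) <= M.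
(** A pair in [s] is a weight and a node, and [s] acts as the functional summing weight times value
    at the node. [s_kernel] bounds this functional on the Cauchy kernels; the conclusion bounds it
    on [f]. *)
Variables (s : seq (R * R)) (rho lam : R).
Hypothesis s_pos : forall p, p \in s -> 0 < p.2.
Hypothesis lam_gt0 : 0 < lam.
Hypothesis s_kernel : forall y : R,
  modulus (\sum_(p <- s) p.1%:C / (p.2%:C - (0 +i* y))) <= rho / modulus (0 +i* y + lam%:C).
Hypothesis axis_fin : (axis_integral F lam < +oo)%E.

Let c_F := fine (axis_integral F lam).

Lemma Re_scale (x : R) z : complex.Re (x%:C * z) = x * complex.Re z.
Proof. by case: z => u v /=; rewrite mul0r subr0. Qed.

Lemma modulus_axis_continuous (h : R[i] -> R[i]) :
  {within closed_rhp : set R[i]^o, continuous (h : R[i]^o -> R[i]^o)} ->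
  continuous (fun y : R => modulus (h (0 +i* y))).
Proof.
move=> /within_continuous_modulusP ch y; apply/cvgrPdist_le => e e0.
have [r r0 hr] := ch (0 +i* y) (lexx 0) e e0; apply/nbhs_ballP; exists r => // y'.
rewrite /ball /= distrC => yy'.
have {}hr : modulus (h (0 +i* y') - h (0 +i* y)) <= e.
  apply: hr; first exact: lexx.
  by apply: le_lt_trans (ler_modulus_ReIm _) _; rewrite !complexRI /= subrr normr0 add0r.
apply: le_trans hr; rewrite distrC ler_norml lerNl opprB ler_sub_modulus andbT.
by rewrite (modulusB (h _)); exact: ler_sub_modulus.
Qed.

(** Written in the shape of [within_continuous_subl_div]; [GE] recovers the integrand of c_f. *)
Let G z := (F z - 0) / (z - - lam%:C).

Let GE y : G (0 +i* y) = F (0 +i* y) / (0 +i* y + lam%:C).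
Proof. by rewrite /G opprK subr0. Qed.

Let continuous_G : continuous (fun y : R => modulus (G (0 +i* y))).
Proof.
apply: modulus_axis_continuous; apply: (@within_continuous_subl_div _ F 0 (- lam%:C)) => // z z0.
exact: shift_neq0.
Qed.

Lemma segment_axis_integral_le T : 0 < T ->
  \int_[- T, T] (fun y => modulus (G (0 +i* y))) <= c_F.
Proof.
move=> T0; have cG : {within `[- T, T], continuous (fun y : R => modulus (G (0 +i* y)))}.
  exact: continuous_subspaceT.
have iG := integrable_segment _ _ _ cG.
rewrite /c_F /axis_integral /Rintegral fine_le//.
- exact: integrable_fin_num.
- rewrite ge0_fin_numE//; apply: integral_ge0 => y _; rewrite lee_fin; exact: modulus_ge0.
have -> : (\int[lebesgue_measure]_(y in [set: R]) (modulus (F (0 +i* y) / (0 +i* y + lam%:C)))%:E =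
  \int[lebesgue_measure]_(y in [set: R]) (modulus (G (0 +i* y)))%:E)%E.
  by apply: eq_integral => y _; rewrite GE.
apply: ge0_subset_integral => //; last by move=> y _; rewrite lee_fin modulus_ge0.
by apply/measurable_EFinP; exact: continuous_measurable_fun.
Qed.

Lemma damped_kernelE a b y : 0 < a -> 0 < b ->
  damped_kernel F a b y = complex.Re (F (0 +i* y) * (b%:C / (0 +i* y + b%:C)) / (a%:C - (0 +i* y))).
Proof.
move=> a0 b0; rewrite /damped_kernel /damped !opprK.
have n0 : y ^+ 2 + a ^+ 2 != 0 by rewrite gt_eqF// ltr_wpDl ?sqr_ge0// exprn_gt0.
have ay : a%:C - 0 +i* y != 0.
  by rewrite eq_complex !complexRI /= subr0 negb_and gt_eqF.
have -> : (0 +i* y + a%:C) = (y ^+ 2 + a ^+ 2)%:C / (a%:C - (0 +i* y)).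
  apply: (mulIf ay); rewrite divfK//; apply/eqP; rewrite eq_complex /=; apply/andP; split; apply/eqP; ring.
set k := y ^+ 2 + a ^+ 2 in n0 *; set w := b%:C / _; set v := _^-1.
have -> : F (0 +i* y) * (k%:C * v) * w = k%:C * (F (0 +i* y) * w * v) by ring.
by rewrite Re_scale mulrC mulKf.
Qed.

(** The damping factor does not depend on the node: it leaves the sum, with modulus at most 1 on the
    axis, and [s_kernel] governs what remains. *)
Lemma sum_damped_kernel_le b y : 0 < b ->
  `|\sum_(p <- s) p.1 * damped_kernel F p.2 b y| <= rho * modulus (G (0 +i* y)).
Proof.
move=> b0; set w := F (0 +i* y) * (b%:C / (0 +i* y + b%:C)).
have -> : \sum_(p <- s) p.1 * damped_kernel F p.2 b y =
    complex.Re (w * \sum_(p <- s) p.1%:C / (p.2%:C - (0 +i* y))).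
  rewrite mulr_sumr (big_morph (@complex.Re R) (id1 := 0) (op1 := +%R))//; last exact: Re_add.
  rewrite !big_seq; apply: eq_bigr => p /s_pos p0.
  by rewrite damped_kernelE// -/w [in RHS]mulrCA Re_scale.
apply: le_trans (ler_Re_modulus _) _; rewrite modulusM.
have yb0 : 0 < modulus (0 +i* y + b%:C) by rewrite modulus_gt0 -[b%:C]opprK shift_neq0 /=.
have wF : modulus w <= modulus (F (0 +i* y)).
  rewrite /w modulusM ler_piMr ?modulus_ge0// modulusM modulusV ler_pdivrMr// mul1r modulus_real.
  by apply: le_trans (ler_Re_modulus _); rewrite !complexRI /= add0r.
apply: le_trans (ler_pM (modulus_ge0 _) (modulus_ge0 _) wF (s_kernel y)) _.
by rewrite GE modulusM modulusV mulrCA.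
Qed.

Lemma sum_damped_integral b (r : seq (R * R)) T : 0 < b -> (forall p, p \in r -> 0 < p.2) ->
  {within `[- T, T], continuous (fun y => \sum_(p <- r) p.1 * damped_kernel F p.2 b y)} /\
  \int_[- T, T] (fun y => \sum_(p <- r) p.1 * damped_kernel F p.2 b y) =
  \sum_(p <- r) p.1 * \int_[- T, T] (damped_kernel F p.2 b).
Proof.
move=> b0; elim: r => [_|p r ih r_pos].
  have -> : (fun y => \sum_(p <- [::]) p.1 * damped_kernel F p.2 b y) = (fun=> 0).
    by apply/funext => y; rewrite big_nil.
  rewrite big_nil; split; first exact: within_continuous_segment_cst.
  by rewrite Rintegral_cst// mul0r.
have [|ihc ihE] := ih; first by move=> q qr; apply: r_pos; rewrite inE qr orbT.
have p0 : 0 < p.2 by apply: r_pos; rewrite mem_head.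
have cp := continuous_damped_kernel _ F_cont p.2 b T p0 b0.
have cpk : {within `[- T, T], continuous (fun y => p.1 * damped_kernel F p.2 b y)}.
  by move=> y; apply: cvgM; [exact: cvg_cst|exact: cp].
have -> : (fun y => \sum_(q <- p :: r) q.1 * damped_kernel F q.2 b y) =
    (fun y => p.1 * damped_kernel F p.2 b y + \sum_(q <- r) q.1 * damped_kernel F q.2 b y).
  by apply/funext => y; rewrite big_cons.
rewrite big_cons; split.
  by move=> y; apply: cvgD; [exact: cpk|exact: ihc].
rewrite RintegralD//; [|exact: integrable_segment|exact: integrable_segment].
by rewrite RintegralZl ?ihE//; exact: integrable_segment.
Qed.

Lemma cvg_sum_damped b (r : seq (R * R)) : 0 < b -> (forall p, p \in r -> 0 < p.2) ->
  \sum_(p <- r) p.1 * \int_[- T, T] (damped_kernel F p.2 b) @[T --> +oo] -->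
  2 * pi * \sum_(p <- r) p.1 * f p.2 * (b / (p.2 + b)).
Proof.
move=> b0; elim: r => [_|p r ih r_pos].
  have -> : (fun T => \sum_(q <- [::]) q.1 * \int_[- T, T] (damped_kernel F q.2 b)) = (fun=> 0).
    by apply/funext => T; rewrite big_nil.
  by rewrite big_nil mulr0; exact: cvg_cst.
have {}ih := ih (fun q qr => r_pos q (mem_behead (s := p :: r) qr)).
have p0 : 0 < p.2 by apply: r_pos; rewrite mem_head.
have -> : (fun T => \sum_(q <- p :: r) q.1 * \int_[- T, T] (damped_kernel F q.2 b)) =
    (fun T => p.1 * \int_[- T, T] (damped_kernel F p.2 b) + \sum_(q <- r) q.1 * \int_[- T, T] (damped_kernel F q.2 b)).
  by apply/funext => T; rewrite big_cons.
rewrite big_cons mulrDr; apply: cvgD; last exact: ih.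
have -> : 2 * pi * (p.1 * f p.2 * (b / (p.2 + b))) = p.1 * (2 * pi * (f p.2 * (b / (p.2 + b)))) by ring.
by apply: cvgM; [exact: cvg_cst|exact: (cvg_damped_integral _ _ M)].
Qed.

Lemma sum_damped_le b : 0 < b ->
  `|2 * pi * \sum_(p <- s) p.1 * f p.2 * (b / (p.2 + b))| <= rho * c_F.
Proof.
move=> b0; apply/ler_addgt0Pr => e e0.
have /cvgrPdist_le/(_ _ e0) near_e := cvg_sum_damped b s b0 s_pos.
have [T [T0 Te]] : exists T : R, 0 < T /\ `|2 * pi * \sum_(p <- s) p.1 * f p.2 * (b / (p.2 + b)) -
    \sum_(p <- s) p.1 * \int_[- T, T] (damped_kernel F p.2 b)| <= e.
  apply: (@filter_ex _ (pinfty_nbhs R)); near=> T; split; first by near: T; exact: nbhs_pinfty_gt.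
  by near: T.
have [cs Es] := sum_damped_integral b s T b0 s_pos.
have cG : {within `[- T, T], continuous (fun y : R => modulus (G (0 +i* y)))}.
  exact: continuous_subspaceT.
have rho0 : 0 <= rho.
  have := le_trans (modulus_ge0 _) (s_kernel 0); rewrite ler_pdivlMr ?mul0r//.
  by rewrite modulus_gt0 -[lam%:C]opprK shift_neq0 /=.
have : `|\sum_(p <- s) p.1 * \int_[- T, T] (damped_kernel F p.2 b)| <= rho * c_F.
  rewrite -Es; apply: le_trans (le_normr_Rintegral _ (integrable_segment _ _ _ cs)) _ => //.
  apply: le_trans (_ : \int_[- T, T] (fun y => rho * modulus (G (0 +i* y))) <= _).
    apply: le_Rintegral => //.
    - exact: integrable_norm (integrable_segment _ _ _ cs).
    - apply: integrable_segment => y; apply: cvgM; [exact: cvg_cst|exact: cG].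
    - by move=> y _; exact: sum_damped_kernel_le.
  rewrite RintegralZl//; last exact: integrable_segment.
  by apply: ler_wpM2l => //; exact: segment_axis_integral_le.
move: Te; set X := 2 * pi * _; set Y := \sum_(p <- s) _.
have := ler_normD (X - Y) Y; rewrite subrK; lra.
Unshelve. all: by end_near. Qed.

(** The damped sum obeys the bound for every b > 0. The undamped one exceeds it by the terms with
    factor p.2 / (p.2 + b), together at most W / b, and b is taken large enough to make this at most
    e. *)
Theorem weighted_estimate :
  `|\sum_(p <- s) p.1 * f p.2| <= rho * c_F / (2 * pi).
Proof.
have pi0 : 0 < 2 * pi :> R by rewrite mulr_gt0// pi_gt0.
apply/ler_addgt0Pr => e e0.
pose W := \sum_(p <- s) `|p.1 * f p.2| * p.2.
have W0 : 0 <= W.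
  by rewrite /W big_seq; apply: sumr_ge0 => p ps; rewrite mulr_ge0// ltW// s_pos.
have [b [b0 Wb]] : exists b : R, 0 < b /\ W / b <= e.
  exists (W / e + 1); have b0 : 0 < W / e + 1 by rewrite ltr_wpDl// divr_ge0// ltW.
  by split=> //; rewrite ler_pdivrMr// mulrDr mulrCA divff ?gt_eqF// !mulr1 lerDl ltW.
have -> : \sum_(p <- s) p.1 * f p.2 =
    \sum_(p <- s) p.1 * f p.2 * (b / (p.2 + b)) + \sum_(p <- s) p.1 * f p.2 * (p.2 / (p.2 + b)).
  rewrite -big_split /= !big_seq; apply: eq_bigr => p /s_pos p0.
  by rewrite -mulrDr -mulrDl [b + _]addrC divff ?mulr1// gt_eqF// addr_gt0.
apply: le_trans (ler_normD _ _) _; apply: lerD.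
  by have := sum_damped_le b b0; rewrite normrM gtr0_norm// ler_pdivlMr// mulrC.
apply: le_trans (ler_norm_sum _ _ _) _.
apply: le_trans Wb; rewrite /W mulr_suml big_seq [leRHS]big_seq; apply: ler_sum => p /s_pos p0.
  rewrite normrM -mulrA; apply: ler_wpM2l => //.
  rewrite ger0_norm ?divr_ge0 ?addr_ge0 ?(ltW p0) ?(ltW b0)//.
  apply: ler_wpM2l; first exact: ltW.
  rewrite lef_pV2 ?posrE; [by rewrite lerDr ltW|exact: addr_gt0|exact: b0].
Qed.

End WeightedEstimate.

(** * Rational interpolation at the mirrored poles *)

Section LagrangeBasis.
Context {K : fieldType} {k : nat}.
Implicit Types (a v : 'I_k -> K) (P : {poly K}).

Definition lagrange_basis a j : {poly K} :=
  \prod_(i < k | i != j) ((a j - a i)^-1 *: ('X - (a i)%:P)).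

Definition lagrange_interp a v : {poly K} := \sum_(j < k) v j *: lagrange_basis a j.

Lemma lagrange_basisE a j x :
  (lagrange_basis a j).[x] = \prod_(i < k | i != j) ((x - a i) / (a j - a i)).
Proof.
rewrite /lagrange_basis horner_prod; apply: eq_bigr => i _.
by rewrite hornerZ hornerXsubC mulrC.
Qed.

Lemma lagrange_basis_node a i j : injective a -> (lagrange_basis a j).[a i] = (i == j)%:R.
Proof.
move=> a_inj; rewrite lagrange_basisE; have [->|ij] := eqVneq i j.
  by rewrite big1// => l lj; rewrite divff// subr_eq0 (inj_eq a_inj) eq_sym.
by rewrite (bigD1 i)//= subrr !mul0r.
Qed.

Lemma size_lagrange_basis a j : (size (lagrange_basis a j) <= k)%N.
Proof.
have k0 : (0 < k)%N by apply: leq_ltn_trans (ltn_ord j).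
apply: leq_trans (size_poly_prod_leq _ _) _.
rewrite leq_subLR; apply: leq_trans (_ : (\sum_(i < k | i != j) 2).+1 <= _)%N.
  rewrite ltnS; apply: leq_sum => i _; apply: leq_trans (size_scale_leq _ _) _.
  by rewrite size_XsubC.
rewrite sum_nat_const; set c := #|_|.
have cE : c = k.-1 by rewrite /c cardC1 card_ord.
by rewrite cE; case: (k) k0 => // m _ /=; lia.
Qed.

Lemma size_lagrange_interp a v : (size (lagrange_interp a v) <= k)%N.
Proof.
apply: leq_trans (size_sum _ _ _) _; apply/bigmax_leqP => j _.
exact: leq_trans (size_scale_leq _ _) (size_lagrange_basis a j).
Qed.

Lemma lagrange_interp_node a v i : injective a -> (lagrange_interp a v).[a i] = v i.
Proof.
move=> a_inj; rewrite /lagrange_interp horner_sum (bigD1 i)//= big1 => [|j ji].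
  by rewrite hornerZ lagrange_basis_node// eqxx mulr1 addr0.
by rewrite hornerZ lagrange_basis_node// eq_sym (negbTE ji) mulr0.
Qed.

Lemma lagrange_interpK a P : injective a -> (size P <= k)%N ->
  P = lagrange_interp a (fun j => P.[a j]).
Proof.
move=> a_inj sP; apply/eqP; rewrite -subr_eq0; apply: contraT => D0.
have := @max_poly_roots _ _ [seq a j | j <- enum 'I_k] D0.
rewrite size_map size_enum_ord map_inj_uniq// enum_uniq.
have -> : all (root (P - lagrange_interp a (fun j => P.[a j]))) [seq a j | j <- enum 'I_k].
  apply/allP => _ /mapP[j _ ->].
  by rewrite /root hornerD hornerN lagrange_interp_node// subrr.
move=> /(_ isT isT); rewrite ltnNge; apply: contraNT => _.
apply: leq_trans (size_polyD _ _) _; rewrite size_polyN geq_max sP.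
exact: size_lagrange_interp.
Qed.
End LagrangeBasis.

Section RationalInterpolation.
Context {K : fieldType} {k : nat}.
Variables (a xi : 'I_k -> K).
Hypothesis a_inj : injective a.

Let N : {poly K} := \prod_(j < k) ('X - (a j)%:P).
Let Q : {poly K} := \prod_(j < k) ('X - (xi j)%:P).

(* The function [1 / (X - w)] is interpolated at the [a j] by [P / Q] with
   [P = (Q - (Q(w) / N(w)) N) / (X - w)]. *)
Lemma cauchy_kernel_interpolation x w : Q.[x] != 0 -> N.[w] != 0 -> x != w -> (forall j, a j != w) ->
  (x - w)^-1 - \sum_(j < k) (Q.[a j] * (lagrange_basis a j).[x] / Q.[x]) / (a j - w) =
  N.[x] / Q.[x] * (Q.[w] / N.[w]) / (x - w).
Proof.
move=> Qx Nw xw aw; set c := Q.[w] / N.[w].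
have xw0 : x - w != 0 by rewrite subr_eq0.
have : root (Q - c *: N) w.
  by rewrite /root hornerD hornerN hornerZ /c divfK// subrr.
move/factor_theorem => [P PE].
have PX z : P.[z] * (z - w) = Q.[z] - c * N.[z].
  by rewrite -(hornerXsubC w z) -hornerM -PE hornerD hornerN hornerZ.
have sQ : size Q = k.+1 by rewrite size_prod_XsubC [index_enum _]unlock -enumT size_enum_ord.
have sN : size N = k.+1 by rewrite size_prod_XsubC [index_enum _]unlock -enumT size_enum_ord.
(* [Q] and [N] have degree k; dividing by X - w leaves at most k coefficients, which the k nodes
   determine. *)
have sP : (size P <= k)%N.
  have [->|P0] := eqVneq P 0; first by rewrite size_poly0.
  have : (size (P * ('X - w%:P))%R <= k.+1)%N.
    rewrite -PE; apply: leq_trans (size_polyD _ _) _; rewrite size_polyN geq_max sQ leqnn /=.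
    by apply: leq_trans (size_scale_leq _ _) _; rewrite sN.
  by rewrite size_Mmonic ?monicXsubC// size_XsubC addn2.
have Pa j : P.[a j] = Q.[a j] / (a j - w).
  have aj0 : a j - w != 0 by rewrite subr_eq0.
  apply: (mulIf aj0); rewrite divfK// PX.
  have -> : N.[a j] = 0.
    by rewrite horner_prod (bigD1 j)//= hornerXsubC subrr mul0r.
  by rewrite mulr0 subr0.
have -> : \sum_(j < k) (Q.[a j] * (lagrange_basis a j).[x] / Q.[x]) / (a j - w) = P.[x] / Q.[x].
  rewrite [in RHS](lagrange_interpK _ _ a_inj sP) horner_sum mulr_suml; apply: eq_bigr => j _.
  by rewrite hornerZ Pa; ring.
have -> : P.[x] = (Q.[x] - c * N.[x]) / (x - w) by rewrite -PX mulfK.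
by field; rewrite ?Qx ?xw0 ?Nw.
Qed.
End RationalInterpolation.

Section RationalApproximation.
Context {R : realType}.

Lemma modulus1 : modulus 1 = 1 :> R.
Proof. by rewrite -[1]/(1%:C) modulus_real normr1. Qed.

Lemma modulus_prod (I : Type) (r : seq I) (P : pred I) (h : I -> R[i]) :
  modulus (\prod_(i <- r | P i) h i) = \prod_(i <- r | P i) modulus (h i).
Proof. by apply: (big_morph _ (@modulusM R)); exact: modulus1. Qed.

Lemma real_complex_prod (I : Type) (r : seq I) (P : pred I) (h : I -> R) :
  (\prod_(i <- r | P i) h i)%:C = \prod_(i <- r | P i) (h i)%:C.
Proof. exact: (rmorph_prod (real_complex R)). Qed.

Lemma real_complex_sum (I : Type) (r : seq I) (P : pred I) (h : I -> R) :
  (\sum_(i <- r | P i) h i)%:C = \sum_(i <- r | P i) (h i)%:C.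
Proof. exact: (raddf_sum (real_complex R)). Qed.

(** For each x the interpolation error is a functional to which [weighted_estimate] applies: weight
    1 at x and minus the interpolation weights at the mirrored poles. The functional varies with x
    while the polynomial stays fixed. *)
Theorem rational_approximation (k : nat) (xi : 'I_k -> R) (f : R -> R) (F : R[i] -> R[i]) (lam : R) :
  injective xi -> (forall j, xi j < 0) -> laplace_stieltjes f ->
  (forall x : R, 0 < x -> F x%:C = (f x)%:C) -> analytic_on_slit_plane F ->
  0 < lam -> (axis_integral F lam < +oo)%E ->
  exists p : {poly R[i]}, (size p <= k.+1)%N /\ forall x : R, lam <= x ->
    modulus (F x%:C - p.[x%:C] / (pole_poly xi).[x%:C]) <=
    modulus (pole_ratio xi x%:C) * fine (axis_integral F lam) / (2 * pi).
Proof.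
move=> xi_inj xi_lt0 f_LS F_ext F_an lam0 axis_fin.
have F_holo := analytic_holomorphic_rhp _ F_an.
have F_cont := analytic_continuous_closed_rhp _ F_an.
have [M F_bd] := laplace_stieltjes_bounded _ _ f_LS F_ext F_an.
pose cx j := (xi j)%:C; pose ca j := (- xi j)%:C.
have ca_inj : injective ca by move=> i j [] /oppr_inj; exact: xi_inj.
pose Q : {poly R[i]} := \prod_(j < k) ('X - (cx j)%:P).
pose N : {poly R[i]} := \prod_(j < k) ('X - (ca j)%:P).
have QE z : Q.[z] = \prod_(j < k) (z - cx j).
  by rewrite horner_prod; apply: eq_bigr => j _; rewrite hornerXsubC.
have NE z : N.[z] = \prod_(j < k) (z - ca j).
  by rewrite horner_prod; apply: eq_bigr => j _; rewrite hornerXsubC.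
(* Multiplying the data by [Q] makes the quotient p / Q, rather than p, take the values of [f] at
   the mirrored poles. *)
exists (lagrange_interp ca (fun j => (f (- xi j))%:C * Q.[ca j])).
split; first by apply: leq_trans (size_lagrange_interp _ _) (leqnSn k).
move=> x lamx; have x0 : 0 < x by exact: lt_le_trans lamx.
rewrite -[pole_poly xi]/Q.
have Qr (y : R) : Q.[y%:C] = (\prod_(j < k) (y - xi j))%:C.
  by rewrite QE real_complex_prod; apply: eq_bigr => j _; rewrite rmorphB.
have Qx : Q.[x%:C] != 0.
  rewrite QE; apply/prodf_neq0 => j _; rewrite -rmorphB fmorph_eq0 gt_eqF//.
  by rewrite subr_gt0 (lt_trans (xi_lt0 j)).
pose l j := \prod_(i < k | i != j) ((x - - xi i) / (- xi j - - xi i)).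
(* The coefficient of f(- xi j) in p(x) / Q(x), written over [R] because [weighted_estimate] takes
   real weights. *)
pose t j := (\prod_(i < k) (- xi j - xi i)) * l j / \prod_(i < k) (x - xi i).
have tE j : (t j)%:C = Q.[ca j] * (lagrange_basis ca j).[x%:C] / Q.[x%:C].
  rewrite /t rmorphM rmorphM fmorphV /= -!Qr; congr (_ * _ / _).
  rewrite lagrange_basisE /l real_complex_prod; apply: eq_bigr => i _.
  by rewrite rmorphM fmorphV !rmorphB.
pose s := (1, x) :: [seq (- t j, - xi j) | j <- enum 'I_k].
have s_pos p : p \in s -> 0 < p.2.
  rewrite inE => /orP[/eqP -> //|/mapP[j _ ->]] /=.
  by rewrite oppr_gt0.
have sumE (h : R -> R -> R[i]) : \sum_(p <- s) h p.1 p.2 = h 1 x + \sum_(j < k) h (- t j) (- xi j).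
  by rewrite big_cons big_map big_enum.
pose rho := modulus (pole_ratio xi x%:C).
have rhoE : rho = modulus (N.[x%:C] / Q.[x%:C]).
  rewrite /rho /pole_ratio prodf_div NE QE; congr (modulus (_ / _)).
  by apply: eq_bigr => j _; rewrite /ca rmorphN opprK.
have s_kernel y : modulus (\sum_(p <- s) p.1%:C / (p.2%:C - (0 +i* y))) <=
    rho / modulus (0 +i* y + lam%:C).
  set w : R[i] := 0 +i* y.
  have Re_neq (r : R) : r != 0 -> r%:C - w != 0.
    by move=> r0; rewrite eq_complex !complexRI /= subr0 negb_and r0.
  have Nw : N.[w] != 0.
    rewrite NE; apply/prodf_neq0 => j _; rewrite -opprB oppr_eq0; apply: Re_neq.
    by rewrite oppr_eq0 lt_eqF.
  (* A purely imaginary w is equidistant from xi j and its mirror image - xi j. *)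
  have QN : modulus (Q.[w] / N.[w]) = 1.
    rewrite modulusM modulusV; have -> : modulus Q.[w] = modulus N.[w].
      rewrite QE NE !modulus_prod; apply: eq_bigr => j _; rewrite !modulusE !complexRI /=.
      by rewrite !sub0r !opprK sqrrN.
    by rewrite divff// modulus_eq0.
  rewrite (sumE (fun c a => c%:C / (a%:C - w))) div1r.
  have -> : \sum_(j < k) (- t j)%:C / ((- xi j)%:C - w) =
      - \sum_(j < k) (Q.[ca j] * (lagrange_basis ca j).[x%:C] / Q.[x%:C]) / (ca j - w).
    by rewrite -sumrN; apply: eq_bigr => j _; rewrite -tE rmorphN mulNr.
  have xw : x%:C != w by rewrite -subr_eq0 Re_neq// gt_eqF.
  have aw j : ca j != w by rewrite -subr_eq0 Re_neq// oppr_eq0 lt_eqF.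
  rewrite (@cauchy_kernel_interpolation _ _ ca cx ca_inj x%:C w Qx Nw xw aw).
  rewrite -/N -/Q (modulusM _ (x%:C - w)^-1) (modulusM (_ / _)) QN mulr1 -rhoE modulusV; apply: ler_wpM2l; first exact: modulus_ge0.
  have lw : 0 < modulus (w + lam%:C).
    by rewrite modulus_gt0 -[lam%:C]opprK shift_neq0.
  (* As x >= lam > 0, |x - i y| >= |lam + i y|: the kernel at x is replaced by the weight that
     occurs in c_f. *)
  rewrite lef_pV2 ?posrE ?lw//; last by rewrite modulus_gt0 Re_neq ?gt_eqF.
  rewrite !modulusE; apply: ler_wsqrtr; rewrite !complexRI /= subr0 add0r addr0 sub0r sqrrN lerD2r.
  by apply: lerXn2r; rewrite ?nnegrE ?(ltW lam0) ?(ltW x0).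
have := @weighted_estimate _ f F M F_ext F_holo F_cont F_bd s rho lam s_pos lam0 s_kernel axis_fin.
rewrite -modulus_real real_complex_sum.
under eq_bigr do rewrite rmorphM.
rewrite (sumE (fun c a => c%:C * (f a)%:C)) /= mul1r F_ext// => h.
apply: le_trans h; rewrite le_eqVlt; apply/orP; left; apply/eqP; congr (modulus (_ + _)).
rewrite /lagrange_interp horner_sum mulr_suml -sumrN; apply: eq_bigr => j _.
have tN : (- t j)%:C = - (Q.[ca j] * (lagrange_basis ca j).[x%:C] / Q.[x%:C]) by rewrite -tE rmorphN.
by rewrite hornerZ tN; ring.
Qed.
End RationalApproximation.

(** * Matrix functions *)

Section SimilarDiagonal.
Local Open Scope sesquilinear_scope.
Context {K : fieldType}.

Lemma eigenvalue_similar_diag n (A S : 'M[K]_n) (d : 'rV_n) a : S \in unitmx ->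
  A = invmx S *m diag_mx d *m S -> eigenvalue A a <-> exists i, a = d 0 i.
Proof.
move=> Su AE; split=> [/eigenvalueP[v]|[i ->]].
  rewrite AE => /(congr1 (mulmx^~ (invmx S))); rewrite !mulmxA mulmxK// -scalemxAl => vE v0.
  have /rV0Pn[i vi] : v *m invmx S != 0.
    by apply: contraNneq v0 => /(congr1 (mulmx^~ S)); rewrite mulmxKV// mul0mx => ->.
  exists i; move: vE => /rowP/(_ i); move: (v *m invmx S) vi => w wi.
  by rewrite mul_mx_diag !mxE mulrC => /(mulIf wi).
apply/eigenvalueP; exists (delta_mx 0 i *m S).
  rewrite AE !mulmxA mulmxK// scalemxAl; congr (_ *m _); apply/rowP => j.
  by rewrite mul_mx_diag !mxE eqxx /=; case: eqP => [->|_]; rewrite ?mul1r ?mulr1 ?mul0r ?mulr0.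
apply/eqP => /(congr1 (mulmx^~ (invmx S))); rewrite mulmxK// mul0mx => /rowP/(_ i).
by rewrite !mxE !eqxx => /eqP; rewrite oner_eq0.
Qed.

Lemma horner_mx_similar_diag n (A S : 'M[K]_n.+1) (d : 'rV_n.+1) (p : {poly K}) :
  S \in unitmx -> A = invmx S *m diag_mx d *m S ->
  horner_mx A p = invmx S *m diag_mx (map_mx (fun x => p.[x]) d) *m S.
Proof. by move=> Su ->; rewrite horner_mx_uconjC// horner_mx_diag. Qed.

(** The minimal polynomial of a diagonalizable matrix divides a product of distinct linear factors.
    In [hermite_interpolates] only j = 0 is then left, so no derivatives enter. *)
Lemma mup_mxminpoly_similar_diag n (A S : 'M[K]_n.+1) (d : 'rV_n.+1) z : S \in unitmx ->
  A = invmx S *m diag_mx d *m S -> (mup z (mxminpoly A) <= 1)%N.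
Proof.
move=> Su AE; have /diagonalizableP[rs urs dv] : diagonalizable A.
  by exists S => //; apply/similar_diagPex; exists d; apply/similarP => //; rewrite AE !mulmxA mulmxV// mul1mx.
have m0 : mxminpoly A != 0 by rewrite monic_neq0// mxminpoly_monic.
rewrite leqNgt mup_geq//; apply/negP => /dvdp_trans/(_ dv){}dv.
have z_rs : z \in rs.
  rewrite -root_prod_XsubC -dvdp_XsubCl; apply: dvdp_trans dv.
  by rewrite expr2 dvdp_mulr.
move: dv; rewrite (big_rem z)//= expr2 dvdp_mul2l ?polyXsubC_eq0 -?size_poly_eq0 ?size_XsubC//.
by rewrite dvdp_XsubCl root_prod_XsubC mem_rem_uniqF.
Qed.
End SimilarDiagonal.

Section MatrixFunctionDiagonalizable.
Local Open Scope sesquilinear_scope.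
Context {R : realType}.
Implicit Types (f : R[i] -> R[i]).

Lemma matfun_diagonalizable n f (A S : 'M[R[i]]_n.+1) (d : 'rV_n.+1) : S \in unitmx ->
  A = invmx S *m diag_mx d *m S -> matfun f A = invmx S *m diag_mx (map_mx f d) *m S.
Proof.
move=> Su AE; have mup1 z := mup_mxminpoly_similar_diag _ _ _ _ z Su AE.
have eigA z := eigenvalue_similar_diag _ _ _ _ z Su AE.
have m0 : mxminpoly A != 0 by rewrite monic_neq0// mxminpoly_monic.
have rootE z : (0 < mup z (mxminpoly A))%N = eigenvalue A z.
  by rewrite -XsubC_dvd// dvdp_XsubCl eigenvalue_root_min.
have d_root i : (0 < mup (d 0%R i) (mxminpoly A))%N.
  by rewrite rootE; apply/eigA; exists i.
(* An interpolant exists, so the [xget] in [matfun] does not fall back on 0. Repeated diagonal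
   entries are merged to make the nodes distinct. *)
have [p pP] : exists p, hermite_interpolates f A p.
  pose rs := undup [seq d 0 i | i <- enum 'I_n.+1].
  pose a (j : 'I_(size rs)) := rs`_j.
  have a_inj : injective a.
    by move=> i j /eqP; rewrite nth_uniq ?undup_uniq// => /eqP; exact: val_inj.
  exists (lagrange_interp a (fun j => f (a j))) => z j jz.
  have j0 : j = 0%N by have := leq_trans jz (mup1 z); case: (j).
  have z_rs : z \in rs.
    have := leq_ltn_trans (leq0n j) jz; rewrite rootE => /eigA[i ->].
    by rewrite mem_undup; apply/mapP; exists i; rewrite ?mem_enum.
  have zi : (index z rs < size rs)%N by rewrite index_mem.
  have -> : z = a (Ordinal zi) by rewrite /a /= nth_index.
  by rewrite j0 /= lagrange_interp_node.
have hP : hermite_interpolates f A (xget 0 [set p | hermite_interpolates f A p]).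
  exact: (xgetPex 0 (ex_intro _ p pP)).
rewrite /matfun; move: (xget _ _) hP => P hP.
rewrite (horner_mx_similar_diag _ _ _ _ P Su AE).
have Pf : map_mx (fun x => P.[x]) d = map_mx f d.
  by apply/rowP => i; rewrite !mxE; have := hP (d 0 i) 0%N (d_root i).
exact: (congr1 (fun X => invmx S *m diag_mx X *m S) Pf).
Qed.
End MatrixFunctionDiagonalizable.

Section HermitianNorm.
Local Open Scope sesquilinear_scope.
Context {C : numClosedFieldType}.

Definition sqn n (x : 'cV[C]_n) : C := (x^t* *m x) 0 0.

Lemma sqnE n (x : 'cV[C]_n) : sqn n x = \sum_i `|x i 0| ^+ 2.
Proof. by rewrite /sqn mxE; apply: eq_bigr => i _; rewrite !mxE normCKC. Qed.

Lemma adjM m n p (A : 'M[C]_(m, n)) (B : 'M[C]_(n, p)) : (A *m B)^t* = B^t* *m A^t*.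
Proof. by rewrite trmx_mul map_mxM. Qed.

Lemma adjB m n (A B : 'M[C]_(m, n)) : (A - B)^t* = A^t* - B^t*.
Proof. by apply/matrixP => i j; rewrite !mxE rmorphB. Qed.

Lemma sqn_ge0 n (x : 'cV[C]_n) : 0 <= sqn n x.
Proof. by rewrite sqnE sumr_ge0// => i _; rewrite exprn_ge0. Qed.

Lemma sqn_isometry n m (W : 'M[C]_(n, m)) x : W^t* *m W = 1%:M -> sqn n (W *m x) = sqn m x.
Proof. by move=> W1; rewrite /sqn adjM -mulmxA (mulmxA (W^t*)) W1 mul1mx. Qed.

Lemma sqn_bessel n m (W : 'M[C]_(n, m)) b : W^t* *m W = 1%:M -> sqn m (W^t* *m b) <= sqn n b.
Proof.
move=> W1; rewrite -subr_ge0.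
have -> : sqn n b - sqn m (W^t* *m b) = sqn n (b - W *m (W^t* *m b)).
  rewrite /sqn adjB !adjM trmxCK mulmxBl !mulmxBr -!mulmxA (mulmxA (W^t*) W) W1 mul1mx.
  by rewrite subrr subr0 !mxE.
exact: sqn_ge0.
Qed.

Lemma sqn_diag_le n (g : 'rV[C]_n) x (E : C) : (forall i, `|g 0 i| <= E) ->
  sqn n (diag_mx g *m x) <= E ^+ 2 * sqn n x.
Proof.
move=> gE; rewrite !sqnE mulr_sumr; apply: ler_sum => i _.
rewrite mul_diag_mx !mxE normrM exprMn; apply: ler_wpM2r; first exact: exprn_ge0.
by apply: lerXn2r; rewrite ?nnegrE// (le_trans _ (gE i)).
Qed.

(** The parallelogram identity with |u + v|^2 dropped. For two vectors of squared norm at most E^2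
    it gives 4 E^2, as sharp as the triangle inequality and without square roots. *)
Lemma sqnB_le n (x y : 'cV[C]_n) : sqn n (x - y) <= 2 * (sqn n x + sqn n y).
Proof.
rewrite !sqnE -big_split /= mulr_sumr; apply: ler_sum => i _; rewrite !mxE.
set u := x i 0; set v := y i 0.
rewrite -subr_ge0.
have -> : 2 * (`|u| ^+ 2 + `|v| ^+ 2) - `|u - v| ^+ 2 = `|u + v| ^+ 2.
  by rewrite !normCK rmorphB rmorphD; ring.
by rewrite exprn_ge0.
Qed.

Lemma hermitian_spectral n (A : 'M[C]_n) : A^t* = A ->
  exists P d, [/\ P \is unitarymx & A = invmx P *m diag_mx d *m P].
Proof.
move=> AA; exists (spectralmx A), (spectral_diag A); split; first exact: spectral_unitarymx.
by apply/orthomx_spectralP/normalmxP; rewrite AA.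
Qed.

Lemma rayleigh n (A P : 'M[C]_n) (d : 'rV_n) (x : 'cV[C]_n) : P \is unitarymx ->
  A = invmx P *m diag_mx d *m P -> (x^t* *m A *m x) 0 0 = \sum_i d 0 i * `|(P *m x) i 0| ^+ 2.
Proof.
move=> Pu AE; rewrite AE invmx_unitary// -!mulmxA mulmxA -adjM mulmxA mxE.
by apply: eq_bigr => i _; rewrite mul_mx_diag !mxE normCKC mulrAC mulrC mulrA.
Qed.

(** In a unitary eigenbasis the Rayleigh quotient is a convex combination of the eigenvalues. *)
Lemma rayleigh_bounds n (A : 'M[C]_n) (x : 'cV[C]_n) lo hi : A^t* = A ->
  (forall a, eigenvalue A a -> lo <= a <= hi) -> sqn n x = 1 ->
  lo <= (x^t* *m A *m x) 0 0 <= hi.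
Proof.
move=> /hermitian_spectral[P [d [Pu AE]]] bounds x1.
have Punit : P \in unitmx by exact: unitarymx_unit.
have Px : \sum_i `|(P *m x) i 0| ^+ 2 = 1.
  rewrite -sqnE sqn_isometry//; apply/eqP.
  by rewrite -invmx_unitary// mulVmx.
have dI i : lo <= d 0 i <= hi.
  by apply: bounds; apply/(eigenvalue_similar_diag _ _ _ _ _ Punit AE); exists i.
rewrite (rayleigh _ _ _ _ _ Pu AE) -[lo]mulr1 -[hi]mulr1 -Px !mulr_sumr.
apply/andP; split; apply: ler_sum => i _; apply: ler_wpM2r; rewrite ?exprn_ge0//;
  by have /andP[] := dI i.
Qed.

(** [schmidt] orthonormalizes rows, hence the passage through adjoints. *)
Lemma qr_decomposition n m (V : 'M[C]_(n, m)) : \rank V = m ->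
  exists Q R, [/\ Q^t* *m Q = 1%:M, R \in unitmx & V = Q *m R].
Proof.
move=> rV; have mn : (m <= n)%N by rewrite -rV rank_leq_row.
have rVt : \rank (V^t*) = m by rewrite mxrank_map mxrank_tr.
pose T := schmidt (V^t*).
have Tu : T \is unitarymx by exact: schmidt_unitarymx.
have /submxP[Y YE] : (V^t* <= T)%MS by exact: schmidt_sub.
exists (T^t*), (Y^t*); split.
- by rewrite trmxCK; exact/unitarymxP.
- rewrite -row_free_unit /row_free eqn_leq rank_leq_row /=.
  rewrite -{1}rV -[V]trmxCK YE adjM; exact: mxrankM_maxr.
- by rewrite -adjM -YE trmxCK.
Qed.
End HermitianNorm.

(** * Compression to the rational Krylov space *)

Section MoorePenrose.
Local Open Scope sesquilinear_scope.
Context {C : numClosedFieldType}.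

(** Full column rank forces [Z *m V] to be the identity. Then [V *m Z] and [V *m Y] are Hermitian
    projections with the same range, hence equal. *)
Lemma moore_penrose_unique n m (Q : 'M[C]_(n, m)) (R : 'M[C]_m) (Z : 'M[C]_(m, n)) :
  Q^t* *m Q = 1%:M -> R \in unitmx ->
  (Q *m R) *m Z *m (Q *m R) = Q *m R -> Z *m (Q *m R) *m Z = Z ->
  ((Q *m R) *m Z)^t* = (Q *m R) *m Z ->
  Z = invmx R *m Q^t*.
Proof.
move=> Q1 Ru h1 h2 h3; set V := Q *m R in h1 h2 h3; set Y := invmx R *m Q^t*.
have YV : Y *m V = 1%:M by rewrite /Y /V mulmxA -(mulmxA (invmx R)) Q1 mulmx1 mulVmx.
have ZV : Z *m V = 1%:M by rewrite -[LHS]mul1mx -YV -(mulmxA Y) (mulmxA V) h1.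
have VYh : (V *m Y)^t* = V *m Y.
  have -> : V *m Y = Q *m Q^t* by rewrite /V /Y mulmxA mulmxK.
  by rewrite adjM trmxCK.
have VZY : V *m Z *m (V *m Y) = V *m Y by rewrite -mulmxA (mulmxA Z) ZV mul1mx.
have VYZ : V *m Y *m (V *m Z) = V *m Z by rewrite -mulmxA (mulmxA Y) YV mul1mx.
have : V *m Z = V *m Y by rewrite -VYZ -[in RHS]VYh -[in RHS]VZY adjM h3 VYh.
by move=> VE; rewrite -[Z]mul1mx -YV -mulmxA VE mulmxA YV mul1mx.
Qed.

Lemma qr_moore_penrose n m (Q : 'M[C]_(n, m)) (R : 'M[C]_m) :
  Q^t* *m Q = 1%:M -> R \in unitmx ->
  let V := Q *m R in let Z := invmx R *m Q^t* in
  [/\ V *m Z *m V = V, Z *m V *m Z = Z, (V *m Z)^t* = V *m Z & (Z *m V)^t* = Z *m V].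
Proof.
move=> Q1 Ru V Z.
have ZV : Z *m V = 1%:M by rewrite /Z /V mulmxA -(mulmxA (invmx R)) Q1 mulmx1 mulVmx.
have VZ : V *m Z = Q *m Q^t* by rewrite /V /Z mulmxA mulmxK.
split; first by rewrite -mulmxA ZV mulmx1.
- by rewrite ZV mul1mx.
- by rewrite VZ adjM trmxCK.
- by rewrite ZV; apply/matrixP => i j; rewrite !mxE rmorph_nat eq_sym.
Qed.
End MoorePenrose.

Section Compression.
Local Open Scope sesquilinear_scope.
Context {C : numClosedFieldType} {n k : nat}.
Variables (A : 'M[C]_n.+1) (b : 'cV[C]_n.+1) (lo hi : C) (p q : {poly C}).
Hypothesis A_herm : A^t* = A.
Hypothesis A_spec : forall a, eigenvalue A a -> lo <= a <= hi.
Hypothesis size_p : (size p <= k.+1)%N.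
Hypothesis size_q : (size q <= k.+1)%N.
Hypothesis q_neq0 : forall z, lo <= z <= hi -> q.[z] != 0.
Variables (Phi : C -> C) (E : C).
Hypothesis Phi_approx : forall z, lo <= z <= hi -> `|Phi z - p.[z] / q.[z]| <= E.


(** With this starting vector the rational Krylov space is an ordinary one, spanned by the
    [A ^+ j *m c] with j <= k. *)
Let c : 'cV[C]_n.+1 := invmx (horner_mx A q) *m b.

Lemma horner_mx_sum m (B : 'M[C]_m.+1) (s : {poly C}) : (size s <= k.+1)%N ->
  horner_mx B s = \sum_(j < k.+1) s`_j *: B ^+ j.
Proof.
move=> ss; have {1}-> : s = \sum_(j < k.+1) s`_j *: 'X^j.
  rewrite -poly_def; apply/polyP => j; rewrite coef_poly; case: ltnP => // kj.
  by rewrite nth_default// (leq_trans ss).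
rewrite raddf_sum /=; apply: eq_bigr => j _.
by rewrite horner_mxZ rmorphXn /= horner_mx_X.
Qed.

(** Phi(A) b and its Krylov approximation are both compared with p(A) q(A)^-1 b, which the Krylov
    space reproduces exactly; each error comes from Phi - p / q, bounded by E on the spectrum
    concerned. The conclusion exhibits diagonalizations so that [matfun_diagonalizable] can
    translate both terms. *)
Theorem hermitian_compression (V : 'M[C]_(n.+1, k.+1)) : \rank V = k.+1 ->
  (forall j, (j <= k)%N -> exists v, A ^+ j *m c = V *m v) ->
  exists (P : 'M[C]_n.+1) (d : 'rV[C]_n.+1) (S : 'M[C]_k.+1) (e : 'rV[C]_k.+1)
    (Z : 'M[C]_(k.+1, n.+1)),
  [/\ P \in unitmx /\ A = invmx P *m diag_mx d *m P,
      S \in unitmx /\ Z *m A *m V = invmx S *m diag_mx e *m S,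
      [/\ V *m Z *m V = V, Z *m V *m Z = Z, (V *m Z)^t* = V *m Z & (Z *m V)^t* = Z *m V],
      (forall Z', V *m Z' *m V = V -> Z' *m V *m Z' = Z' -> (V *m Z')^t* = V *m Z' -> Z' = Z) &
      sqn _ (invmx P *m diag_mx (map_mx Phi d) *m P *m b -
             V *m (invmx S *m diag_mx (map_mx Phi e) *m S) *m Z *m b) <= 4 * E ^+ 2 * sqn _ b].
Proof.
move=> rV krylov; have [Q [Rm [Q1 Ru VE]]] := qr_decomposition _ _ _ rV.
have [P [d [Pu AE]]] := hermitian_spectral _ _ A_herm.
have Punit := unitarymx_unit Pu.
pose B := Q^t* *m A *m Q.
have B_herm : B^t* = B by rewrite /B !adjM trmxCK A_herm mulmxA.
have [U [e [Uu BE]]] := hermitian_spectral _ _ B_herm.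
have Uunit := unitarymx_unit Uu.
have UU : U *m U^t* = 1%:M by exact/unitarymxP.
have UU' : U^t* *m U = 1%:M by rewrite -invmx_unitary// mulVmx.
(* An orthonormal basis of the range of [V] in which the compression of [A] is diagonal. *)
pose W := Q *m U^t*.
have W1 : W^t* *m W = 1%:M by rewrite /W adjM trmxCK -mulmxA (mulmxA (Q^t*)) Q1 mul1mx.
have WAW : W^t* *m A *m W = diag_mx e.
  have -> : W^t* *m A *m W = U *m B *m U^t* by rewrite /W adjM trmxCK /B !mulmxA.
  by rewrite BE invmx_unitary// !mulmxA UU mul1mx -mulmxA UU mulmx1.
have d_bounds i : lo <= d 0 i <= hi.
  by apply: A_spec; apply/(eigenvalue_similar_diag _ _ _ _ _ Punit AE); exists i.
(* Each eigenvalue of the compression is a Rayleigh quotient of [A] at a unit vector. *)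
have e_bounds i : lo <= e 0 i <= hi.
  pose x : 'cV[C]_k.+1 := delta_mx i 0.
  have -> : e 0 i = ((W *m x)^t* *m A *m (W *m x)) 0 0.
    have -> : (W *m x)^t* *m A *m (W *m x) = x^t* *m (diag_mx e *m x).
      by rewrite -WAW adjM !mulmxA.
    rewrite mul_diag_mx mxE (bigD1 i)//= big1 => [|j ji].
      by rewrite !mxE !eqxx rmorph1 mul1r mulr1 addr0.
    by rewrite !mxE (negbTE ji) rmorph0 mul0r.
  apply: rayleigh_bounds => //; rewrite sqn_isometry// sqnE (bigD1 i)//= big1 => [|j ji].
    by rewrite !mxE !eqxx normr1 expr1n addr0.
  by rewrite !mxE (negbTE ji) normr0 expr0n.
have VW : V = W *m (U *m Rm) by rewrite /W -mulmxA (mulmxA (U^t*)) UU' mul1mx.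
have proj j : (j <= k)%N -> W *m (W^t* *m (A ^+ j *m c)) = A ^+ j *m c.
  by move=> /krylov[v ->]; rewrite VW -(mulmxA W) (mulmxA (W^t*)) W1 mul1mx.
(* One factor [A] at a time: as long as the lower power applied to [c] lies in the range of [W], the
   product W^t* A acts on it as diag(e) W^t*. *)
have WA j : (j <= k)%N -> W^t* *m (A ^+ j *m c) = diag_mx e ^+ j *m (W^t* *m c).
  elim: j => [|j ih] jk; first by rewrite !expr0 !mul1mx.
  have jk' : (j <= k)%N by exact: ltnW.
  have -> : A ^+ j.+1 *m c = A *m (A ^+ j *m c) by rewrite exprS mulmxA.
  have -> : diag_mx e ^+ j.+1 *m (W^t* *m c) = diag_mx e *m (W^t* *m (A ^+ j *m c)).
    by rewrite ih// exprS mulmxA.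
  by rewrite -[in LHS](proj j jk') -WAW !mulmxA.
have Wpoly (s : {poly C}) : (size s <= k.+1)%N ->
    W^t* *m (horner_mx A s *m c) = diag_mx (map_mx (horner s) e) *m (W^t* *m c).
  move=> ss; rewrite -horner_mx_diag !horner_mx_sum// !mulmx_suml mulmx_sumr.
  apply: eq_bigr => j _; rewrite -!scalemxAl -scalemxAr WA//.
  by rewrite -ltnS.
have projp : W *m (W^t* *m (horner_mx A p *m c)) = horner_mx A p *m c.
  rewrite horner_mx_sum// mulmx_suml !mulmx_sumr; apply: eq_bigr => j _.
  by rewrite -scalemxAl -!scalemxAr proj// -ltnS.
have hornerA (s : {poly C}) : horner_mx A s = invmx P *m diag_mx (map_mx (horner s) d) *m P.
  by rewrite AE horner_mx_uconjC// horner_mx_diag.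
have qd_inv : diag_mx (map_mx (horner q) d) *m diag_mx (map_mx (fun z => q.[z]^-1) d) = 1%:M.
  rewrite mulmx_diag; apply/matrixP => i j; rewrite !mxE.
  by case: eqP => //= _; rewrite divff ?q_neq0.
have cE : c = invmx P *m diag_mx (map_mx (fun z => q.[z]^-1) d) *m P *m b.
  have qA1 : horner_mx A q *m (invmx P *m diag_mx (map_mx (fun z => q.[z]^-1) d) *m P) = 1%:M.
    rewrite hornerA !mulmxA mulmxK// -(mulmxA (invmx P)) qd_inv mulmx1.
    by rewrite mulVmx.
  have qAu : horner_mx A q \in unitmx by case/mulmx1_unit: qA1.
  by rewrite /c -[RHS]mul1mx -(mulVmx qAu) -(mulmxA (invmx _)) (mulmxA (horner_mx A q)) qA1 mul1mx.
have qc : horner_mx A q *m c = b.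
  rewrite cE hornerA !mulmxA mulmxK// -(mulmxA (invmx P)) qd_inv mulmx1.
  by rewrite mulVmx// mul1mx.
pose X := invmx P *m diag_mx (map_mx Phi d) *m P *m b - horner_mx A p *m c.
pose Y := W *m (diag_mx (map_mx Phi e) *m (W^t* *m b)) - horner_mx A p *m c.
have P1 : (invmx P)^t* *m invmx P = 1%:M by rewrite invmx_unitary// trmxCK; exact/unitarymxP.
have PP1 : P^t* *m P = 1%:M by rewrite -invmx_unitary// mulVmx.
have XE : sqn _ X <= E ^+ 2 * sqn _ b.
  have -> : X = invmx P *m (diag_mx (map_mx (fun z => Phi z - p.[z] / q.[z]) d) *m (P *m b)).
    rewrite /X cE hornerA !mulmxA mulmxK// -(mulmxA (invmx P) (diag_mx (map_mx (horner p) d))) mulmx_diag.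
    rewrite -mulmxBl -mulmxBl -mulmxBr.
    congr (_ *m _ *m _ *m _); rewrite -raddfB; congr diag_mx.
    by apply/rowP => i; rewrite !mxE.
  rewrite sqn_isometry//; apply: le_trans (sqn_diag_le _ _ _ E _) _.
    by move=> i; rewrite mxE; exact: Phi_approx.
  by rewrite sqn_isometry.
have YE : sqn _ Y <= E ^+ 2 * sqn _ b.
  (* Since b = q(A) c, this rewrites p(e) W^t* c as (p / q)(e) W^t* b, where the approximation
     hypothesis applies. *)
  have WbE : W^t* *m b = diag_mx (map_mx (horner q) e) *m (W^t* *m c) by rewrite -Wpoly// qc.
  have -> : Y = W *m (diag_mx (map_mx (fun z => Phi z - p.[z] / q.[z]) e) *m (W^t* *m b)).
    rewrite /Y -projp Wpoly// -mulmxBr; congr (_ *m _); rewrite WbE.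
    move: (W^t* *m c) => y; rewrite !mulmxA !mulmx_diag -mulmxBl; congr (_ *m _); rewrite -raddfB; congr diag_mx; apply/rowP => i; rewrite !mxE.
    by rewrite mulrBl divfK ?q_neq0.
  rewrite sqn_isometry//; apply: le_trans (sqn_diag_le _ _ _ E _) _.
    by move=> i; rewrite mxE; exact: Phi_approx.
  apply: ler_wpM2l; last exact: sqn_bessel.
  by rewrite exprn_ge0// (le_trans _ (Phi_approx _ (d_bounds 0))).
have [MP1 MP2 MP3 MP4] := qr_moore_penrose _ _ _ _ Q1 Ru.
rewrite -VE in MP1 MP2 MP3 MP4.
exists P, d, (U *m Rm), e, (invmx Rm *m Q^t*).
have Su : U *m Rm \in unitmx by rewrite unitmx_mul Uunit.
have Sinv : invmx (U *m Rm) = invmx Rm *m U^t*.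
  apply: (can_inj (mulKmx Su)); rewrite mulmxV// mulmxA -(mulmxA U) mulmxV// mulmx1.
  by rewrite UU.
split.
- by split.
- split=> //; rewrite Sinv VE.
  have -> : invmx Rm *m Q^t* *m A *m (Q *m Rm) = invmx Rm *m B *m Rm by rewrite /B !mulmxA.
  by rewrite BE (invmx_unitary Uu) !mulmxA.
- by split.
- by move=> Z'; rewrite VE => h1 h2 h3; exact: moore_penrose_unique h1 h2 h3.
have -> : V *m (invmx (U *m Rm) *m diag_mx (map_mx Phi e) *m (U *m Rm)) *m (invmx Rm *m Q^t*) *m b =
    W *m (diag_mx (map_mx Phi e) *m (W^t* *m b)).
  have VS : V *m invmx (U *m Rm) = W by rewrite VW mulmxK.
  have SZ : (U *m Rm) *m (invmx Rm *m Q^t*) = W^t*.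
    by rewrite mulmxA -(mulmxA U) mulmxV// mulmx1 /W adjM trmxCK.
  have assoc (X1 X2 X3 : 'M[C]_k.+1) (X4 : 'M[C]_(k.+1, n.+1)) :
      V *m (X1 *m X2 *m X3) *m X4 *m b = V *m X1 *m (X2 *m (X3 *m X4 *m b)).
    by rewrite !mulmxA.
  by rewrite assoc VS SZ.
rewrite (_ : _ - _ = X - Y); last by rewrite /X /Y opprB addrA subrK.
apply: le_trans (sqnB_le _ _ _) _; rewrite -mulrA -[4]/(2 * 2)%:R natrM -mulrA ler_pM2l// mulr_natl mulr2n.
exact: lerD.
Qed.
End Compression.

Section SpectrumBounds.
Local Open Scope sesquilinear_scope.
Context {R : realType}.

Lemma positive_definite_eigenvalue n (L : 'M[R]_n) a :
  positive_definite L -> eigenvalue L a -> 0 < a.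
Proof.
move=> Lpd /eigenvalueP[v vL v0]; have := Lpd (v^T)%R.
rewrite trmxK vL -scalemxAl mxE trmx_eq0 => /(_ v0); apply: contraTT; rewrite -!leNgt => a0.
rewrite mxE; apply: mulr_le0_ge0 => //; apply: sumr_ge0 => i _.
by rewrite mxE -expr2 sqr_ge0.
Qed.

Lemma diagonalizable_similar_diag n (L : 'M[R]_n) : diagonalizable L ->
  exists P d, P \in unitmx /\ L = invmx P *m diag_mx d *m P.
Proof.
case=> P Pu /similar_diagPex[d /(similarP Pu) PL]; exists P, d; split=> //.
by rewrite -mulmxA -PL mulmxA mulVmx// mul1mx.
Qed.

Section Diagonalizable.
Variables (n : nat) (L P : 'M[R]_n.+1) (d : 'rV[R]_n.+1).
Hypothesis Pu : P \in unitmx.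
Hypothesis LE : L = invmx P *m diag_mx d *m P.

Let eigL a : eigenvalue L a <-> exists i, a = d 0 i.
Proof. exact: eigenvalue_similar_diag Pu LE. Qed.

(** [lambda_min] and [lambda_max] are an [inf] and a [sup]; the attained extrema supply the bounds
    that give them meaning. *)
Let spectrum_extrema : exists i j, forall a, eigenvalue L a -> d 0 i <= a <= d 0 j.
Proof.
case: (@arg_minP _ _ _ ord0 predT (fun i => d 0 i) isT) => i _ hi.
case: (@arg_maxP _ _ _ ord0 predT (fun i => d 0 i) isT) => j _ hj.
exists i, j => a /eigL[l ->]; apply/andP; split; first exact: hi.
exact: hj.
Qed.

Lemma eigenvalue_Sigma a : eigenvalue L a -> Sigma L a.
Proof.
have [i [j ij]] := spectrum_extrema => La; rewrite /Sigma /= in_itv /=; apply/andP; split.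
  apply: ge_inf => //; exists (d 0 i) => b Lb; by have /andP[] := ij b Lb.
apply: ub_le_sup => //; exists (d 0 j) => b Lb; by have /andP[] := ij b Lb.
Qed.

Lemma lambda_min_eigenvalue : eigenvalue L (lambda_min L).
Proof.
have [i [j ij]] := spectrum_extrema.
suff -> : lambda_min L = d 0 i by apply/eigL; exists i.
have Li : eigenvalue L (d 0 i) by apply/eigL; exists i.
apply/eqP; rewrite eq_le; apply/andP; split.
  by apply: ge_inf => //; exists (d 0 i) => b Lb; have /andP[] := ij b Lb.
apply: lb_le_inf; first by exists (d 0 i).
by move=> b Lb; have /andP[] := ij b Lb.
Qed.

Lemma toC_similar_diag : toC P \in unitmx /\
  toC L = invmx (toC P) *m diag_mx (map_mx (real_complex R) d) *m toC P.
Proof.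
split; first by rewrite /toC map_unitmx.
by rewrite LE /toC !map_mxM map_invmx map_diag_mx.
Qed.

Lemma toC_eigenvalue z : eigenvalue (toC L) z -> exists2 a, z = a%:C & Sigma L a.
Proof.
have [PCu LCE] := toC_similar_diag.
move=> /(eigenvalue_similar_diag _ _ _ _ _ PCu LCE)[i ->]; exists (d 0 i); first by rewrite mxE.
by apply: eigenvalue_Sigma; apply/eigL; exists i.
Qed.
End Diagonalizable.

Lemma enorm_ge0 n (x : 'cV[R[i]]_n) : 0 <= enorm x.
Proof. exact: sqrtr_ge0. Qed.

Lemma sqn_enorm n (x : 'cV[R[i]]_n) : sqn _ x = (enorm x ^+ 2)%:C.
Proof.
rewrite sqnE /enorm sqr_sqrtr; last by apply: sumr_ge0 => i _; exact: sqr_ge0.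
by rewrite real_complex_sum; apply: eq_bigr => i _; rewrite normr_modulus rmorphXn.
Qed.

Lemma adj_toC m n (A : 'M[R]_(m, n)) : (toC A)^t* = toC (A^T)%R.
Proof.
by apply/matrixP => i j; rewrite !mxE; apply: conj_Creal; rewrite realE -[0]/(0%:C) !lecR le_total.
Qed.
End SpectrumBounds.

(** * Quasi-optimality for symmetric matrices *)

Section SymmetricCase.
Local Open Scope sesquilinear_scope.
Context {R : realType}.

Lemma moore_penrose_eq m n (V : 'M[R[i]]_(m, n)) Z : is_moore_penrose V Z ->
  (forall Z', is_moore_penrose V Z' -> Z' = Z) -> moore_penrose V = Z.
Proof. by move=> VZ uniq; apply: uniq; exact: (xgetPex 0 (ex_intro _ Z VZ)). Qed.

(** Powers of [L] commute with q_k(L)^-1, and a unit coefficient family selects one of them. *)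
Lemma krylov_power n k (L : 'M[R]_n.+1) b (xi : 'I_k -> R) j : (j <= k)%N ->
  rational_krylov L b xi
    (toC L ^+ j *m (invmx (horner_mx (toC L) (pole_poly xi)) *m toC b)).
Proof.
rewrite -ltnS => jk; exists (fun i => (i == Ordinal jk)%:R) => //=.
rewrite (bigD1 (Ordinal jk))//= eqxx scale1r big1 ?addr0 => [|i /negbTE ->]; last by rewrite scale0r.
set A := toC L; set B := horner_mx A _.
have AB : GRing.comm (A ^+ j) (invmx B).
  apply: commrV; rewrite /GRing.comm -(horner_mx_X A) -rmorphXn /= -!rmorphM /=.
  by rewrite mulrC.
by rewrite !mulmxA; congr (_ *m _); exact: esym AB.
Qed.

Theorem symmetric_quasi_optimality n k (L : 'M[R]_n.+1) (b : 'cV[R]_n.+1) (xi : 'I_k -> R)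
    (V : 'M[R[i]]_(n.+1, k.+1)) (F : R[i] -> R[i]) (p : {poly R[i]}) (E : R) :
  diagonalizable L -> L^T = L -> columns_basis V (rational_krylov L b xi) ->
  (size p <= k.+1)%N -> (forall x, Sigma L x -> (pole_poly xi).[x%:C] != 0) ->
  (forall x, Sigma L x -> modulus (F x%:C - p.[x%:C] / (pole_poly xi).[x%:C]) <= E) ->
  enorm (matfun F (toC L) *m toC b - krylov_approx F L b V) <= 2 * E * enorm (toC b).
Proof.
move=> Ldiag Lsym [rV VE] size_p q0 FE.
have [P0 [d0 [P0u LE]]] := diagonalizable_similar_diag _ _ Ldiag.
have A_herm : (toC L)^t* = toC L by rewrite adj_toC Lsym.
(* Comparable elements of [R[i]] have equal imaginary parts, so an interval with real ends consists
   of real numbers. *)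
have inS z : (lambda_min L)%:C <= z <= (lambda_max L)%:C -> exists2 x, z = x%:C & Sigma L x.
  case: z => x y; rewrite !lecE /= => /andP[/andP[/eqP y0 h1] /andP[_ h2]].
  by exists x; [rewrite y0|rewrite /Sigma /= in_itv /= h1].
have A_spec a : eigenvalue (toC L) a -> (lambda_min L)%:C <= a <= (lambda_max L)%:C.
  move=> /(toC_eigenvalue _ _ _ _ P0u LE)[x ->]; rewrite /Sigma /= in_itv /= => /andP[h1 h2].
  by rewrite !lecR h1.
have size_q : (size (pole_poly xi) <= k.+1)%N.
  by rewrite size_prod_XsubC [index_enum _]unlock -enumT size_enum_ord.
have q_neq0 z : (lambda_min L)%:C <= z <= (lambda_max L)%:C -> (pole_poly xi).[z] != 0.
  by move=> /inS[x -> xS]; exact: q0.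
have Phi_approx z : (lambda_min L)%:C <= z <= (lambda_max L)%:C ->
    `|F z - p.[z] / (pole_poly xi).[z]| <= E%:C.
  by move=> /inS[x -> xS]; rewrite normr_modulus lecR; exact: FE.
have krylov j : (j <= k)%N -> exists v,
    toC L ^+ j *m (invmx (horner_mx (toC L) (pole_poly xi)) *m toC b) = V *m v.
  by move=> jk; have := krylov_power _ _ L b xi _ jk; rewrite VE => -[v _ <-]; exists v.
have [P [d [S [e [Z [[Pu AE] [Su ME] VZ Z_uniq err]]]]]] :=
  @hermitian_compression R[i] n k (toC L) (toC b) _ _ p (pole_poly xi) A_herm A_spec size_p size_q q_neq0
    F E%:C Phi_approx V rV krylov.
have ZE : moore_penrose V = Z.
  by apply: moore_penrose_eq => // Z' [h1 h2 h3 _]; exact: Z_uniq.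
rewrite /krylov_approx ZE (matfun_diagonalizable _ F _ _ _ Pu AE) (matfun_diagonalizable _ F _ _ _ Su ME).
move: err; rewrite !sqn_enorm; set X := enorm _; set Y := enorm _ => err.
have E0 : 0 <= E.
  have : Sigma L (lambda_min L) by apply: (eigenvalue_Sigma _ _ _ _ P0u LE); exact: (lambda_min_eigenvalue _ _ _ _ P0u LE).
  by move=> /FE; apply: le_trans; exact: modulus_ge0.
rewrite -(ler_pXn2r (_ : 0 < 2)%N) ?nnegrE ?enorm_ge0 ?mulr_ge0 ?enorm_ge0//.
have scaleE (a c : R) : (4 * a ^+ 2 * c)%:C = 4 * a%:C ^+ 2 * c%:C.
  by rewrite (rmorphM (real_complex R)) (rmorphM (real_complex R)) (rmorphXn (real_complex R)) rmorph_nat.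
by rewrite -lecR (_ : (2 * E * Y) ^+ 2 = 4 * E ^+ 2 * Y ^+ 2) ?scaleE//; ring.
Qed.
End SymmetricCase.

(** * The error bound in the maximum norm *)

Section MaximumNorm.
Context {R : realType}.

(** A set without supremum has [sup] equal to 0, so the bound holds in that case too. *)
Lemma sup_nonneg (S : set R) : (forall x, S x -> 0 <= x) -> 0 <= sup S.
Proof.
move=> S0; have [hs|hs] := pselect (has_sup S); last by rewrite sup_out.
have [[x Sx] ub] := hs; exact: le_trans (S0 x Sx) (ub_le_sup ub Sx).
Qed.

Lemma maxnorm_ge0 (S : set R) g : 0 <= maxnorm S g.
Proof. by apply: sup_nonneg => _ [x _ <-]; exact: modulus_ge0. Qed.

Lemma opnorm_ge0 n (A : 'M[R[i]]_n) : 0 <= opnorm A.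
Proof. by apply: sup_nonneg => _ [x _ <-]; exact: enorm_ge0. Qed.

Lemma maxnorm_le (S : set R) g (E : R) x0 : S x0 ->
  (forall x, S x -> modulus (g x%:C) <= E) -> maxnorm S g <= E.
Proof.
move=> Sx0 gE; apply: ge_sup; first by exists (modulus (g x0%:C)), x0.
by move=> _ [x Sx <-]; exact: gE.
Qed.

(** A positive x is nearer to - xi j than to xi j. The resulting boundedness makes the [sup] in
    [maxnorm] a genuine upper bound of |r_Xi|. *)
Lemma pole_ratio_le1 k (xi : 'I_k -> R) x : (forall j, xi j < 0) -> 0 < x ->
  modulus (pole_ratio xi x%:C) <= 1.
Proof.
move=> xi0 x0; rewrite /pole_ratio modulus_prod.
apply: prodr_ile1 => j _.
apply/andP; split; first exact: modulus_ge0.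
rewrite modulusM modulusV -rmorphD -rmorphB !modulus_real.
have h := xi0 j; rewrite [X in _ / X]gtr0_norm ?ler_pdivrMr ?mul1r; [|lra|lra].
by rewrite ler_norml; apply/andP; split; lra.
Qed.

(** The constant function 1, of maximum norm 1, serves as test function. The sign is needed to
    multiply the approximation bound by C. *)
Lemma crouzeix_constant_ge0 n (L : 'M[R]_n.+1) (C : R) x0 : Sigma L x0 ->
  crouzeix_estimate L C -> 0 <= C.
Proof.
move=> Lx0 /(_ (fun=> 1)) h.
have {}h := le_trans (opnorm_ge0 _ _) (h _).
have m1 : maxnorm (Sigma L) (fun=> 1) = 1.
  apply/eqP; rewrite eq_le; apply/andP; split.
    by apply: (maxnorm_le _ _ _ x0) => // x _; rewrite modulus1.
  rewrite -[leLHS](@modulus1 R); apply: ub_le_sup; last by exists x0.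
  by exists 1 => _ [x _ <-]; rewrite modulus1.
rewrite m1 mulr1 pmulr_rge0// in h; apply: h.
by apply: continuous_subspaceT => x; exact: cvg_cst.
Qed.
End MaximumNorm.

Theorem theorem8 (R : realType) (n k : nat)
  (L : 'M[R]_n.+1) (b : 'cV[R]_n.+1)
  (xi : 'I_k -> R) (V : 'M[R[i]]_(n.+1, k.+1))
  (f : R -> R) (F : R[i] -> R[i]) (C : R)
  (L_diag : diagonalizable L)
  (L_posdef : positive_definite L)
  (xi_distinct : injective xi)
  (xi_range : forall j : 'I_k, Sigma L (- xi j))
  (V_basis : columns_basis V (rational_krylov L b xi))
  (f_LS : laplace_stieltjes f)
  (F_extends : forall x : R, 0 < x -> F x%:C = (f x)%:C)
  (F_analytic : analytic_on_slit_plane F)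
  (C_bound : C <= 1108%:R / 100%:R)
  (C_selfadjoint : L^T = L -> C = 1)
  (C_crouzeix : L^T <> L -> crouzeix_estimate L C)
  (C_quasi_optimal : L^T <> L -> quasi_optimality F L b xi V C)
  (c_f_finite : (axis_integral F (lambda_min L) < +oo)%E) :
  enorm (matfun F (toC L) *m toC b - krylov_approx F L b V)
  <= C * fine (axis_integral F (lambda_min L)) / pi
     * enorm (toC b) * maxnorm (Sigma L) (pole_ratio xi).
Proof.
have [P0 [d0 [P0u LE]]] := diagonalizable_similar_diag _ _ L_diag.
have lmin_eig := lambda_min_eigenvalue _ _ _ _ P0u LE.
have lmin_Sigma := eigenvalue_Sigma _ _ _ _ P0u LE _ lmin_eig.
have lmin_gt0 := positive_definite_eigenvalue _ _ _ L_posdef lmin_eig.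
have Sigma_ge x : Sigma L x -> lambda_min L <= x.
  by rewrite /Sigma /= in_itv /= => /andP[].
have xi_lt0 j : xi j < 0.
  by rewrite -oppr_gt0; apply: lt_le_trans lmin_gt0 (Sigma_ge _ (xi_range j)).
have [p [size_p pE]] := rational_approximation _ _ _ _ _ xi_distinct xi_lt0 f_LS F_extends F_analytic
  lmin_gt0 c_f_finite.
set c := fine _ in pE *; set m := maxnorm _ _.
have c0 : 0 <= c.
  by apply: fine_ge0; apply: integral_ge0 => y _; rewrite lee_fin modulus_ge0.
have pi0 := pi_gt0 R.
(* The uniform error of p / q_k on [Sigma L]; the 2 in its denominator absorbs the factor 2 of
   quasi-optimality. *)
pose E := m * c / (2 * pi).
have FE x : Sigma L x -> modulus (F x%:C - p.[x%:C] / (pole_poly xi).[x%:C]) <= E.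
  move=> Lx; apply: le_trans (pE x (Sigma_ge x Lx)) _; rewrite /E -!mulrA.
  apply: ler_wpM2r; first by rewrite mulr_ge0// invr_ge0 mulr_ge0// ltW.
  apply: ub_le_sup; last by exists x.
  exists 1 => _ [y Ly <-]; apply: pole_ratio_le1 => //.
  exact: lt_le_trans lmin_gt0 (Sigma_ge y Ly).
have -> : C * c / pi * enorm (toC b) * m = 2 * C * enorm (toC b) * E.
  by rewrite /E; move: (pi : R) pi0 => w w0; field; rewrite gt_eqF.
have [Lsym|Lnsym] := pselect (L^T = L).
  have q_neq0 x : Sigma L x -> (pole_poly xi).[x%:C] != 0.
    move=> Lx; rewrite horner_prod; apply/prodf_neq0 => j _.
    rewrite hornerXsubC -rmorphB fmorph_eq0 gt_eqF// subr_gt0.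
    by rewrite (lt_trans (xi_lt0 j))// (lt_le_trans lmin_gt0)// Sigma_ge.
  rewrite (C_selfadjoint Lsym) mulr1 mulrAC.
  exact: (symmetric_quasi_optimality _ _ L b xi V F p E L_diag Lsym V_basis size_p q_neq0 FE).
have C0 := crouzeix_constant_ge0 _ _ _ _ lmin_Sigma (C_crouzeix Lnsym).
apply: le_trans (C_quasi_optimal Lnsym) _; apply: ler_wpM2l.
  by rewrite !mulr_ge0// enorm_ge0.
(* The interpolant is one competitor in the infimum, which is bounded below by 0. *)
apply: le_trans (_ : maxnorm (Sigma L) (fun z => F z - p.[z] / (pole_poly xi).[z]) <= _).
  apply: ge_inf; last by exists p.
  by exists 0 => _ [r _ <-]; exact: maxnorm_ge0.
exact: maxnorm_le lmin_Sigma FE.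
Qed.
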